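(* Let $n\ge 2$, and fix $\alpha\ge 0$ and $\beta\in\mathbb{R}$ with $\alpha^2+\beta^2=1$. For every $v=(v_1,v_2,0)\in T_{e_3}\mathbb{S}^2$ there is a unique global solution $\psi:[0,\infty)\to\mathbb{S}^2\subset\mathbb{R}^3$ of the self-similar problem $$-\frac r2\left(\alpha\,\psi\times\psi_r+\beta\,\psi_r\right)=\psi\times\left(\psi_{rr}+\frac{2n-1}{r}\psi_r+\frac{2n-2+\psi_3}{r^2}e_3\right),\quad r>0,\qquad \psi(0)=e_3,\quad \psi'(0)=v .$$ The solution is smooth for $r>0$. In the non-trivial case, when $v\ne 0$, the solution has the following properties: 1. For all $r>0$, $\psi(r)\ne e_3$. 2. If $\alpha>0$ then $|\psi_r|\lesssim 1/r^3$ (that is, there is a constant $C$, independent of $r$, with $|\psi_r(r)|\le C/r^3$ for all $r>0$). If $\alpha=0$ then $r|\psi_r(r)|\to 0$ as $r\to\infty$. 3. There exists a point $\psi_\infty\in\mathbb{S}^2$, $\psi_\infty\neq e_3$, such that $\lim_{r\to\infty}\psi(r)=\psi_\infty$. Consequently, $\mathcal{E}(\psi)=\infty$. 4. The limit $\psi_\infty$ depends continuously on $v$; in particular, $\lim_{v\to 0}\psi_\infty=e_3$.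
   Context: $\mathbb{S}^2\subset\mathbb{R}^3$ is the unit sphere, $e_3=(0,0,1)$, $\times$ is the cross product on $\mathbb{R}^3$, and $\psi=(\psi_1,\psi_2,\psi_3)$. By a solution we mean a function that is $C^1$ on $[0,\infty)$ and $C^2$ on $(0,\infty)$, satisfying the equation for $r>0$ and the initial conditions at $r=0$. For a radial map $u:\mathbb{R}^{2n}\to\mathbb{S}^2$, $u=u(r)$, $r=|x|$, the energy is $$\mathcal{E}(u)=\frac12\int_{\mathbb{R}^{2n}}\left(|u_r|^2+\frac{u_1^2+u_2^2+(2n-2)|u-e_3|^2}{r^2}\right)dx\in[0,\infty].$$ The ODE describes profiles $\psi$ of self-similar solutions $u(r,t)=\psi(r/\sqrt t)$ of the equivariant generalized Landau-Lifshitz equation $u_t=(\alpha P+\beta u\times)\left(u_{rr}+\frac{2n-1}{r}u_r+\frac{2n-2+u_3}{r^2}e_3\right)$, where $P$ is the orthogonal projection onto $T_u\mathbb{S}^2$. *)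

(* Defs.v *)
From HB Require Import structures.
From mathcomp Require Import all_boot all_order all_algebra.
From mathcomp Require Import all_classical all_reals all_analysis.

Set Implicit Arguments.
Unset Strict Implicit.
Unset Printing Implicit Defensive.

Import Order.TTheory GRing.Theory Num.Theory.
Import numFieldNormedType.Exports.

Local Open Scope ring_scope.
Local Open Scope classical_set_scope.

Section euclidean_space.
Context {R : realType}.

Definition dotp {d : nat} (u v : 'rV[R]_d) : R := \sum_i u 0 i * v 0 i.

(* The library norm `|u| on row vectors is the sup norm. *)
Definition enorm {d : nat} (u : 'rV[R]_d) : R := Num.sqrt (dotp u u).

(* Indices are added in 'I_3, that is, modulo 3. *)
Definition crossp (u v : 'rV[R]_3) : 'rV[R]_3 :=
  \row_i (u 0 (i + 1) * v 0 (i + 2) - u 0 (i + 2) * v 0 (i + 1)).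

Definition e3 : 'rV[R]_3 := delta_mx 0 2.

Definition sphere2 : set 'rV[R]_3 := [set p | enorm p = 1].

Definition tangent_sphere2 (p : 'rV[R]_3) : set 'rV[R]_3 :=
  [set v | dotp v p = 0].

End euclidean_space.

Section half_line_regularity.
Context {R : realType} {V : normedModType R}.
Implicit Types (f : R -> V) (l : V).

Definition Ck_pos (k : nat) f : Prop :=
  (forall (j : nat) (r : R), (j < k)%N -> 0 < r -> derivable (f^`(j)) r 1) /\
  (forall r : R, 0 < r -> {for r, continuous (f^`(k))}).

Definition smooth_pos f : Prop := forall k, Ck_pos k f.

Definition is_right_derive0 f l : Prop :=
  h^-1 *: (f h - f 0) @[h --> 0^'+] --> l.

Definition C1_nonneg f : Prop :=
  Ck_pos 1 f /\
  exists2 l, is_right_derive0 f l & f^`() r @[r --> 0^'+] --> l.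

End half_line_regularity.

Section lebesgue_tuple.
Context {R : realType}.
Local Open Scope ereal_scope.

Definition tuple_of_pair {n : nat} (p : measurableTypeR R * n.-tuple (measurableTypeR R)) :
  n.+1.-tuple (measurableTypeR R) := [tuple of p.1 :: p.2].

Fixpoint lebesgue_tuple (n : nat) :
    set (n.-tuple (measurableTypeR R)) -> \bar R :=
  match n with
  | 0 => \d_[tuple]
  | m.+1 => pushforward (@lebesgue_measure R \x @lebesgue_tuple m)
              (@tuple_of_pair m)
  end.

Let measurable_tuple_of_pair n :
  measurable_fun [set: measurableTypeR R * n.-tuple (measurableTypeR R)]
    (@tuple_of_pair n).
Proof. by apply: measurable_cons; [exact: measurable_fst|exact: measurable_snd]. Qed.

Let pair_of_tuple n (t : n.+1.-tuple (measurableTypeR R)) :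
  measurableTypeR R * n.-tuple (measurableTypeR R) := (thead t, [tuple of behead t]).

Let measurable_pair_of_tuple n :
  measurable_fun [set: n.+1.-tuple (measurableTypeR R)] (@pair_of_tuple n).
Proof.
apply/measurable_fun_pairP; split.
  exact: (measurable_tnth ord0).
exact: measurable_behead.
Qed.

Let tuple_of_pairK n : cancel (@tuple_of_pair n) (@pair_of_tuple n).
Proof.
by move=> [x t]; congr pair; apply/val_inj.
Qed.

Lemma lebesgue_tuple_sigma_finite_measure n :
  exists m : {sigma_finite_measure set (n.-tuple (measurableTypeR R)) -> \bar R},
    (m : set _ -> \bar R) = @lebesgue_tuple n.
Proof.
elim: n => [|n [m mE]]; first by exists (\d_[tuple]).
rewrite /= -mE.
pose Q : {measure set (n.+1.-tuple (measurableTypeR R)) -> \bar R} :=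
  measure_function_pushforward__canonical__measure_function_Measure
    (@lebesgue_measure R \x m) (@measurable_tuple_of_pair n).
have sfQ : sigma_finite setT Q.
  have /sigma_finiteP[F [TF ndF Foo]] := sigma_finiteT (@lebesgue_measure R).
  have /sigma_finiteP[G [TG ndG Goo]] := sigma_finiteT m.
  exists (fun k => @pair_of_tuple n @^-1` (F k `*` G k)).
    apply/esym; rewrite -subTset => t _.
    have [i _ Fi] : (\bigcup_k F k) (pair_of_tuple t).1 by rewrite -TF.
    have [j _ Gj] : (\bigcup_k G k) (pair_of_tuple t).2 by rewrite -TG.
    exists (maxn i j) => //; split => /=.
      by move: Fi; exact/subsetPset/ndF/leq_maxl.
    by move: Gj; exact/subsetPset/ndG/leq_maxr.
  move=> k; have [mF Fk] := Foo k; have [mG Gk] := Goo k; split.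
    rewrite -[X in measurable X]setTI; apply: measurable_pair_of_tuple => //.
    exact: measurableX.
  rewrite /Q /= /pushforward -comp_preimage.
  rewrite (_ : _ \o _ = id) ?preimage_id; last first.
    by apply/funext => x /=; rewrite tuple_of_pairK.
  by rewrite product_measure1E// lte_mul_pinfty// ge0_fin_numE.
pose H1 := isSigmaFinite.Build _ _ _ _ sfQ.
pose H2 := isSFinite.Build _ _ _ _ (sfinite_measure_sigma_finite sfQ).
pose Q' := HB.pack_for (SigmaFiniteMeasure.type
  (n.+1.-tuple (measurableTypeR R)) R) (Measure.sort Q) H1 H2.
by exists Q'.
Qed.

Let lebesgue_tuple0 n : @lebesgue_tuple n set0 = 0.
Proof. by have [m <-] := lebesgue_tuple_sigma_finite_measure n; exact: measure0. Qed.

Let lebesgue_tuple_ge0 n A : 0 <= @lebesgue_tuple n A.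
Proof. by have [m <-] := lebesgue_tuple_sigma_finite_measure n; exact: measure_ge0. Qed.

Let lebesgue_tuple_sigma_additive n : semi_sigma_additive (@lebesgue_tuple n).
Proof.
have [m <-] := lebesgue_tuple_sigma_finite_measure n.
exact: measure_semi_sigma_additive.
Qed.

HB.instance Definition _ n := isMeasure.Build _ _ _ (@lebesgue_tuple n)
  (lebesgue_tuple0 n) (@lebesgue_tuple_ge0 n)
  (@lebesgue_tuple_sigma_additive n).

Let lebesgue_tuple_sigma_finite n : sigma_finite setT (@lebesgue_tuple n).
Proof.
by have [m <-] := lebesgue_tuple_sigma_finite_measure n; exact: sigma_finiteT.
Qed.

HB.instance Definition _ n := Measure_isSigmaFinite.Build _ _ _
  (@lebesgue_tuple n) (@lebesgue_tuple_sigma_finite n).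

End lebesgue_tuple.

Section landau_lifshitz.
Context {R : realType}.

Definition energy_density (n : nat) (u : R -> 'rV[R]_3) (r : R) : R :=
  enorm (u^`()%classic r) ^+ 2 +
  (u r 0 0 ^+ 2 + u r 0 1 ^+ 2
   + (2 * n%:R - 2) * enorm (u r - e3) ^+ 2) / r ^+ 2.

(* The energy of the radial map x |-> u(|x|) on R^(2n), given its profile u.
   At the origin the density takes an arbitrary value, on a null set. *)
Definition energy (n : nat) (u : R -> 'rV[R]_3) : \bar R :=
  ((1 / 2)%:E * \int[@lebesgue_tuple R (2 * n)%N]_x
    (energy_density n u (Num.sqrt (\sum_i tnth x i ^+ 2)))%:E)%E.

Definition self_similar_eq (alpha beta : R) (n : nat) (psi : R -> 'rV[R]_3)
    (r : R) : Prop :=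
  - (r / 2) *: (alpha *: crossp (psi r) (psi^`()%classic r)
                + beta *: psi^`()%classic r)
  = crossp (psi r)
      (psi^`(2)%classic r + ((2 * n%:R - 1) / r) *: psi^`()%classic r
       + ((2 * n%:R - 2 + psi r 0 2) / r ^+ 2) *: e3).

(* A map [0, oo) -> S^2 is represented by a function on R whose values at
   negative arguments are irrelevant. *)
Definition global_solution (alpha beta : R) (n : nat) (v : 'rV[R]_3)
    (psi : R -> 'rV[R]_3) : Prop :=
  [/\ forall r : R, 0 <= r -> sphere2 (psi r),
      C1_nonneg psi /\ Ck_pos 2 psi,
      forall r : R, 0 < r -> self_similar_eq alpha beta n psi r
    & psi 0 = e3 /\ is_right_derive0 psi v].

End landau_lifshitz.

(* Main.v *)
Require Import Defs.
From mathcomp Require Import all_boot all_order all_algebra.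
From mathcomp Require Import all_classical all_reals all_analysis.
From mathcomp Require Import ring lra.

Set Implicit Arguments.
Unset Strict Implicit.
Unset Printing Implicit Defensive.

Import Order.TTheory GRing.Theory Num.Theory.
Import numFieldNormedType.Exports.

Local Open Scope ring_scope.
Local Open Scope classical_set_scope.

(** Subtracting the pole, [psi = e_3 + r w], turns the equation into the system
    [w' = p], [(r^(d+1) p)' = r^d N(r, w, r p)] with [d = 2 n] and [N] polynomial,
    whose only singularity is the averaging operator [p |-> r^-(d+1) \int_0^r s^d N].
    With the weight [expR (lam r)] this operator is a contraction, which gives
    existence (after truncating [N]), uniqueness and Lipschitz dependence on [v].

    The energy [E = r^2 |psi'|^2 - F(psi_3)], [F(c) = 1 - c^2 + (d - 2) (2 - 2 c)],
    satisfies [E(0) = 0] and [E' = - (2 (d - 2) r + alpha r^3) |psi'|^2 <= 0].  Hence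
    [r |psi'|] is bounded, so that the truncation is never active, and for [v <> 0]
    [F(psi_3) >= - E > 0] stays away from [0]: [psi] avoids [e_3], also in the limit,
    and the energy density is at least [c / r^2].

    If [alpha > 0], [r^6 |psi'|^2] is a subsolution of a linear equation with strong
    damping.  If [alpha = 0], [beta / 2 psi + psi x psi' / r] has derivative
    [O(r^-3)], which gives the limit; [r^2 |psi'|^2] then converges too, and its
    limit is [0] because [E] is bounded.  In both cases
    [|psi - psi_infty| <= C / r^2] with [C] independent of [v], and the continuity of
    [psi_infty] follows from the continuous dependence at fixed [r]. *)

(** * Real derivatives *)

(** The substitution [psi = e_3 + r w] is dictated by the linearisation at the pole: the horizontal
    components solve [phi'' + (d-1)/r phi' - (d-1)/r^2 phi = 0], with exponents [1] and [-(d-1)].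
    Dividing by [r] shifts them to [0] and [-d], the exponents of [r^-(d+1) (r^(d+1) w')'], so
    [w(0) = v] becomes free data. The vertical component has another linear part and would leave a
    term of order [w_3 / r] in [N]; replacing it by the quadratic expression valid on the sphere
    removes the singularity, at the price that [|psi| = 1] must be recovered afterwards. The energy
    bounds [psi'] only by a multiple of [1 / r], which is useless near [0]. There a short-time bound
    takes over, on an interval whose length depends on the size of [v] alone once the parameters are
    fixed. The resulting bounds are uniform over bounded sets of [v], which is what allows a single
    Lipschitz constant for all nearby solutions. *)

Section real_derivatives.
Context {R : realType}.
Implicit Types (f g : R -> R) (x a b : R).

Lemma der_cst (c x : R) : is_derive x 1 (fun=> c) 0.
Proof. exact: is_derive_cst. Qed.

Lemma der_id (x : R) : is_derive x 1 (fun t => t) 1.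
Proof. exact: is_derive_id. Qed.

Lemma derD f g x a b : is_derive x 1 f a -> is_derive x 1 g b ->
  is_derive x 1 (fun t => f t + g t) (a + b).
Proof. exact: is_deriveD. Qed.

Lemma derN f x a : is_derive x 1 f a -> is_derive x 1 (fun t => - f t) (- a).
Proof. exact: is_deriveN. Qed.

Lemma derM f g x a b : is_derive x 1 f a -> is_derive x 1 g b ->
  is_derive x 1 (fun t => f t * g t) (f x * b + g x * a).
Proof. exact: is_deriveM. Qed.

Lemma derX f n x a : is_derive x 1 f a ->
  is_derive x 1 (fun t => f t ^+ n) (n%:R * f x ^+ n.-1 * a).
Proof. by move=> /is_deriveX-/(_ n); rewrite exprfctE. Qed.

Lemma derV f x a : f x != 0 -> is_derive x 1 f a ->
  is_derive x 1 (fun t => (f t)^-1) (- (f x) ^- 2 * a).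
Proof. exact: is_deriveV. Qed.

Lemma der_expR f x a : is_derive x 1 f a ->
  is_derive x 1 (fun t => expR (f t)) (expR (f x) * a).
Proof.
move=> fa; exact: (@is_derive1_comp R expR f x _ _ (is_derive_expR _) fa).
Qed.

Lemma der_continuous f x a : is_derive x 1 f a -> {for x, continuous f}.
Proof.
by move=> fa; apply/differentiable_continuous/derivable1_diffP; case: fa.
Qed.

Lemma der_near f g x a : (\forall t \near x, f t = g t) ->
  is_derive x 1 f a -> is_derive x 1 g a.
Proof.
by move=> fg; apply: near_eq_is_derive => //; exact: oner_neq0.
Qed.

End real_derivatives.

Lemma der_eq (R : realType) (f : R -> R) (x a b : R) :
  is_derive x 1 f a -> a = b -> is_derive x 1 f b.
Proof. by move=> + <-. Qed.

(* [is_derive] is a class: [notypeclasses refine] keeps instance search from choosing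
   its own, unreadable form of the derivative. *)
Ltac der := lazymatch goal with
  | |- is_derive _ _ (fun t => @GRing.add _ (@?f t) (@?g t)) _ =>
      notypeclasses refine (@derD _ f g _ _ _ _ _); der
  | |- is_derive _ _ (fun t => @GRing.opp _ (@?f t)) _ =>
      notypeclasses refine (@derN _ f _ _ _); der
  | |- is_derive _ _ (fun t => @GRing.mul _ (@?f t) (@?g t)) _ =>
      notypeclasses refine (@derM _ f g _ _ _ _ _); der
  | |- is_derive _ _ (fun t => @GRing.exp _ (@?f t) ?n) _ =>
      notypeclasses refine (@derX _ f n _ _ _); der
  | |- is_derive _ _ (fun t => @GRing.inv _ (@?f t)) _ =>
      notypeclasses refine (@derV _ f _ _ _ _); der
  | |- is_derive _ _ (fun t => expR (@?f t)) _ =>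
      notypeclasses refine (@der_expR _ f _ _ _); der
  | |- is_derive _ _ (fun t => t) _ => exact: der_id
  | |- is_derive _ _ (fun t => ?c) _ => first [exact: der_cst | eassumption]
  | |- is_derive _ _ _ _ => try eassumption
  | |- _ => idtac
  end.

Ltac dereq := notypeclasses refine (@der_eq _ _ _ _ _ _ _); [der|cbv beta].

(** * Comparison of derivatives, primitives and continuous induction *)

Section comparison.
Context {R : realType}.
Implicit Types f g F : R -> R.

Lemma der_ge0_le f (f' : R -> R) (a b : R) : a <= b ->
  (forall x, a <= x <= b -> is_derive x 1 f (f' x)) ->
  (forall x, a < x < b -> 0 <= f' x) -> f a <= f b.
Proof.
rewrite le_eqVlt => /predU1P[->//|ab] df f'0.
have [||c cab] := @MVT R f f' a b ab.
- by move=> x; rewrite in_itv/= => /andP[ax xb]; apply: df; rewrite !ltW.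
- apply: derivable_within_continuous => x; rewrite in_itv/= => /df.
  by case.
- move: cab; rewrite in_itv/= => cab fab.
  by rewrite -subr_ge0 fab mulr_ge0 ?f'0// subr_ge0 ltW.
Qed.

Lemma der_comparison F g (F' g' : R -> R) (a b : R) : a <= b ->
  (forall x, a <= x <= b -> is_derive x 1 F (F' x)) ->
  (forall x, a <= x <= b -> is_derive x 1 g (g' x)) ->
  (forall x, a < x < b -> `|F' x| <= g' x) -> `|F b - F a| <= g b - g a.
Proof.
move=> ab dF dg Fg.
rewrite ler_norml; apply/andP; split.
- rewrite lerNl opprB -subr_ge0.
  have -> : g b - g a - (F a - F b) = (g b + F b) - (g a + F a) by ring.
  rewrite subr_ge0.
  apply: (@der_ge0_le (fun t => g t + F t) (fun t => g' t + F' t)) => //.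
  + by move=> x xab; apply: derD; [exact: dg|exact: dF].
  + by move=> x /Fg; rewrite ler_norml => /andP[+ _]; lra.
- rewrite -subr_ge0.
  have -> : g b - g a - (F b - F a) = (g b - F b) - (g a - F a) by ring.
  rewrite subr_ge0.
  apply: (@der_ge0_le (fun t => g t - F t) (fun t => g' t - F' t)) => //.
  + by move=> x xab; apply: derD; [exact: dg|apply: derN; exact: dF].
  + by move=> x /Fg; rewrite ler_norml => /andP[_]; lra.
Qed.

(** Solutions are controlled only for [x > 0], so one-sided limits stand in for the values at the
    left end. *)
Lemma der_comparison0 F g (F' g' : R -> R) (l m T : R) :
  (forall x, 0 < x < T -> is_derive x 1 F (F' x)) ->
  (forall x, 0 < x < T -> is_derive x 1 g (g' x)) ->
  F x @[x --> 0^'+] --> l -> g x @[x --> 0^'+] --> m ->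
  (forall x, 0 < x < T -> `|F' x| <= g' x) ->
  forall r, 0 < r < T -> `|F r - l| <= g r - m.
Proof.
move=> dF dg Fl gm Fg r /andP[r0 rT].
have H1 : `|F r - F x| @[x --> 0^'+] --> `|F r - l|.
  by apply: cvg_norm; apply: cvgB => //; exact: cvg_cst.
have H2 : (g r - g x) @[x --> 0^'+] --> (g r - m).
  by apply: cvgB => //; exact: cvg_cst.
apply: (ler_cvg_to H1 H2); near=> s.
have s0 : 0 < s by near: s; exact: nbhs_right_gt.
have sr : s < r by near: s; exact: nbhs_right_lt.
apply: (@der_comparison F g F' g') => //.
- exact: ltW.
- by move=> x /andP[sx xr]; apply: dF; lra.
- by move=> x /andP[sx xr]; apply: dg; lra.
- by move=> x /andP[sx xr]; apply: Fg; lra.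
Unshelve. all: by end_near. Qed.

Lemma antiderivative f : continuous f ->
  exists F : R -> R, F 0 = 0 /\ forall x : R, 0 <= x -> is_derive x 1 F (f x).
Proof.
move=> cf.
(* Starting the integral at [-1] makes [0] an interior point, so that the derivative there is
   two-sided. *)
pose G (x : R) : R := (\int[@lebesgue_measure R]_(t in [set` `[-1, x]]) (f t))%R.
exists (fun x : R => G x - G 0); rewrite subrr; split=> // x x0.
have dG : is_derive x 1 G (f x).
  have [] := @continuous_FTC1 R f (BLeft (-1)) x (x + 1).
  - by rewrite ltrDl.
  - apply: continuous_compact_integrable; first exact: segment_compact.
    exact: continuous_subspaceT.
  - by rewrite /= lte_fin; lra.
  - exact: cf.
  - by move=> dG G'; split; [exact: dG|rewrite -derive1E].
by clearbody G; dereq; rewrite oppr0 addr0.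
Qed.

(** The supremum of the initial segments on which [B] holds can always be passed. This is the
    continuation principle behind the a priori bounds of the existence proof. *)
Lemma real_induction (B : R -> Prop) : B 0 ->
  (forall t, 0 <= t -> B t -> \forall s \near t, t < s -> B s) ->
  (forall t, 0 < t -> (forall s, 0 <= s < t -> B s) -> B t) ->
  forall t, 0 <= t -> B t.
Proof.
move=> B0 Bopen Bclosed t t0.
pose A := [set x | 0 <= x /\ forall s, 0 <= s <= x -> B s].
apply: contrapT => nBt.
have A0 : A 0 by split=> // s /andP[s0 s0']; have -> : s = 0 by lra.
have Aub x : A x -> x <= t.
  move=> [x0 Ax]; rewrite leNgt; apply/negP => tx.
  by apply: nBt; apply: Ax; rewrite t0 ltW.
have supA : has_sup A by split; [exists 0|exists t].
have s0 : 0 <= sup A by apply: ub_le_sup => //; exists t.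
have Bs s : 0 <= s < sup A -> B s.
  move=> /andP[s_ge0 ss].
  have [x [x0 Ax] sx] := sup_adherent (eps := sup A - s) (ltac:(by rewrite subr_gt0)) supA.
  by apply: Ax; rewrite s_ge0/=; lra.
have Bsup : B (sup A).
  move: s0; rewrite le_eqVlt => /predU1P[<-//|s0].
  exact: Bclosed.
have /nbhs_ballP[e /= e0 He] := Bopen _ s0 Bsup.
have : A (sup A + e / 2).
  split; first by rewrite addr_ge0// divr_ge0// ltW.
  move=> s /andP[s1 s2]; have [ss|] := ltP s (sup A); first by apply: Bs; rewrite s1.
  rewrite le_eqVlt => /predU1P[<-//|ss].
  apply: He => //=; rewrite /ball/= ltr0_norm; lra.
by move=> /(ub_le_sup (proj2 supA)); lra.
Qed.

(** With [h = K / (2 r^2)], [f - h] is nondecreasing and [f + h] nonincreasing, so every value of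
    the former lies below every value of the latter; [l] is the supremum of the former. *)
Lemma cube_tail f (f' : R -> R) (K R0 : R) : 0 <= R0 ->
  (forall r, R0 < r -> is_derive r 1 f (f' r)) ->
  (forall r, R0 < r -> `|f' r| <= K / r ^+ 3) ->
  exists l, forall r, R0 < r -> `|f r - l| <= K / r ^+ 2.
Proof.
move=> R00 df f'K.
have K0 : 0 <= K.
  have := f'K (R0 + 1) (ltac:(lra)).
  move=> /(le_trans (normr_ge0 _)); rewrite pmulr_lge0// invr_gt0 exprn_gt0//; lra.
pose h r : R := K / (2 * r ^+ 2).
have dh r : R0 < r -> is_derive r 1 h (- K / r ^+ 3).
  move=> r0; have r_neq0 : r != 0 by apply/eqP; lra.
  rewrite /h; dereq; last by rewrite /=; field.
   by rewrite mulf_neq0// expf_neq0.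
have h0 r : R0 < r -> 0 <= h r.
  by move=> r0; rewrite /h divr_ge0// mulr_ge0// exprn_ge0//; lra.
have hle r s : R0 < r -> r <= s -> `|f s - f r| <= h r - h s.
  move=> r0 rs.
  have -> : h r - h s = - h s - - h r by ring.
  apply: (@der_comparison f (fun t => - h t) f' (fun t => K / t ^+ 3)) => //.
  - by move=> x /andP[rx _]; apply: df; lra.
  - move=> x /andP[rx _]; have -> : K / x ^+ 3 = - (- K / x ^+ 3) by rewrite mulNr opprK.
    by apply: derN; apply: dh; lra.
  - by move=> x /andP[rx _]; apply: f'K; lra.
pose A := [set f s - h s | s in [set s | R0 < s]].
have Aub r : R0 < r -> ubound A (f r + h r).
  move=> r0 _ [s /= s0 <-].
  have [rs|sr] := leP r s.
  - have := hle _ _ r0 rs; rewrite ler_norml => /andP[_].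
    by have := h0 _ s0; have := h0 _ r0; lra.
  - have := hle _ _ s0 (ltW sr); rewrite ler_norml => /andP[+ _].
    by have := h0 _ s0; have := h0 _ r0; lra.
have A0 : A !=set0 by exists (f (R0 + 1) - h (R0 + 1)), (R0 + 1) => //=; lra.
exists (sup A) => r r0.
have H1 : f r - h r <= sup A.
  by apply: ub_le_sup; [exists (f r + h r); exact: Aub|exists r].
have H2 : sup A <= f r + h r by apply: ge_sup => //; exact: Aub.
have : h r <= K / r ^+ 2.
  rewrite /h invfM mulrA ler_wpM2r ?invr_ge0 ?exprn_ge0//; lra.
by rewrite ler_norml; lra.
Qed.

End comparison.

(** * Limits at zero and the singular averaging operator *)

Section limits_at_zero.
Context {R : realType}.
Implicit Types (f g : R -> R) (x : R).

Lemma der_cvg_at_right f (x a : R) :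
  is_derive x 1 f a -> f t @[t --> x^'+] --> f x.
Proof. by move=> /der_continuous cf; exact: cvg_at_right_filter. Qed.

Lemma continuous_near f g (x : R) : (\forall t \near x, f t = g t) ->
  {for x, continuous f} -> {for x, continuous g}.
Proof.
move=> fg cf; have fgx := nbhs_singleton fg; apply/cvgrPdist_le => e e0.
move/cvgrPdist_le : cf => /(_ e e0) cf; near=> t.
have <- : f t = g t by near: t.
by rewrite -fgx; near: t.
Unshelve. all: by end_near. Qed.

Lemma cntD f g x : continuous_at x f -> continuous_at x g ->
  continuous_at x (fun t => f t + g t).
Proof. exact: cvgD. Qed.

Lemma cntN f x : continuous_at x f -> continuous_at x (fun t => - f t).
Proof. exact: cvgN. Qed.

Lemma cntM f g x : continuous_at x f -> continuous_at x g ->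
  continuous_at x (fun t => f t * g t).
Proof. exact: cvgM. Qed.

Lemma linear_bound_cvg0 f (K T : R) : 0 < T ->
  (forall r : R, 0 < r < T -> `|f r| <= K * r) -> f t @[t --> 0^'+] --> 0.
Proof.
move=> T0 fK.
have gK : `|K| * t @[t --> 0^'+] --> (0 : R).
  rewrite -[X in _ --> X](mulr0 `|K|).
  apply: (@der_cvg_at_right (fun t => `|K| * t)); der.
apply/cvgr0Pnorm_le => e e0.
move/cvgr0Pnorm_le : gK => /(_ e e0) gK; near=> t.
have t0 : 0 < t by near: t; exact: nbhs_right_gt.
have tT : t < T by near: t; exact: nbhs_right_lt.
have te : `| `|K| * t| <= e by near: t.
apply: le_trans te; apply: (le_trans (fK t _)); first by rewrite t0.
by rewrite normrM normr_id (gtr0_norm t0) ler_wpM2r ?ler_norm// ltW.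
Unshelve. all: by end_near. Qed.

Lemma half_pow_cvg0 (B : R) : B / 2 ^+ k @[k --> \oo] --> 0.
Proof.
rewrite -[X in _ --> X](mulr0 B).
apply: cvgMr; under eq_fun do rewrite -exprVn.
by apply: cvg_expr; rewrite ger0_norm; lra.
Qed.

(** Ends the contraction arguments: an error that is halved at every step disappears. *)
Lemma le_half_pow (x A B : R) : (forall k : nat, x <= A + B / 2 ^+ k) -> x <= A.
Proof.
move=> H.
have : A + B / 2 ^+ k @[k --> \oo] --> A + 0.
  by apply: cvgD; [exact: cvg_cst|exact: half_pow_cvg0].
rewrite addr0 => /cvgr_to_ge; apply.
by near=> k; exact: H.
Unshelve. all: by end_near. Qed.

(* Solves [(t^(d+1) q)' = t^d f], including the limit value at the singular point. *)
Lemma singular_average (d : nat) f : continuous f ->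
  exists q : R -> R, [/\ continuous q, forall r : R, r <= 0 -> q r = q 0
    & forall r : R, 0 < r -> is_derive r 1 (fun t => t ^+ d.+1 * q t) (r ^+ d * f r)].
Proof.
move=> cf.
have [|G [G0 dG]] := @antiderivative R (fun t => t ^+ d * f t).
  by move=> x; apply: cvgM; [exact: exprn_continuous|exact: cf].
have d0 : d.+1%:R != 0 :> R by rewrite pnatr_eq0.
have d0' : 0 < d.+1%:R :> R by rewrite ltr0n.
(* The value [f 0 / (d+1)] is the limit of the average at [0]; keeping it for negative arguments
   makes [q] continuous on the whole line. *)
pose q (r : R) : R := if 0 < r then G r / r ^+ d.+1 else f 0 / d.+1%:R.
have qpos (r : R) : 0 < r -> q r = G r / r ^+ d.+1 by rewrite /q => ->.
have qneg (r : R) : r <= 0 -> q r = f 0 / d.+1%:R by rewrite /q leNgt; case: ifP.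
exists q; split.
- move=> x; have [x0|x0|x0] := ltgtP x 0.
  + apply: (@continuous_near (fun=> q x)); last exact: cvg_cst.
    near=> t; rewrite !qneg ?(ltW x0)//.
    by apply: ltW; near: t; exact: lt_nbhsl.
  + have dGx := dG x (ltW x0).
    have xn0 : x ^+ d.+1 != 0 by rewrite expf_neq0// gt_eqF.
    apply: (@continuous_near (fun t : R => G t / t ^+ d.+1)).
      near=> t; rewrite qpos//; near: t; exact: lt_nbhsr.
    by apply: der_continuous; der.
  + rewrite x0; apply/cvgrPdist_le => e e0.
    have /cvgrPdist_le/(_ e e0)/nbhs_ballP[del /= del0 Hdel] := cf 0.
    near=> t; rewrite (qneg 0)//.
    have [t0|t0] := ltP 0 t; last by rewrite qneg// subrr normr0 ltW.
    rewrite qpos// distrC.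
    have tdel : t < del by near: t; exact: lt_nbhsl.
    have -> : G t / t ^+ d.+1 - f 0 / d.+1%:R = (G t - f 0 * t ^+ d.+1 / d.+1%:R) / t ^+ d.+1.
      by rewrite mulrBl; congr (_ - _); rewrite mulrAC mulfK// expf_neq0// gt_eqF.
    rewrite normrM normfV (gtr0_norm (exprn_gt0 _ t0)) ler_pdivrMr ?exprn_gt0//.
    (* [F] removes the primitive of [f 0 s^d] from [G]; continuity of [f] at [0] then gives
       [|F'| <= e s^d] near [0], and [g] is the primitive of that bound. *)
    pose F (s : R) := G s - f 0 * s ^+ d.+1 / d.+1%:R.
    pose g (s : R) := e * s ^+ d.+1 / d.+1%:R.
    have dF (x1 : R) : 0 <= x1 -> is_derive x1 1 F (x1 ^+ d * (f x1 - f 0)).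
      by move=> x10; have dGx := dG x1 x10; rewrite /F; dereq => //=; move: d.+1%:R d0 => D D0; field.
    have dg (x1 : R) : is_derive x1 1 g (e * x1 ^+ d).
      by rewrite /g; dereq => //=; move: d.+1%:R d0 => D D0; field.
    have F0 : F 0 = 0 by rewrite /F G0 exprS; ring.
    have g0 : g 0 = 0 by rewrite /g exprS; ring.
    have : `|F t - F 0| <= g t - g 0.
      apply: (@der_comparison0 R F g (fun x1 => x1 ^+ d * (f x1 - f 0))
        (fun x1 => e * x1 ^+ d) (F 0) (g 0) del).
      * by move=> x1 /andP[x10 _]; apply: dF; exact: ltW.
      * by move=> x1 _; exact: dg.
      * exact: der_cvg_at_right (dF 0 (lexx _)).
      * exact: der_cvg_at_right (dg 0).
      * move=> x1 /andP[x10 x1d]; rewrite normrM ger0_norm ?(exprn_ge0 _ (ltW x10))//.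
        rewrite mulrC ler_wpM2r ?(exprn_ge0 _ (ltW x10))// distrC; apply: Hdel.
        by rewrite /ball/= sub0r normrN gtr0_norm.
      * by rewrite t0.
    rewrite F0 g0 !subr0.
    rewrite /F /g => /le_trans; apply.
    rewrite -mulrA ler_wpM2l ?(ltW e0)// ler_pdivrMr// ler_peMr ?(exprn_ge0 _ (ltW t0))//.
    by rewrite ler1n.
- by move=> r r0; rewrite !qneg.
- move=> r r0; apply: (@der_near _ G); last exact/dG/ltW.
  near=> t; have t0 : 0 < t by near: t; exact: lt_nbhsr.
  by rewrite qpos// mulrC divfK// expf_neq0// gt_eqF.
Unshelve. all: by end_near. Qed.

End limits_at_zero.

Ltac cnt := lazymatch goal with
  | |- continuous_at _ (fun t => @GRing.add _ (@?f t) (@?g t)) =>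
      notypeclasses refine (@cntD _ f g _ _ _); cnt
  | |- continuous_at _ (fun t => @GRing.opp _ (@?f t)) =>
      notypeclasses refine (@cntN _ f _ _); cnt
  | |- continuous_at _ (fun t => @GRing.mul _ (@?f t) (@?g t)) =>
      notypeclasses refine (@cntM _ f g _ _ _); cnt
  | |- continuous_at _ (fun t => t) => exact: cvg_id
  | |- continuous_at _ (fun t => ?c) => first [exact: cvg_cst | idtac]
  | |- _ => idtac
  end.

(** * The singular linear and Lipschitz systems *)

Section singular_system.
Context {R : realType}.

Lemma expR_ge1W (x : R) : 0 <= x -> 1 <= expR x.
Proof. by move=> x0; rewrite -[leLHS]expR0 ler_expR. Qed.

(* The contraction estimate behind existence, uniqueness and continuous
   dependence for [w' = p], [(r^(d+1) p)' = r^d n(r, w, r p)]: the weight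
   [expR (lam r)] gains a factor [1/2]. *)
Lemma singular_contraction (I : Type) (d : nat) (T L a D lam : R)
    (dw dp dn G : I -> R -> R) (c : I -> R) :
  0 < T -> 0 <= L -> 0 <= a -> 0 <= D -> 0 < lam -> 2 * L <= lam ->
  (forall i (r : R), 0 < r < T -> is_derive r 1 (dw i) (dp i r)) ->
  (forall i, `|c i| <= a) -> (forall i, dw i t @[t --> 0^'+] --> c i) ->
  (forall i (r : R), 0 < r < T -> `|dp i r| <= D * expR (lam * r)) ->
  (forall i (r : R), 0 < r < T -> is_derive r 1 (G i) (r ^+ d * dn i r)) ->
  (forall i, G i t @[t --> 0^'+] --> 0) ->
  (forall r B C : R, 0 < r < T -> (forall i, `|dw i r| <= B) ->
    (forall i, `|dp i r| <= C) -> forall i, `|dn i r| <= L * (B + r * C)) ->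
  forall i (r : R), 0 < r < T ->
    `|dw i r| <= a + D / lam * expR (lam * r) /\
    `|G i r| <= r ^+ d.+1 * (L * a + D / 2 * expR (lam * r)).
Proof.
move=> T0 L0 a0 D0 lam0 Llam ddw ca dwc dpD dG G0 dnL.
have lamn0 : lam != 0 by rewrite gt_eqF.
pose e (t : R) := expR (lam * t).
have e0 t : 0 <= e t by exact: expR_ge0.
have dwb i (r : R) : 0 < r < T -> `|dw i r| <= a + D / lam * e r.
  move=> rT.
  pose g (t : R) := D / lam * e t.
  have dg (t : R) : is_derive t 1 g (D * e t).
    by rewrite /g /e; dereq => //=; field.
  have H : `|dw i r - c i| <= g r - g 0.
    apply: (@der_comparison0 R (dw i) g (dp i) (fun t => D * e t) _ _ T) => //.
    + exact: der_cvg_at_right (dg 0).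
    + by move=> x; exact: dpD.
  have g0 : 0 <= g 0 by rewrite /g mulr_ge0// divr_ge0// ltW.
  have : `|dw i r| <= `|dw i r - c i| + `|c i|.
    by rewrite -[X in `|X| <= _](subrK (c i)) ler_normD.
  by have := ca i; rewrite -/(g r); lra.
move=> i r rT; split; first exact: dwb.
(* The derivative of [g] exceeds the bound on [t^d dn] by [d t^d (L a + L D / lam e)]. The factor
   [1 / lam] comes from integrating the weight, and [2 L <= lam] turns it into the gain [1/2]. *)
pose g (t : R) := t ^+ d.+1 * (L * a + L * D / lam * e t).
have dg (t : R) : is_derive t 1 g
    (d.+1%:R * t ^+ d * (L * a + L * D / lam * e t) + t ^+ d.+1 * (L * D * e t)).
  by rewrite /g /e; dereq => //=; field.
have g0 : g 0 = 0 by rewrite /g exprS !mul0r.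
have H : `|G i r - 0| <= g r - g 0.
  apply: (@der_comparison0 R (G i) g _ _ 0 (g 0) T (dG i) (fun x _ => dg x)) => //.
  - exact: der_cvg_at_right (dg 0).
  - move=> x xT; have /andP[x0 _] := xT.
    have xd0 : 0 <= x ^+ d by rewrite exprn_ge0// ltW.
    rewrite normrM ger0_norm//.
    have := dnL x _ _ xT (fun j => dwb j x xT) (fun j => dpD j x xT) i.
    rewrite -/(e x) => dnx.
    have -> : d.+1%:R = 1 + d%:R :> R by rewrite -natr1 addrC.
    have dR : 0 <= d%:R :> R by rewrite ler0n.
    have q0 : 0 <= L * a + L * D / lam * e x.
      by rewrite addr_ge0// mulr_ge0// divr_ge0 ?mulr_ge0// ltW.
    apply: (le_trans (ler_wpM2l xd0 dnx)).
    rewrite -subr_ge0 (_ : _ - _ = d%:R * x ^+ d * (L * a + L * D / lam * e x)).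
      by rewrite mulr_ge0// mulr_ge0.
    by rewrite exprS; field.
move: H; rewrite g0 !subr0 => /le_trans; apply.
have /andP[r0 _] := rT.
rewrite /g ler_wpM2l ?(exprn_ge0 _ (ltW r0))// lerD2l ler_wpM2r//.
by rewrite ler_pdivrMr//; have := ler_wpM2l D0 Llam; lra.
Qed.

(** The contraction replaces a bound [D expR (2 L r)] on [dp] by [(L a + D / 2) expR (2 L r)], whose
    fixed point is [D = 2 L a]. The a priori bound [D0] starts the iteration and is absent from the
    result, so [a = 0] forces the differences to vanish. *)
Lemma singular_gronwall (I : finType) (d : nat) (T L a D0 : R)
    (dw dp dn : I -> R -> R) (c : I -> R) :
  0 < L -> 0 <= a ->
  (forall i (r : R), 0 < r < T -> is_derive r 1 (dw i) (dp i r)) ->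
  (forall i, `|c i| <= a) -> (forall i, dw i t @[t --> 0^'+] --> c i) ->
  (forall i (r : R), 0 < r < T -> `|dp i r| <= D0) ->
  (forall i (r : R), 0 < r < T ->
    is_derive r 1 (fun t => t ^+ d.+1 * dp i t) (r ^+ d * dn i r)) ->
  (forall r B C : R, 0 < r < T -> (forall i, `|dw i r| <= B) ->
    (forall i, `|dp i r| <= C) -> forall i, `|dn i r| <= L * (B + r * C)) ->
  forall i (r : R), 0 < r < T ->
    `|dw i r| <= a * (1 + expR (2 * L * r)) /\
    `|dp i r| <= 2 * L * a * expR (2 * L * r).
Proof.
move=> L0 a0 ddw ca dwc dpD0 dG dnL i r rT.
have T0 : 0 < T by case/andP: rT; exact: lt_trans.
have D00 : 0 <= D0 by apply: le_trans (dpD0 i r rT).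
have lam0 : 0 < 2 * L by rewrite mulr_gt0.
have G0 j : t ^+ d.+1 * dp j t @[t --> (0 : R)^'+] --> 0.
  apply: (@linear_bound_cvg0 R _ (T ^+ d * D0) T) => // x /andP[x0 xT].
  have xd : 0 <= x ^+ d.+1 by rewrite exprn_ge0// ltW.
  rewrite normrM ger0_norm// exprSr mulrAC ler_wpM2r ?(ltW x0)//.
  rewrite ler_pM ?(exprn_ge0 _ (ltW x0))//; last by apply: dpD0; rewrite x0.
  by rewrite lerXn2r ?nnegrE ?(ltW x0) ?(ltW T0) ?(ltW xT).
have e1 (x : R) : 0 < x -> 1 <= expR (2 * L * x).
  by move=> x0; apply/expR_ge1W/ltW/mulr_gt0.
(* The excess of the bound over the fixed point [2 L a] is halved at each application. *)
have key (k : nat) : forall j (x : R), 0 < x < T ->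
    `|dp j x| <= (2 * L * a + D0 / 2 ^+ k) * expR (2 * L * x).
  elim: k => [|k IH] j x xT; have /andP[x0 _] := xT.
    rewrite expr0 divr1; apply: (le_trans (dpD0 j x xT)).
    rewrite -[leLHS]mulr1 ler_pM ?e1// lerDr; apply: mulr_ge0 => //; exact: ltW.
  have DD : 0 <= 2 * L * a + D0 / 2 ^+ k.
    by rewrite addr_ge0 ?divr_ge0 ?exprn_ge0//; apply: mulr_ge0 => //; exact: ltW.
  have [_] := singular_contraction T0 (ltW L0) a0 DD lam0 (lexx _) ddw ca dwc IH
    dG G0 dnL j xT.
  have xd : 0 < x ^+ d.+1 by rewrite exprn_gt0.
  rewrite normrM (gtr0_norm xd) ler_pM2l// => /le_trans; apply.
  have La : 0 <= L * a by rewrite mulr_ge0// ltW.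
  have := ler_wpM2l La (e1 x x0).
  rewrite exprS invfM; move: (2 ^+ k)^-1 (expR _) => q E; lra.
have dpb j (x : R) : 0 < x < T -> `|dp j x| <= 2 * L * a * expR (2 * L * x).
  move=> xT; apply: (@le_half_pow R _ _ (D0 * expR (2 * L * x))) => k.
  apply: le_trans (key k j x xT) _.
  by rewrite mulrDl lerD2l mulrAC.
split; last exact: dpb.
have LL : 0 <= 2 * L * a by apply: mulr_ge0 => //; exact: ltW.
have [+ _] := singular_contraction T0 (ltW L0) a0 LL lam0 (lexx _) ddw ca dwc dpb
  dG G0 dnL i rT.
have -> : 2 * L * a / (2 * L) = a by field; rewrite gt_eqF.
by move=> /le_trans; apply; lra.
Qed.


(** Freezing a function at [f 0] on the negative axis: primitives are controlled only for [r >= 0],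
    while the iteration runs among functions continuous on the line. *)
Lemma continuous_max0 (f : R -> R) : (forall x : R, 0 <= x -> {for x, continuous f}) ->
  continuous (fun x : R => f (Num.max x 0)).
Proof.
move=> cf x; apply: (@continuous_comp _ _ _ (fun x : R => Num.max x 0) f).
  by apply: continuous_max; [exact: cvg_id|exact: cvg_cst].
by apply: cf; rewrite le_max lexx orbT.
Qed.

(** * Picard iteration for the singular system *)

Section picard.
Variables (I : finType) (d : nat) (n : I -> R -> (I -> R) -> (I -> R) -> R).
Hypothesis n_lipschitz : forall T : R, 0 < T -> exists2 L, 0 < L &
  forall (r : R) w y w' y' (B C : R), 0 < r < T ->
  (forall i, `|w i - w' i| <= B) -> (forall i, `|y i - y' i| <= C) ->
  forall i, `|n i r w y - n i r w' y'| <= L * (B + C).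
Hypothesis n_continuous : forall w y : I -> R -> R,
  (forall i, continuous (w i)) -> (forall i, continuous (y i)) ->
  forall i, continuous (fun r => n i r (w^~ r) (y^~ r)).

Let picard_step_spec (v : I -> R) (p w q : I -> R -> R) :=
  [/\ forall i, continuous (w i) /\ continuous (q i),
      forall i, w i 0 = v i,
      forall i (r : R), r <= 0 -> q i r = q i 0,
      forall i (r : R), 0 < r -> is_derive r 1 (w i) (p i r) &
      forall i (r : R), 0 < r -> is_derive r 1 (fun t => t ^+ d.+1 * q i t)
         (r ^+ d * n i r (w^~ r) (fun j => r * p j r))].

Let picard_step v (p : I -> R -> R) : (forall i, continuous (p i)) ->
  exists wq : (I -> R -> R) * (I -> R -> R), picard_step_spec v p wq.1 wq.2.
Proof.
move=> cp.
have /choice[W HW] i := @antiderivative R (p i) (cp i).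
pose w i (x : R) : R := v i + W i (Num.max x 0).
have cw i : continuous (w i).
  move=> x; apply: cvgD; first exact: cvg_cst.
  apply: (continuous_max0 (f := W i)) => z z0.
  exact: der_continuous ((HW i).2 z z0).
have cy i : continuous (fun r : R => r * p i r).
  by move=> x; apply: cvgM; [exact: cvg_id|exact: cp].
have /choice[q Hq] i := singular_average d (n_continuous cw cy (i := i)).
exists (w, q); split => /=.
- by move=> i; split => //; case: (Hq i).
- by move=> i; rewrite /w maxxx (HW i).1 addr0.
- by move=> i r r0; case: (Hq i) => _ /(_ r r0).
- move=> i r r0; apply: (@der_near _ (fun x => v i + W i x)).
    near=> t; rewrite /w max_l// ltW//; near: t; exact: lt_nbhsr.
  by have dW := (HW i).2 r (ltW r0); dereq; rewrite add0r.
- by move=> i r r0; case: (Hq i) => _ _; exact.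
Unshelve. all: by end_near. Qed.

(** The iteration acts on [p]. In the norm weighted by [expR (2 L r)] on [(0, T)] successive
    differences shrink like [2^-k]; the weight depends on [T] but the iterates do not, so the limit
    is a global solution at once. *)
Lemma singular_picard (v : I -> R) : exists w p : I -> R -> R,
  [/\ forall i, continuous (w i) /\ continuous (p i),
      forall i, w i 0 = v i,
      forall i (r : R), 0 < r -> is_derive r 1 (w i) (p i r) &
      forall i (r : R), 0 < r -> is_derive r 1 (fun t => t ^+ d.+1 * p i t)
         (r ^+ d * n i r (w^~ r) (fun j => r * p j r))].
Proof.
(* [choice] needs a total step function; a discontinuous [p] is sent to zero, and such a [p] never
   occurs among the iterates. *)
have /choice[S HS] : forall p : I -> R -> R, exists wq : (I -> R -> R) * (I -> R -> R),
    (forall i, continuous (p i)) -> picard_step_spec v p wq.1 wq.2.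
  move=> p.
  have [cp|ncp] := pselect (forall i, continuous (p i)).
    by have [wq H] := picard_step v cp; exists wq.
  by exists (fun _ _ => 0, fun _ _ => 0).
pose P k := iter k (fun p => (S p).2) (fun _ _ => 0).
pose W k := (S (P k)).1.
have PS k : P k.+1 = (S (P k)).2 by [].
have P_cont k i : continuous (P k i).
  elim: k i => [|k IH] i; first by move=> x; exact: cvg_cst.
  by case: (HS _ IH) => /(_ i)[].
have spec k : picard_step_spec v (P k) (W k) (P k.+1) by exact: HS.
(* The iterates are constant on the negative axis, so estimates for [r > 0] extend to a full
   neighbourhood of [0] and the uniform limit is continuous there. *)
have P_neg k i (r : R) : r <= 0 -> P k i r = P k i 0.
  by case: k => // k; case: (spec k) => _ _ + _ _; exact.
have G_cvg0 (q : I -> R -> R) i : continuous (q i) ->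
    t ^+ d.+1 * q i t @[t --> (0 : R)^'+] --> 0.
  move=> cq; have E0 : 0 ^+ d.+1 * q i 0 = 0 by rewrite exprS !mul0r.
  rewrite -[X in _ --> X]E0.
  apply: (@cvg_at_right_filter _ _ (fun t => t ^+ d.+1 * q i t) 0).
  by apply: cvgM; [exact: exprn_continuous|exact: cq].
have n_diff L T (p p' w w' : I -> R -> R) :
    (forall (r : R) w y w' y' (B C : R), 0 < r < T ->
    (forall i, `|w i - w' i| <= B) -> (forall i, `|y i - y' i| <= C) ->
    forall i, `|n i r w y - n i r w' y'| <= L * (B + C)) ->
    forall r B C : R, 0 < r < T -> (forall i, `|w i r - w' i r| <= B) ->
    (forall i, `|p i r - p' i r| <= C) -> forall i,
    `|n i r (w^~ r) (fun j => r * p j r) - n i r (w'^~ r) (fun j => r * p' j r)|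
       <= L * (B + r * C).
  move=> nL r B C rT wB pC i; apply: nL => // j; have /andP[r0 _] := rT.
  by rewrite -mulrBr normrM gtr0_norm// ler_wpM2l ?(ltW r0).
have step T L D : 0 < T -> 0 < L -> 0 <= D ->
   (forall (r : R) w y w' y' (B C : R), 0 < r < T ->
    (forall i, `|w i - w' i| <= B) -> (forall i, `|y i - y' i| <= C) ->
    forall i, `|n i r w y - n i r w' y'| <= L * (B + C)) ->
   forall p p' w w' q q', picard_step_spec v p w q -> picard_step_spec v p' w' q' ->
   (forall i (r : R), 0 < r < T -> `|p i r - p' i r| <= D * expR (2 * L * r)) ->
   forall i (r : R), 0 < r < T -> `|q i r - q' i r| <= D / 2 * expR (2 * L * r).
  move=> T0 L0 D0 nL p p' w w' q q' [c1 w01 _ dw1 dq1] [c2 w02 _ dw2 dq2] pD i r rT.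
  have /andP[r0 _] := rT.
  have L20 : 0 < 2 * L by rewrite mulr_gt0.
  have dwB j (x : R) : 0 < x < T ->
      is_derive x 1 (fun x => w j x - w' j x) (p j x - p' j x).
    by move=> /andP[x0 _]; have H1 := dw1 j x x0; have H2 := dw2 j x x0; der.
  have dwc j : w j t - w' j t @[t --> 0^'+] --> 0.
    have E0 : w j 0 - w' j 0 = 0 by rewrite w01 w02 subrr.
    rewrite -[X in _ --> X]E0.
    by apply: cvgB; apply: cvg_at_right_filter; [exact: (c1 j).1|exact: (c2 j).1].
  have dqB j (x : R) : 0 < x < T ->
      is_derive x 1 (fun x => x ^+ d.+1 * q j x - x ^+ d.+1 * q' j x)
       (x ^+ d * (n j x (w^~ x) (fun i => x * p i x) - n j x (w'^~ x) (fun i => x * p' i x))).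
    move=> /andP[x0 _]; have H1 := dq1 j x x0; have H2 := dq2 j x x0.
    rewrite mulrBr; exact: (derD H1 (derN H2)).
  have dqc j : t ^+ d.+1 * q j t - t ^+ d.+1 * q' j t @[t --> (0 : R)^'+] --> 0.
    rewrite -[X in _ --> X](subrr 0).
    by apply: cvgB; apply: G_cvg0; [exact: (c1 j).2|exact: (c2 j).2].
  have [_] := singular_contraction T0 (ltW L0) (lexx 0) D0 L20 (lexx _) dwB
    (c := fun=> 0) (ltac:(by move=> j; rewrite normr0)) dwc pD dqB dqc
    (n_diff _ _ _ _ _ _ nL) i rT.
  rewrite mulr0 add0r -mulrBr normrM gtr0_norm ?exprn_gt0//.
  by rewrite ler_pM2l// exprn_gt0.
have geom T : 0 < T -> exists C : R, forall k i (r : R), r < T ->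
    `|P k.+1 i r - P k i r| <= C / 2 ^+ k.
  move=> T0; have [L L0 nL] := n_lipschitz T0.
  have [C [C0 HC]] : exists C, 0 <= C /\ forall i (r : R), 0 < r < T -> `|P 1%N i r| <= C.
    have /choice[b Hb] i : exists b, forall r : R, 0 < r < T -> `|P 1%N i r| <= b.
      have [||m _ Hm] := @EVT_max R (fun r => `|P 1%N i r|) 0 T.
      - exact: ltW.
      - apply: continuous_subspaceT => x; apply: continuous_comp; first exact: P_cont.
        exact: norm_continuous.
      - exists `|P 1%N i m| => r /andP[r0 rT]; apply: Hm.
        by rewrite in_itv/= !ltW.
    exists (\sum_i `|b i|); split; first exact: sumr_ge0.
    move=> i r rT; apply: le_trans (Hb i r rT) _; apply: le_trans (ler_norm _) _.
    by rewrite (bigD1 i)//= lerDl sumr_ge0.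
  have bnd k : forall i (r : R), 0 < r < T ->
      `|P k.+1 i r - P k i r| <= C / 2 ^+ k * expR (2 * L * r).
    elim: k => [|k IH] i r rT; have /andP[r0 _] := rT.
      rewrite expr0 divr1 subr0; apply: le_trans (HC i r rT) _.
      by rewrite ler_peMr//; apply/expR_ge1W/ltW/mulr_gt0 => //; exact: mulr_gt0.
    have := step T L (C / 2 ^+ k) T0 L0 _ nL _ _ _ _ _ _ (spec k.+1) (spec k) IH i r rT.
    rewrite exprSr invfM mulrA; apply.
    by rewrite divr_ge0// exprn_ge0.
  exists (C * expR (2 * L * T)) => k i r rT.
  have posb (x : R) : 0 < x < T -> `|P k.+1 i x - P k i x| <= C * expR (2 * L * T) / 2 ^+ k.
    move=> xT; apply: le_trans (bnd k i x xT) _; have /andP[_ /ltW xT'] := xT.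
    rewrite mulrAC ler_wpM2r ?invr_ge0 ?exprn_ge0// ler_wpM2l// ler_expR.
    by rewrite ler_wpM2l// mulr_ge0// ltW.
  have [r0|r0] := ltP 0 r; first by apply: posb; rewrite r0.
  rewrite !(P_neg _ _ _ r0).
  have H : `|P k.+1 i t - P k i t| @[t --> 0^'+] --> `|P k.+1 i 0 - P k i 0|.
    apply: cvg_norm; apply: cvgB; apply: cvg_at_right_filter; exact: P_cont.
  apply: (cvgr_to_le H); near=> t; apply: posb; apply/andP; split.
    by near: t; exact: nbhs_right_gt.
  by near: t; exact: nbhs_right_lt.
have tailb T C k : (forall k i (r : R), r < T -> `|P k.+1 i r - P k i r| <= C / 2 ^+ k) ->
    forall m i (r : R), r < T -> `|P (k + m)%N i r - P k i r| <= 2 * C / 2 ^+ k.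
  move=> HC m i r rT.
  have C0 : 0 <= C.
    by have := le_trans (normr_ge0 _) (HC 0%N i r rT); rewrite expr0 divr1.
  suff : `|P (k + m)%N i r - P k i r| <= 2 * C / 2 ^+ k - 2 * C / 2 ^+ (k + m).
    move/le_trans; apply; rewrite gerBl divr_ge0// ?mulr_ge0// exprn_ge0//.
  elim: m => [|m IH]; first by rewrite addn0 !subrr normr0.
  rewrite addnS; have := HC (k + m)%N i r rT.
  rewrite exprS invfM; set q := (2 ^+ (k + m))^-1 => H.
  have : `|P (k + m).+1 i r - P k i r| <= `|P (k + m).+1 i r - P (k + m)%N i r| +
      `|P (k + m)%N i r - P k i r| by rewrite -[X in `|X| <= _](subrKA (P (k + m)%N i r)) ler_normD.
  by move: IH H; rewrite -/q; lra.
have P_cvg i (r : R) : cvgn (fun k => P k i r).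
  have rT : r < `|r| + 1 by rewrite (le_lt_trans (ler_norm r))// ltrDl.
  have [C HC] := geom (`|r| + 1) (ltr_wpDl (normr_ge0 _) ltr01).
  apply/cauchy_cvgP/cauchy_exP => e e0.
  have /cvgrPdist_lt/(_ e e0)[k _ /(_ k (leqnn k))] := half_pow_cvg0 (2 * C).
  rewrite /= sub0r normrN => He.
  exists (P k i r); exists k => // m /= km.
  rewrite /ball/= distrC -(subnKC km).
  by apply: le_lt_trans (tailb _ _ k HC _ _ _ rT) (le_lt_trans (ler_norm _) He).
pose p i (r : R) : R := limn (fun k => P k i r).
have p_dist T C k : (forall k i (r : R), r < T -> `|P k.+1 i r - P k i r| <= C / 2 ^+ k) ->
    forall i (r : R), r < T -> `|p i r - P k i r| <= 2 * C / 2 ^+ k.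
  move=> HC i r rT.
  have H : `|P m i r - P k i r| @[m --> \oo] --> `|p i r - P k i r|.
    by apply: cvg_norm; apply: cvgB; [exact: P_cvg|exact: cvg_cst].
  apply: (cvgr_to_le H); exists k => // m /= km.
  by rewrite -(subnKC km); exact: tailb HC _ _ _ rT.
have p_cont i : continuous (p i).
  move=> r.
  have T0 : 0 < `|r| + 1 by rewrite ltr_wpDl.
  have rT : r < `|r| + 1 by rewrite (le_lt_trans (ler_norm r))// ltrDl.
  have [C HC] := geom _ T0.
  apply/cvgrPdist_lt => e e0.
  have e30 : 0 < e / 3 by rewrite divr_gt0.
  have /cvgrPdist_lt/(_ _ e30)[k _ /(_ k (leqnn k))] := half_pow_cvg0 (2 * C).
  rewrite /= sub0r normrN => He.
  have pP (x : R) : x < `|r| + 1 -> `|p i x - P k i x| < e / 3.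
    by move=> xT; apply: le_lt_trans (p_dist _ _ k HC _ _ xT) (le_lt_trans (ler_norm _) He).
  have /cvgrPdist_lt/(_ _ e30) PP := P_cont k i r.
  near=> t.
  have tT : t < `|r| + 1 by near: t; exact: lt_nbhsl.
  have H1 := pP r rT; have H2 := pP t tT.
  have H3 : `|P k i r - P k i t| < e / 3 by near: t.
  have -> : p i r - p i t = (p i r - P k i r) + (P k i r - P k i t) - (p i t - P k i t) by ring.
  apply: le_lt_trans (ler_normB _ _) _.
  apply: le_lt_trans (lerD (ler_normD _ _) (lexx _)) _; lra.
have [w_spec q_spec] := (HS p p_cont, HS p p_cont).
pose w := (S p).1; pose q := (S p).2.
(* The limit is a fixed point: [P k.+1] is close to [q], because [P k] is close to [p] and the step
   contracts, and it is close to [p] by construction. *)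
have qp i (r : R) : 0 < r -> q i r = p i r.
  move=> r0; have T0 : 0 < r + 1 by rewrite ltr_wpDl// ltW.
  have rT : 0 < r < r + 1 by rewrite r0/= ltrDl.
  have [L L0 nL] := n_lipschitz T0; have [C HC] := geom _ T0.
  have C0 : 0 <= C.
    by have := le_trans (normr_ge0 _) (HC 0%N i r (ltac:(by case/andP: rT)));
      rewrite expr0 divr1.
  apply/eqP; rewrite -subr_eq0 -normr_le0.
  apply: (@le_half_pow R _ _ (C * expR (2 * L * r) + C)) => k.
  rewrite add0r.
  have Dk : 0 <= 2 * C / 2 ^+ k by rewrite divr_ge0 ?mulr_ge0// exprn_ge0.
  have H1 : `|P k.+1 i r - q i r| <= 2 * C / 2 ^+ k / 2 * expR (2 * L * r).
    apply: (step (r + 1) L _ T0 L0 Dk nL _ _ _ _ _ _ (spec k) w_spec) => // j x /andP[x0 xT].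
    rewrite distrC; apply: le_trans (p_dist _ _ k HC _ _ xT) _.
    by rewrite ler_peMr//; apply/expR_ge1W/ltW/mulr_gt0 => //; exact: mulr_gt0.
  have H2 := p_dist _ _ k.+1 HC i r (ltac:(by case/andP: rT)).
  have -> : q i r - p i r = - (P k.+1 i r - q i r) - (p i r - P k.+1 i r) by ring.
  apply: le_trans (ler_normB _ _) _; rewrite normrN.
  apply: le_trans (lerD H1 H2) _.
  by rewrite exprS invfM; move: (2 ^+ k)^-1 (expR _) => a b; lra.
exists w, q; case: w_spec => c w0 _ dw dq; split => //.
  by move=> i r r0; rewrite qp//; exact: dw.
move=> i r r0; have := dq i r r0; congr (is_derive _ _ _ (_ * n _ _ _ _)).
by apply/funext => j; rewrite qp.
Unshelve. all: by end_near. Qed.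

End picard.

End singular_system.

(** * The equation near the pole *)

Section profile_system.
Context {R : realType}.
Implicit Types (x u w y : 'I_3 -> R) (i : 'I_3).

Lemma ord3_ind (P : 'I_3 -> Prop) : P 0 -> P 1 -> P 2 -> forall i, P i.
Proof.
move=> P0 P1 P2 [[|[|[|//]]] Hi].
- by have -> : Ordinal Hi = 0 by exact: val_inj.
- by have -> : Ordinal Hi = 1 by exact: val_inj.
- by have -> : Ordinal Hi = 2 by exact: val_inj.
Qed.

Lemma ord3_addE : ((0 + 1)%R = 1%R :> 'I_3) * ((0 + 2)%R = 2%R :> 'I_3) *
  ((1 + 1)%R = 2%R :> 'I_3) * ((1 + 2)%R = 0%R :> 'I_3) *
  ((2 + 1)%R = 0%R :> 'I_3) * ((2 + 2)%R = 1%R :> 'I_3).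
Proof. by repeat split; exact: val_inj. Qed.

(** Vectors are coordinate functions on ['I_3] from here on, so that vector identities become
    rational identities in the coordinates, within reach of [ring] and [field]. *)
Definition pole i : R := (i == 2)%:R.
Definition dot x u : R := x 0 * u 0 + x 1 * u 1 + x 2 * u 2.
Definition cross x u i : R := x (i + 1) * u (i + 2) - x (i + 2) * u (i + 1).

Lemma poleE : (pole 0 = 0) * (pole 1 = 0) * (pole 2 = 1).
Proof. by []. Qed.

Variables (alpha beta : R) (d : nat).

(* The equation solved for the second derivative, on the sphere. *)
Definition profile_rhs (r : R) x u i : R :=
  - dot u u * x i - (d%:R - 1) / r * u i
  - (d%:R - 2 + x 2) / r ^+ 2 * (pole i - x 2 * x i)
  - r / 2 * (alpha * u i - beta * cross x u i).

(* With [x = e_3 + r w] and [x' = w + y] the equation becomes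
   [r w'' + (d + 1) w' = regular_rhs r w (r w')], regular at [r = 0].  Off the
   sphere it differs from the original one: [phi_3] was replaced by
   [- |phi|^2 / 2], where [phi = x - e_3]. *)
Definition regular_rhs (r : R) w y i : R :=
  let u j := w j + y j in let x j := pole j + r * w j in
  - dot u u * x i + w 2 * w i
  - (d%:R - 1 + r * w 2) * (dot w w / 2 * pole i - w 2 * w i)
  - r / 2 * (alpha * u i - beta * cross x u i).

(** The last term is the cost of the substitution for [phi_3]: off the sphere,
    [r w_3 + r^2 |w|^2 / 2] equals [(|x|^2 - 1) / 2] instead of zero. *)
Lemma profile_rhs_regular (r : R) w y i : r != 0 ->
  let x j := pole j + r * w j in
  profile_rhs r x (fun j => w j + y j) i = regular_rhs r w y i
    - (d%:R - 1) / r * y i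
    + (d%:R - 1 + r * w 2) * (dot x x - 1) / (2 * r ^+ 2) * pole i.
Proof.
move=> r0; elim/ord3_ind: i;
  rewrite /profile_rhs /regular_rhs /cross /dot !ord3_addE !poleE; field; exact: r0.
Qed.

Section lipschitz.
Variables (T M : R).

(** The size bound [K] travels with the Lipschitz constant because a product is Lipschitz only when
    its factors are bounded. Closure under sums, opposites and products then covers the polynomial
    [regular_rhs]. *)
Definition bounded_lipschitz (f : R -> ('I_3 -> R) -> ('I_3 -> R) -> R) :=
  exists K L : R, [/\ 0 <= K, 0 <= L & forall (r : R) w y w' y' (del : R), 0 < r < T ->
    (forall i, [/\ `|w i| <= M, `|y i| <= M, `|w' i| <= M & `|y' i| <= M]) ->
    (forall i, `|w i - w' i| <= del) -> (forall i, `|y i - y' i| <= del) ->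
    [/\ `|f r w y| <= K, `|f r w' y'| <= K & `|f r w y - f r w' y'| <= L * del]].

Lemma blip_cst (c : R) : bounded_lipschitz (fun _ _ _ => c).
Proof.
exists `|c|, 0; split=> // r w y w' y' del _ _ _ _.
by rewrite subrr normr0 mul0r.
Qed.

Lemma blip_r : bounded_lipschitz (fun r _ _ => r).
Proof.
exists `|T|, 0; split=> // r w y w' y' del /andP[r0 rT] _ _ _.
have rT' : `|r| <= `|T| by rewrite (gtr0_norm r0) (le_trans (ltW rT))// ler_norm.
by rewrite subrr normr0 mul0r.
Qed.

Lemma blip_w i : bounded_lipschitz (fun _ w _ => w i).
Proof.
exists `|M|, 1; split=> // r w y w' y' del _ wM wd _; have [H1 _ H2 _] := wM i.
by rewrite mul1r; split; rewrite ?wd// (le_trans _ (ler_norm M)).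
Qed.

Lemma blip_y i : bounded_lipschitz (fun _ _ y => y i).
Proof.
exists `|M|, 1; split=> // r w y w' y' del _ wM _ yd; have [_ H1 _ H2] := wM i.
by rewrite mul1r; split; rewrite ?yd// (le_trans _ (ler_norm M)).
Qed.

Lemma blipD f g : bounded_lipschitz f -> bounded_lipschitz g ->
  bounded_lipschitz (fun r w y => f r w y + g r w y).
Proof.
move=> [K1 [L1 [K10 L10 H1]]] [K2 [L2 [K20 L20 H2]]].
exists (K1 + K2), (L1 + L2); split; [exact: addr_ge0|exact: addr_ge0|].
move=> r w y w' y' del rT wM wd yd.
have [a1 b1 c1] := H1 _ _ _ _ _ _ rT wM wd yd.
have [a2 b2 c2] := H2 _ _ _ _ _ _ rT wM wd yd.
split; [exact: le_trans (ler_normD _ _) (lerD _ _)|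
        exact: le_trans (ler_normD _ _) (lerD _ _)|].
by rewrite opprD addrACA mulrDl; exact: le_trans (ler_normD _ _) (lerD _ _).
Qed.

Lemma blipN f : bounded_lipschitz f -> bounded_lipschitz (fun r w y => - f r w y).
Proof.
move=> [K1 [L1 [K10 L10 H1]]]; exists K1, L1; split=> // r w y w' y' del rT wM wd yd.
have [a1 b1 c1] := H1 _ _ _ _ _ _ rT wM wd yd.
by rewrite !normrN -opprD normrN.
Qed.

Lemma blipM f g : bounded_lipschitz f -> bounded_lipschitz g ->
  bounded_lipschitz (fun r w y => f r w y * g r w y).
Proof.
move=> [K1 [L1 [K10 L10 H1]]] [K2 [L2 [K20 L20 H2]]].
exists (K1 * K2), (K1 * L2 + L1 * K2); split; [exact: mulr_ge0| |].
  by rewrite addr_ge0// mulr_ge0.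
move=> r w y w' y' del rT wM wd yd.
have [a1 b1 c1] := H1 _ _ _ _ _ _ rT wM wd yd.
have [a2 b2 c2] := H2 _ _ _ _ _ _ rT wM wd yd.
split; [by rewrite normrM ler_pM|by rewrite normrM ler_pM|].
have -> : f r w y * g r w y - f r w' y' * g r w' y' =
  f r w y * (g r w y - g r w' y') + (f r w y - f r w' y') * g r w' y' by ring.
rewrite (le_trans (ler_normD _ _))// !normrM mulrDl lerD//.
  by rewrite -mulrA ler_pM.
by rewrite mulrAC ler_pM.
Qed.

Lemma blip_regular_rhs i : bounded_lipschitz (fun r w y => regular_rhs r w y i).
Proof.
rewrite /regular_rhs /dot /cross.
repeat first [exact: blip_cst | exact: blip_r | exact: blip_w | exact: blip_y
  | apply: blipD | apply: blipN | apply: blipM].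
Qed.

Lemma regular_rhs_bounds : exists K L : R, [/\ 0 < K, 0 < L &
  forall (r : R) w y w' y' (B C : R), 0 < r < T ->
    (forall i, [/\ `|w i| <= M, `|y i| <= M, `|w' i| <= M & `|y' i| <= M]) ->
    (forall i, `|w i - w' i| <= B) -> (forall i, `|y i - y' i| <= C) ->
    forall i, `|regular_rhs r w y i| <= K /\
      `|regular_rhs r w y i - regular_rhs r w' y' i| <= L * (B + C)].
Proof.
have [K0 [L0 [K00 L00 H0]]] := blip_regular_rhs 0.
have [K1 [L1 [K10 L10 H1]]] := blip_regular_rhs 1.
have [K2 [L2 [K20 L20 H2]]] := blip_regular_rhs 2.
exists (K0 + K1 + K2 + 1), (L0 + L1 + L2 + 1); split; [lra|lra|].
move=> r w y w' y' B C rT wM wB yC i.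
have B0 : 0 <= B := le_trans (normr_ge0 _) (wB 0).
have C0 : 0 <= C := le_trans (normr_ge0 _) (yC 0).
have BC0 : 0 <= B + C by exact: addr_ge0.
have wBC j : `|w j - w' j| <= B + C by have := wB j; lra.
have yBC j : `|y j - y' j| <= B + C by have := yC j; lra.
elim/ord3_ind: i.
- have [a _ b] := H0 _ _ _ _ _ _ rT wM wBC yBC; split; first lra.
  by apply: (le_trans b); rewrite ler_wpM2r//; lra.
- have [a _ b] := H1 _ _ _ _ _ _ rT wM wBC yBC; split; first lra.
  by apply: (le_trans b); rewrite ler_wpM2r//; lra.
- have [a _ b] := H2 _ _ _ _ _ _ rT wM wBC yBC; split; first lra.
  by apply: (le_trans b); rewrite ler_wpM2r//; lra.
Qed.

End lipschitz.

Section clamp.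
Variable M : R.

Definition clamp (a : R) : R := 
  if a < - M then - M else if M < a then M else a.

Lemma clamp_le (a : R) : 0 <= M -> `|clamp a| <= M.
Proof.
move=> M0; rewrite /clamp ler_norml.
by case: (ltP a (- M)) => ?; [|case: (ltP M a) => ?]; apply/andP; split; lra.
Qed.

Lemma clamp_id (a : R) : `|a| <= M -> clamp a = a.
Proof.
rewrite ler_norml => /andP[H1 H2]; by rewrite /clamp !ltNge H1 H2.
Qed.

Lemma clamp_lipschitz (a b : R) : 0 <= M -> `|clamp a - clamp b| <= `|a - b|.
Proof.
move=> M0; have := lexx `|a - b|; rewrite ler_norml /clamp => /andP[H3 H4]; rewrite ler_norml.
case: (ltP a (- M)) => ?; [|case: (ltP M a) => ?];
  (case: (ltP b (- M)) => ?; [|case: (ltP M b) => ?]); apply/andP; split; lra.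
Qed.

Lemma clamp_continuous : 0 <= M -> continuous clamp.
Proof.
move=> M0 a; apply/cvgrPdist_le => e e0; near=> b.
apply: le_trans (clamp_lipschitz _ _ M0) _.
by near: b; apply: cvgr_dist_le.
Unshelve. all: by end_near. Qed.

End clamp.

Lemma singular_derive (p : R -> R) (r c : R) : 0 < r ->
  is_derive r 1 (fun t => t ^+ d.+1 * p t) (r ^+ d * c) ->
  is_derive r 1 p ((c - d.+1%:R * p r) / r).
Proof.
move=> r0 H.
have rn0 : r != 0 by rewrite gt_eqF.
apply: (@der_near _ (fun t => (t ^+ d.+1 * p t) / t ^+ d.+1)).
  near=> t; rewrite mulrAC divff ?mul1r// expf_neq0// gt_eqF//.
  by near: t; exact: lt_nbhsr.
pose f (t : R) := t ^+ d.+1 * p t; rewrite -/f in H *.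
have H' : is_derive r 1 (fun t => f t / t ^+ d.+1)
  (f r * (- (r ^+ d.+1) ^- 2 * (d.+1%:R * r ^+ d * 1)) + (r ^+ d.+1)^-1 * (r ^+ d * c)).
  by der; rewrite expf_neq0.
apply: (der_eq H'); rewrite /f exprS; have : r ^+ d != 0 by rewrite expf_neq0.
by move: (r ^+ d) (d.+1%:R) => q D q0; field; rewrite rn0 q0.
Unshelve. all: by end_near. Qed.

End profile_system.

(** * Recovery of the sphere constraint and monotonicity of the energy *)

Section sphere_and_energy.
Context {R : realType}.
Variables (alpha beta : R) (d : nat).

(** The bounded interval [(0, T)] lets these systems be used inside the continuation argument,
    before the truncation is known to be inactive for all times. *)
Definition regular_system (T : R) (w p : 'I_3 -> R -> R) :=
  (forall i (r : R), 0 < r < T -> is_derive r 1 (w i) (p i r)) /\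
  (forall i (r : R), 0 < r < T -> is_derive r 1 (fun t => t ^+ d.+1 * p i t)
     (r ^+ d * regular_rhs alpha beta d r (w^~ r) (fun j => r * p j r) i)).

Definition profile_system (T : R) (x x' : 'I_3 -> R -> R) :=
  [/\ forall i (r : R), 0 < r < T -> is_derive r 1 (x i) (x' i r),
      forall i (r : R), 0 < r < T ->
        is_derive r 1 (x' i) (profile_rhs alpha beta d r (x^~ r) (x'^~ r) i)
    & forall r : R, 0 < r < T -> dot (x^~ r) (x^~ r) = 1].

(* The defect [r * (2 w_3 + r |w|^2)] of [|x|^2 = 1] solves a linear equation of
   the same singular type, with zero initial value. *)
Lemma regular_system_sphere (T M : R) (w p : 'I_3 -> R -> R) (v : 'I_3 -> R) :
  regular_system T w p -> (forall i, w i t @[t --> 0^'+] --> v i) -> v 2 = 0 ->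
  (forall i (r : R), 0 < r < T -> `|w i r| <= M /\ `|p i r| <= M) ->
  forall r : R, 0 < r < T ->
    dot (fun j => pole j + r * w j r) (fun j => pole j + r * w j r) = 1.
Proof.
move=> [dw dp] wv v0 wM r rT.
have T0 : 0 < T by case/andP: rT; exact: lt_trans.
have M0 : 0 <= M by apply: le_trans (wM 0 r rT).1.
pose m : R := d%:R.
(* Here [|x|^2 = 1 + t S] and [sg] is the derivative of [S]. With [w] and [p] given, [dn] is linear
   in [S] and [sg] with bounded coefficients, and [(t^(d+1) sg)' = t^d dn]. *)
pose S (t : R) := 2 * w 2 t + t * dot (w^~ t) (w^~ t).
pose sg (t : R) := 2 * p 2 t + dot (w^~ t) (w^~ t) + 2 * t * dot (w^~ t) (p^~ t).
pose u (t : R) j := w j t + t * p j t.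
pose k (t : R) := - 2 * dot (u t) (u t) * t + w 2 t * (m + t * w 2 t).
pose dn (t : R) := S t * k t - t * alpha / 2 * (S t + t * sg t).
have dS (t : R) : 0 < t < T -> is_derive t 1 S (sg t).
  move=> tT; have H0 := dw 0 t tT; have H1 := dw 1 t tT; have H2 := dw 2 t tT.
  by rewrite /S /dot; dereq; rewrite /sg /dot; ring.
have dsg (t : R) : 0 < t < T ->
    is_derive t 1 (fun t => t ^+ d.+1 * sg t) (t ^+ d * dn t).
  move=> tT; have /andP[t0 _] := tT.
  have H0 := dw 0 t tT; have H1 := dw 1 t tT; have H2 := dw 2 t tT.
  have P0 := singular_derive t0 (dp 0 t tT).
  have P1 := singular_derive t0 (dp 1 t tT).
  have P2 := singular_derive t0 (dp 2 t tT).
  rewrite /sg /dot; dereq; rewrite /= exprS /dn /k /sg /S /u /regular_rhs /cross /dot.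
  rewrite !ord3_addE !poleE -natr1 -/m.
  move: (t ^+ d) => td; field; exact: lt0r_neq0.
have S0 : S t @[t --> 0^'+] --> 0.
  have E0 : 2 * v 2 + 0 * (v 0 * v 0 + v 1 * v 1 + v 2 * v 2) = 0 by rewrite v0; ring.
  rewrite -[X in _ --> X]E0 /S /dot; apply: cvgD; first by apply: cvgM; [exact: cvg_cst|exact: wv].
  apply: cvgM; first by apply: cvg_at_right_filter; exact: cvg_id.
  by repeat apply: cvgD; apply: cvgM; exact: wv.
have dotb (a b : 'I_3 -> R) (A B : R) : (forall i, `|a i| <= A) -> (forall i, `|b i| <= B) ->
    `|dot a b| <= 3 * (A * B).
  move=> aA bB; have AB i j : `|a i * b j| <= A * B by rewrite normrM ler_pM.
  rewrite /dot; apply: le_trans (ler_normD _ _) _.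
  apply: le_trans (lerD (ler_normD _ _) (lexx _)) _.
  by have := AB 0 0; have := AB 1 1; have := AB 2 2; lra.
have TM (t : R) i : 0 < t < T -> `|t * p i t| <= T * M.
  move=> tT; have /andP[t0 /ltW tT'] := tT.
  by rewrite normrM (gtr0_norm t0) ler_pM ?(ltW t0)//; exact: (wM i t tT).2.
have sgb (t : R) : 0 < t < T -> `|sg t| <= 2 * M + 3 * (M * M) + 2 * T * (3 * (M * M)).
  move=> tT; have /andP[t0 /ltW tT'] := tT.
  have H1 := dotb _ _ _ _ (fun i => (wM i t tT).1) (fun i => (wM i t tT).1).
  have H2 := dotb _ _ _ _ (fun i => (wM i t tT).1) (fun i => (wM i t tT).2).
  rewrite /sg; apply: le_trans (ler_normD _ _) _.
  apply: le_trans (lerD (ler_normD _ _) (lexx _)) _.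
  rewrite normrM [`|_ * _ * dot _ _|]normrM normrM (gtr0_norm t0) ger0_norm//.
  have := (wM 2 t tT).2; move=> H3.
  apply: lerD; first by apply: lerD => //; lra.
  by apply: ler_pM => //; [apply: mulr_ge0 => //; lra|lra].
pose K1 := 2 * (3 * ((M + T * M) * (M + T * M))) * T + M * (m + T * M).
have m0 : 0 <= m by rewrite ler0n.
have TM0 : 0 <= T * M by rewrite mulr_ge0// ltW.
have kb (t : R) : 0 < t < T -> `|k t| <= K1.
  move=> tT; have /andP[t0 /ltW tT'] := tT.
  have ub i : `|u t i| <= M + T * M.
    by apply: le_trans (ler_normD _ _) (lerD (wM i t tT).1 (TM t i tT)).
  have H1 := dotb _ _ _ _ ub ub.
  rewrite /k; apply: le_trans (ler_normD _ _) _; apply: lerD.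
    rewrite !normrM normrN (gtr0_norm t0) [`|2|]ger0_norm//.
    by apply: ler_pM; rewrite ?(ltW t0) ?mulr_ge0// ler_pM2l.
  rewrite normrM; apply: ler_pM => //; first exact: (wM 2 t tT).1.
  apply: le_trans (ler_normD _ _) _; rewrite (ger0_norm m0) lerD2l normrM.
  by rewrite (gtr0_norm t0) ler_pM ?(ltW t0)//; exact: (wM 2 t tT).1.
have K10 : 0 <= K1.
  by rewrite /K1 addr_ge0// !mulr_ge0// ?addr_ge0// ltW.
pose K2 := T * `|alpha| / 2.
have K20 : 0 <= K2 by rewrite /K2 divr_ge0// mulr_ge0// ltW.
have L0 : 0 < K1 + K2 + 1 by lra.
have dnL (t B C : R) : 0 < t < T -> (forall _ : unit, `|S t| <= B) ->
    (forall _ : unit, `|sg t| <= C) -> forall _ : unit, `|dn t| <= (K1 + K2 + 1) * (B + t * C).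
  move=> tT /(_ tt) SB /(_ tt) sC _; have /andP[t0 /ltW tT'] := tT.
  have B0 : 0 <= B := le_trans (normr_ge0 _) SB.
  have C0 : 0 <= C := le_trans (normr_ge0 _) sC.
  have tC0 : 0 <= t * C by rewrite mulr_ge0// ltW.
  have H1 : `|S t * k t| <= K1 * B by rewrite normrM mulrC ler_pM// kb.
  have H2 : `|t * alpha / 2 * (S t + t * sg t)| <= K2 * (B + t * C).
    rewrite normrM ler_pM//.
      rewrite /K2 !normrM (gtr0_norm t0) [`|2^-1|]ger0_norm ?invr_ge0//.
      by rewrite ler_wpM2r ?invr_ge0// ler_wpM2r.
    apply: le_trans (ler_normD _ _) _; apply: lerD => //.
    by rewrite normrM (gtr0_norm t0) ler_wpM2l// ltW.
  rewrite /dn; apply: le_trans (ler_normB _ _) _; apply: le_trans (lerD H1 H2) _.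
  have := mulr_ge0 K10 tC0; move: (t * C) tC0 B0 {H1 H2 L0 kb} => tC.
  by clear K20; move: {K10} K1 K2 => k1 k2; lra.
(* The initial bound is [a = 0], because [S] tends to [2 v_3 = 0]; hence [S] vanishes. *)
have [H _] := @singular_gronwall R unit d T (K1 + K2 + 1) 0 _ (fun _ => S) (fun _ => sg)
  (fun _ => dn) (fun _ => 0) L0 (lexx 0) (fun _ => dS) (fun _ => ltac:(by rewrite normr0))
  (fun _ => S0) (fun _ => sgb) (fun _ => dsg) dnL tt r rT.
have {H} Sr : S r = 0.
  by apply/eqP; rewrite -normr_le0 -(mul0r (1 + expR (2 * (K1 + K2 + 1) * r))).
have -> : dot (fun j => pole j + r * w j r) (fun j => pole j + r * w j r) = 1 + r * S r.
  by rewrite /S /dot !poleE; ring.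
by rewrite Sr mulr0 addr0.
Qed.

Lemma regular_system_profile (T : R) (w p : 'I_3 -> R -> R) :
  regular_system T w p ->
  (forall r : R, 0 < r < T ->
    dot (fun j => pole j + r * w j r) (fun j => pole j + r * w j r) = 1) ->
  profile_system T (fun i r => pole i + r * w i r) (fun i r => w i r + r * p i r).
Proof.
move=> [dw dp] sph; split => // i r rT; have dwi := dw i r rT.
  by dereq; ring.
have /andP[r0 _] := rT; have rn0 : r != 0 by rewrite gt_eqF.
have dpi := singular_derive r0 (dp i r rT).
dereq; rewrite (profile_rhs_regular _ _ _ (w^~ r) (fun j => r * p j r))// sph//.
by rewrite -natr1; field.
Qed.

(** On the sphere [potential x_3] equals [x_1^2 + x_2^2 + (d - 2) |x - e_3|^2], the numerator of the
    undifferentiated term of the energy density. *)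
Definition potential (c : R) : R := 1 - c ^+ 2 + (d%:R - 2) * (2 - 2 * c).

Lemma profile_system_tangent T x x' : profile_system T x x' ->
  forall r : R, 0 < r < T -> dot (x^~ r) (x'^~ r) = 0.
Proof.
move=> [dx _ sph] r rT; have /andP[r0 rT'] := rT.
have H0 := dx 0 r rT; have H1 := dx 1 r rT; have H2 := dx 2 r rT.
have D1 : is_derive r 1 (fun t => dot (x^~ t) (x^~ t)) (2 * dot (x^~ r) (x'^~ r)).
  by rewrite /dot; dereq; ring.
have D2 : is_derive r 1 (fun t => dot (x^~ t) (x^~ t)) 0.
  apply: (@der_near _ (fun=> 1)).
  near=> t; rewrite sph//; apply/andP; split; near: t; [exact: lt_nbhsr|exact: lt_nbhsl].
have := @derive_val _ _ _ _ _ _ _ D1; rewrite (@derive_val _ _ _ _ _ _ _ D2); lra.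
Unshelve. all: by end_near. Qed.

Definition profile_energy (x x' : 'I_3 -> R -> R) (r : R) : R :=
  r ^+ 2 * dot (x'^~ r) (x'^~ r) - potential (x 2 r).

(** Pair the equation with [2 r^2 x']. The [beta] term is orthogonal to [x'], the terms along [x]
    vanish by tangency, and the [e_3] term is cancelled by the derivative of the potential. What
    remains is [2 r - 2 (d - 1) r - alpha r^3] times [|x'|^2]. *)
Lemma profile_energy_derive T x x' : profile_system T x x' ->
  forall r : R, 0 < r < T -> is_derive r 1 (profile_energy x x')
    (- (2 * (d%:R - 2) * r + alpha * r ^+ 3) * dot (x'^~ r) (x'^~ r)).
Proof.
move=> sys r rT; have [dx dx' _] := sys; have /andP[r0 rT'] := rT.
have Z := profile_system_tangent sys rT.
have H0 := dx 0 r rT; have H1 := dx 1 r rT; have H2 := dx 2 r rT.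
have K0 := dx' 0 r rT; have K1 := dx' 1 r rT; have K2 := dx' 2 r rT.
rewrite /profile_energy /potential /dot; dereq.
set A := (X in X = _); set B := (X in _ = X).
(* The two expressions differ by a multiple of the constraint [x . x' = 0]; the same device recurs
   in every later derivative computation. *)
have -> : A = B + (- 2 * r ^+ 2 * dot (x'^~ r) (x'^~ r) + 2 * (d%:R - 2 + x 2 r) * x 2 r)
    * dot (x^~ r) (x'^~ r).
  rewrite /A /B /profile_rhs /cross /dot !ord3_addE !poleE /=.
  by move: (d%:R) => m; field; rewrite gt_eqF.
by rewrite Z mulr0 addr0.
Qed.

Hypothesis alpha0 : 0 <= alpha.
Hypothesis d2 : 2 <= d%:R :> R.

Lemma dot_ge0 (u : 'I_3 -> R) : 0 <= dot u u.
Proof. by rewrite /dot !addr_ge0// -expr2 sqr_ge0. Qed.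

Lemma dot_coord (u : 'I_3 -> R) i : u i ^+ 2 <= dot u u.
Proof.
by elim/ord3_ind: i; rewrite /dot; have := sqr_ge0 (u 0); have := sqr_ge0 (u 1);
  have := sqr_ge0 (u 2); rewrite !expr2; lra.
Qed.

Lemma profile_energy_nonincreasing T x x' : profile_system T x x' ->
  forall r s : R, 0 < r -> r <= s -> s < T -> profile_energy x x' s <= profile_energy x x' r.
Proof.
move=> sys r s r0 rs sT; rewrite -lerN2.
apply: (@der_ge0_le R (fun t => - profile_energy x x' t)
  (fun t => - (- (2 * (d%:R - 2) * t + alpha * t ^+ 3) * dot (x'^~ t) (x'^~ t)))) => //.
- move=> t /andP[rt ts]; apply: derN; apply: profile_energy_derive sys _ _.
  by rewrite (lt_le_trans r0)//= (le_lt_trans ts).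
- move=> t /andP[rt ts]; have t0 : 0 < t by exact: lt_trans rt.
  rewrite mulNr opprK; apply: mulr_ge0; last exact: dot_ge0.
  apply: addr_ge0; last by rewrite mulr_ge0// exprn_ge0// ltW.
  by rewrite mulr_ge0 ?(ltW t0)// mulr_ge0// subr_ge0.
Qed.

Lemma profile_energy_cvg0 T x x' (v : 'I_3 -> R) : profile_system T x x' ->
  (forall i, x i t @[t --> 0^'+] --> pole i) -> (forall i, x' i t @[t --> 0^'+] --> v i) ->
  profile_energy x x' t @[t --> 0^'+] --> 0.
Proof.
move=> sys xp xv.
have E0 : 0 * 0 * (v 0 * v 0 + v 1 * v 1 + v 2 * v 2)
    - (1 - 1 * 1 + (d%:R - 2) * (2 - 2 * 1)) = 0 :> R by ring.
rewrite -[X in _ --> X]E0 /profile_energy /potential /dot; under eq_fun do rewrite [x 2 _ ^+ 2]expr2 [_ ^+ 2]expr2.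
have id0 : t @[t --> (0 : R)^'+] --> 0 by apply: cvg_at_right_filter; exact: cvg_id.
apply: cvgB.
  apply: cvgM; first by apply: cvgM.
  by repeat apply: cvgD; apply: cvgM; exact: xv.
apply: cvgD; first by apply: cvgB; [exact: cvg_cst|apply: cvgM; exact: (xp 2)].
apply: cvgM; first exact: cvg_cst.
by apply: cvgB; [exact: cvg_cst|apply: cvgM; [exact: cvg_cst|exact: (xp 2)]].
Qed.

Lemma profile_energy_le0 T x x' (v : 'I_3 -> R) : profile_system T x x' ->
  (forall i, x i t @[t --> 0^'+] --> pole i) -> (forall i, x' i t @[t --> 0^'+] --> v i) ->
  forall r : R, 0 < r < T -> profile_energy x x' r <= 0.
Proof.
move=> sys xp xv r /andP[r0 rT].
apply: (cvgr_to_ge (profile_energy_cvg0 sys xp xv)); near=> s.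
have s0 : 0 < s by near: s; exact: nbhs_right_gt.
have sr : s < r by near: s; exact: nbhs_right_lt.
exact: profile_energy_nonincreasing sys _ _ s0 (ltW sr) rT.
Unshelve. all: by end_near. Qed.

Lemma profile_coord_le1 T x x' : profile_system T x x' ->
  forall r i, 0 < r < T -> `|x i r| <= 1.
Proof.
move=> [_ _ sph] r i rT; rewrite -(@ler_pXn2r _ 2)// ?nnegrE//.
by rewrite real_normK ?num_real// expr1n -(sph r rT) dot_coord.
Qed.

Lemma potential_le (c : R) : `|c| <= 1 -> potential c <= 4 * d%:R.
Proof.
rewrite ler_norml /potential => /andP[c1 c2].
have := sqr_ge0 c; have : (d%:R - 2) * (2 - 2 * c) <= (d%:R - 2) * 4.
  by rewrite ler_wpM2l ?subr_ge0//; lra.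
by move: (d%:R) (c ^+ 2) => m c2'; lra.
Qed.

(** Nonpositive energy means that [r^2 |x'|^2] is at most the potential. The coordinate bound
    replaces the square root of [4 d] by [4 d], which is larger since [4 d >= 1]. *)
Lemma profile_speed T x x' (v : 'I_3 -> R) : profile_system T x x' ->
  (forall i, x i t @[t --> 0^'+] --> pole i) -> (forall i, x' i t @[t --> 0^'+] --> v i) ->
  forall r : R, 0 < r < T ->
    r ^+ 2 * dot (x'^~ r) (x'^~ r) <= 4 * d%:R /\ forall i, `|x' i r| <= 4 * d%:R / r.
Proof.
move=> sys xp xv r rT; have /andP[r0 _] := rT.
have H : r ^+ 2 * dot (x'^~ r) (x'^~ r) <= 4 * d%:R.
  have := profile_energy_le0 sys xp xv rT; rewrite /profile_energy subr_le0.
  by move=> /le_trans; apply; apply/potential_le/(profile_coord_le1 sys).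
split=> // i; rewrite ler_pdivlMr// mulrC -(gtr0_norm r0) -normrM (gtr0_norm r0).
rewrite -(@ler_pXn2r _ 2)// ?nnegrE ?mulr_ge0//.
rewrite real_normK ?num_real// exprMn.
apply: (@le_trans _ _ (r ^+ 2 * dot (x'^~ r) (x'^~ r))).
  by rewrite ler_pM2l ?exprn_gt0// (dot_coord (x'^~ r)).
apply: (le_trans H); move: d2; set m := (d%:R : R) => m2.
by nra.
Qed.

End sphere_and_energy.

(** * Existence *)

Section bounded_existence.
Context {R : realType}.
Variables (alpha beta : R) (d : nat).

Lemma left_limit_bound (f : R -> R) (K s t : R) : s < t -> {for t, continuous f} ->
  (forall x, s < x < t -> `|f x| <= K) -> `|f t| <= K.
Proof.
move=> st cf fK.
have H : `|f x| @[x --> t^'-] --> `|f t|.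
  by apply: cvg_norm; apply: cvg_at_left_filter; exact: cf.
apply: (cvgr_to_le H); near=> x; apply: fK; apply/andP; split; near: x.
  exact: nbhs_left_gt.
exact: nbhs_left_lt.
Unshelve. all: by end_near. Qed.

Lemma continuous_bounded_oo (I : finType) (f : I -> R -> R) (T : R) : 0 <= T ->
  (forall i, continuous (f i)) ->
  exists2 C, 0 <= C & forall i (r : R), 0 <= r <= T -> `|f i r| <= C.
Proof.
move=> T0 cf.
have /choice[b Hb] i : exists b, forall r : R, 0 <= r <= T -> `|f i r| <= b.
  have [||m _ Hm] := @EVT_max R (fun r => `|f i r|) 0 T.
  - exact: T0.
  - apply: continuous_subspaceT => x; apply: continuous_comp; first exact: cf.
    exact: norm_continuous.
  - by exists `|f i m| => r rT; apply: Hm; rewrite in_itv.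
exists (\sum_i `|b i|); first exact: sumr_ge0.
move=> i r rT; apply: le_trans (Hb i r rT) _; apply: le_trans (ler_norm _) _.
by rewrite (bigD1 i)//= lerDl sumr_ge0.
Qed.

(** The average [r^-(d+1) \int_0^r s^d n] is at most [K / (d + 1)] in size; the cruder [K]
    suffices. *)
Lemma singular_bound (p n : R -> R) (K T : R) : 0 <= K ->
  (forall r : R, 0 < r < T -> is_derive r 1 (fun t => t ^+ d.+1 * p t) (r ^+ d * n r)) ->
  (forall r : R, 0 < r < T -> `|n r| <= K) ->
  t ^+ d.+1 * p t @[t --> 0^'+] --> 0 ->
  forall r : R, 0 < r < T -> `|p r| <= K.
Proof.
move=> K0 dp nK p0 r rT; have /andP[r0 _] := rT.
pose g (z : R) := K * z ^+ d.+1.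
have dg (z : R) : is_derive z 1 g (K * (d.+1%:R * z ^+ d)).
  by rewrite /g; dereq; rewrite /=; ring.
have g0 : g 0 = 0 by rewrite /g exprS mul0r mulr0.
have : `|r ^+ d.+1 * p r - 0| <= g r - g 0.
  apply: (@der_comparison0 R (fun z => z ^+ d.+1 * p z) g _ _ 0 (g 0) T
    dp (fun z _ => dg z)) => //; first exact: der_cvg_at_right (dg 0).
  move=> z zT; have /andP[z0 _] := zT.
  have zd : 0 <= z ^+ d by rewrite exprn_ge0// ltW.
  rewrite normrM (ger0_norm zd) [leRHS]mulrCA mulrC.
  apply: (@le_trans _ _ (K * z ^+ d)); first by rewrite ler_wpM2r// nK.
  by rewrite ler_peMl ?mulr_ge0// ler1n.
rewrite g0 !subr0 /g normrM gtr0_norm ?exprn_gt0//.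
by rewrite mulrC ler_pM2r// exprn_gt0.
Qed.

Lemma regular_rhs_clamp_continuous (M : R) (w y : 'I_3 -> R -> R) i : 0 <= M ->
  (forall i, continuous (w i)) -> (forall i, continuous (y i)) ->
  continuous (fun r => regular_rhs alpha beta d r (fun j => clamp M (w j r))
    (fun j => clamp M (y j r)) i).
Proof.
move=> M0 cw cy r.
have cw' j : continuous_at r (fun t => clamp M (w j t)).
  by apply: continuous_comp; [exact: cw|exact: clamp_continuous].
have cy' j : continuous_at r (fun t => clamp M (y j t)).
  by apply: continuous_comp; [exact: cy|exact: clamp_continuous].
by rewrite /regular_rhs /dot /cross; cnt; rewrite ?cw' ?cy'.
Qed.

Hypothesis alpha0 : 0 <= alpha.
Hypothesis d2 : 2 <= d%:R :> R.

(** The truncated system has a global solution, and a truncation level depending on [A], not on [v],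
    turns out never to be reached. The bound is proved in two phases, by the integral equation up to
    [r0] and by the energy beyond it. *)
Lemma bounded_profiles (A : R) : 0 <= A -> exists2 M : R, 0 <= M &
  forall v : 'I_3 -> R, v 2 = 0 -> (forall i, `|v i| <= A) ->
  exists w p : 'I_3 -> R -> R,
  [/\ forall i, continuous (w i) /\ continuous (p i), forall i, w i 0 = v i,
      forall T, regular_system alpha beta d T w p &
      forall i (r : R), 0 <= r -> `|w i r| <= M /\ `|r * p i r| <= M].
Proof.
move=> A0.
have [K [L' [K0 _ HK]]] := regular_rhs_bounds alpha beta d 1 (A + 1).
(* [K] bounds the right-hand side while [|w|] and [|r p|] stay below [A + 1]. The choice
   [r0 K <= 1/2] then keeps both [|w - v|] and [|r p|] below [1/2] up to [r0], strictly inside that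
   range. *)
pose r0 := Num.min (1 / 2) (1 / (2 * K)).
have r00 : 0 < r0 by rewrite /r0 lt_min !divr_gt0// mulr_gt0.
have r0h : r0 <= 1 / 2 by rewrite /r0 ge_min lexx.
have r0K : r0 * K <= 1 / 2.
  rewrite -ler_pdivlMr//; have -> : 1 / 2 / K = 1 / (2 * K) by field; rewrite gt_eqF.
  by rewrite /r0 ge_min lexx orbT.
(* For [r > r0], [r p = x' - w] with [|x'| <= 4 d / r] by the energy and [|w| <= 2 / r] because [x]
   and the pole have coordinates of size at most [1]. *)
pose Q := 4 * d%:R / r0 + 2 / r0.
have m0 : 0 <= d%:R :> R by rewrite ler0n.
have Q0 : 0 <= Q by rewrite addr_ge0// divr_ge0 ?mulr_ge0// ltW.
have hQ : 2 / r0 <= Q by rewrite lerDr divr_ge0 ?mulr_ge0// ltW.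
(* The level lies strictly above the bounds of both phases, so it is never attained. *)
pose M := A + 1 + Q + 1.
have M0 : 0 <= M by rewrite /M; lra.
exists M => // v v2 vA.
have [|w y cw cy i|w [p [cwp w0 dw dp]]] := @singular_picard R 'I_3 d
  (fun i r w y => regular_rhs alpha beta d r (fun j => clamp M (w j)) (fun j => clamp M (y j)) i)
  _ _ v.
- move=> T T0; have [K' [L [_ L0 HL]]] := regular_rhs_bounds alpha beta d T M.
  exists L => // r w y w' y' B C rT wB yC i.
  have [|||_] := HL r (fun j => clamp M (w j)) (fun j => clamp M (y j))
    (fun j => clamp M (w' j)) (fun j => clamp M (y' j)) B C rT _ _ _ i => //.
  + by move=> j; split; exact: clamp_le.
  + by move=> j; apply: le_trans (wB j); exact: clamp_lipschitz.
  + by move=> j; apply: le_trans (yC j); exact: clamp_lipschitz.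
- exact: regular_rhs_clamp_continuous.
have cy i : continuous (fun t : R => t * p i t).
  by move=> t; apply: cvgM; [exact: cvg_id|exact: (cwp i).2].
have w_cvg0 i : w i t @[t --> 0^'+] --> v i.
  by rewrite -w0; apply: cvg_at_right_filter; exact: (cwp i).1.
(* Strict inequalities make the condition open in [t], as [real_induction] requires. *)
pose B (b t : R) := forall i, `|w i t| < b /\ `|t * p i t| < b.
have Bopen b t : B b t -> \forall s \near t, B b s.
  move=> Bt.
  have H i : \forall s \near t, `|w i s| < b /\ `|s * p i s| < b.
    have [H1 H2] := Bt i.
    have c1 : `|w i s| @[s --> t] --> `|w i t| by apply: cvg_norm; exact: (cwp i).1.
    have c2 : `|s * p i s| @[s --> t] --> `|t * p i t| by apply: cvg_norm; exact: cy.
    near=> s; split; near: s; [exact: (cvgr_lt _ c1)|exact: (cvgr_lt _ c2)].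
  have H0 := H 0; have H1 := H 1; have H2 := H 2.
  near=> s; elim/ord3_ind; near: s => //.
have sys_below t : (forall s, 0 < s < t -> B M s) -> regular_system alpha beta d t w p.
  move=> Bs; split=> i r /andP[rr rt]; first exact: dw.
  have E1 : (fun j => clamp M (w j r)) = w^~ r.
    by apply/funext => j; rewrite clamp_id// ltW// (Bs r _ j).1// rr.
  have E2 : (fun j => clamp M (r * p j r)) = (fun j => r * p j r).
    by apply/funext => j; rewrite clamp_id// ltW// (Bs r _ j).2// rr.
  by have := dp i r rr; rewrite E1 E2.
have phase1 t : 0 <= t -> t <= r0 -> B (A + 1) t.
  apply: (@real_induction R (fun t => t <= r0 -> B (A + 1) t)).
  - move=> _ i; rewrite w0 mul0r normr0; have := vA i; lra.
  - move=> s s0 Bs; have [sr0|sr0] := leP s r0.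
      by apply: filterS (Bopen _ _ (Bs sr0)).
    by near=> x; move=> sx xr0; lra.
  - move=> s s0 Bs sr0.
    have Bs' x : 0 < x < s -> B (A + 1) x.
      by move=> /andP[x0 xs]; apply: Bs; [rewrite xs ltW|lra].
    have BM x : 0 < x < s -> B M x.
      by move=> /Bs' H i; have [H1 H2] := H i; split; rewrite /M; lra.
    have [_ dp'] := sys_below s BM.
    have pK i x : 0 < x < s -> `|p i x| <= K.
      move=> xs; have /andP[x0 xs'] := xs.
      have bnd z : 0 < z < s ->
          `|regular_rhs alpha beta d z (w^~ z) (fun j => z * p j z) i| <= K.
        move=> zs; have /andP[z0 zs'] := zs.
        have [|j|j|j|] := HK z (w^~ z) (fun j => z * p j z) (w^~ z) (fun j => z * p j z) 0 0 _ _ _ _ i => //.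
        - by rewrite z0/=; lra.
        - by have [/ltW ? /ltW ?] := Bs' z zs j.
        - by rewrite subrr normr0.
        - by rewrite subrr normr0.
      apply: (singular_bound (ltW K0) (dp' i) bnd) => //.
      have E0 : 0 ^+ d.+1 * p i 0 = 0 by rewrite exprS !mul0r.
      rewrite -[X in _ --> X]E0; apply: (@cvg_at_right_filter _ _ (fun z => z ^+ d.+1 * p i z)).
      by apply: cvgM; [exact: exprn_continuous|exact: (cwp i).2].
    have wK i x : 0 < x < s -> `|w i x - v i| <= K * x - K * 0.
      apply: (@der_comparison0 R (w i) (fun z => K * z) (p i) (fun=> K) _ _ s) => //.
      - by move=> z /andP[z0 _]; exact: dw.
      - by move=> z _; dereq; ring.
      - by apply: (@der_cvg_at_right R (fun z => K * z)); der.
      - by move=> z; exact: pK.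
    have sK : s * K <= 1 / 2 by apply: le_trans r0K; rewrite ler_pM2r.
    move=> i.
    have H1 : `|p i s| <= K by apply: left_limit_bound s0 _ (pK i); exact: (cwp i).2.
    have H2 : `|w i s - v i| <= 1 / 2.
      apply: (@left_limit_bound (fun z => w i z - v i) _ 0 s s0).
        by apply: cvgB; [exact: (cwp i).1|exact: cvg_cst].
      move=> x xs; have /andP[x0 xs'] := xs; apply: le_trans (wK i x xs) _.
      rewrite mulr0 subr0; apply: le_trans sK; rewrite mulrC ler_pM2r//; exact: ltW.
    split.
      have : `|w i s| <= `|w i s - v i| + `|v i|.
        by rewrite -[X in `|X| <= _](subrK (v i)) ler_normD.
      have := vA i; lra.
    rewrite normrM (gtr0_norm s0).
    have : s * `|p i s| <= s * K by rewrite ler_pM2l.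
    lra.
(* As long as the truncation is inactive, the true equation, the sphere constraint and hence the
   energy bounds hold; these return estimates strictly better than [M]. *)
have phase2 t : 0 <= t -> B M t.
  apply: (@real_induction R (B M)).
  - by move=> i; have [] := phase1 0 (lexx _) (ltW r00) i; split; rewrite /M; lra.
  - by move=> s s0 Bs; apply: filterS (Bopen _ _ Bs) => x.
  - move=> s s0 Bs; have [sr0|r0s] := leP s r0.
      by move=> i; have [] := phase1 s (ltW s0) sr0 i; split; rewrite /M; lra.
    have Bs' x : 0 < x < s -> B M x by move=> /andP[x0 xs]; apply: Bs; rewrite xs ltW.
    have sys := sys_below s Bs'.
    have [C C0 HC] := continuous_bounded_oo (ltW s0) (fun i => (cwp i).2).
    have sph : forall r : R, 0 < r < s ->
        dot (fun j => pole j + r * w j r) (fun j => pole j + r * w j r) = 1.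
      apply: (regular_system_sphere (M := M + C)) sys w_cvg0 v2 _ => i r rs.
      have /andP[rr rs'] := rs; have [H1 _] := Bs' r rs i.
      have H2 : `|p i r| <= C by apply: HC; rewrite !ltW.
      by split; lra.
    have psys := regular_system_profile sys sph.
    have id0 : t @[t --> (0 : R)^'+] --> 0 by apply: cvg_at_right_filter; exact: cvg_id.
    have xp i : pole i + t * w i t @[t --> 0^'+] --> pole i.
      have E0 : pole i + 0 * v i = pole i by rewrite mul0r addr0.
      rewrite -[X in _ --> X]E0; apply: cvgD; first exact: cvg_cst.
      exact: cvgM.
    have xv i : w i t + t * p i t @[t --> 0^'+] --> v i.
      have E0 : v i + 0 * p i 0 = v i by rewrite mul0r addr0.
      rewrite -[X in _ --> X]E0; apply: cvgD => //.
      by apply: cvgM => //; apply: cvg_at_right_filter; exact: (cwp i).2.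
    have inside r i : r0 < r < s -> `|w i r| <= 2 / r0 /\ `|r * p i r| <= Q.
      move=> /andP[rr rs].
      have rpos : 0 < r by exact: lt_trans rr.
      have rs' : 0 < r < s by rewrite rpos.
      have H1 := profile_coord_le1 psys i rs'.
      have [_ /(_ i) H2] := profile_speed alpha0 d2 psys xp xv rs'.
      have Hp : `|pole i| <= 1 :> R by rewrite /pole; case: eqP; rewrite ?normr0 ?normr1.
      have H3 : `|w i r| <= 2 / r0.
        have : `|r * w i r| <= 2.
          have -> : r * w i r = (pole i + r * w i r) - pole i by ring.
          by apply: le_trans (ler_normB _ _) _; lra.
        rewrite normrM (gtr0_norm rpos) mulrC -ler_pdivlMr// => /le_trans; apply.
        by rewrite ler_pM2l// lef_pV2 ?posrE// ltW.
      split => //.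
      have -> : r * p i r = (w i r + r * p i r) - w i r by ring.
      apply: le_trans (ler_normB _ _) _; apply: lerD => //.
      apply: le_trans H2 _; rewrite ler_wpM2l ?mulr_ge0// lef_pV2 ?posrE//; exact: ltW.
    move=> i.
    have H1 : `|w i s| <= 2 / r0.
      apply: left_limit_bound r0s _ (fun x H => (inside x i H).1); exact: (cwp i).1.
    have H2 : `|s * p i s| <= Q.
      apply: (@left_limit_bound (fun t => t * p i t) _ _ _ r0s) => [|x H]; first exact: cy.
      exact: (inside x i H).2.
    by split; rewrite /M; lra.
exists w, p; split => //.
  by move=> T; apply: sys_below => s /andP[s0 _]; apply: phase2; exact: ltW.
by move=> i r rr; have [/ltW ? /ltW ?] := phase2 r rr i.
Unshelve. all: by end_near. Qed.

End bounded_existence.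

(** * Energy and asymptotics of profiles *)

Section asymptotics.
Context {R : realType}.
Variables (alpha beta : R) (d : nat).
Implicit Types (x w p : 'I_3 -> R -> R) (v : 'I_3 -> R).

(** The two limits say that [w] tends to [v] and that [r p = x' - w] tends to [0], the initial data
    of the regular system. *)
Definition global_profile v x x' :=
  [/\ forall T, profile_system alpha beta d T x x',
      forall i, (x i t - pole i) / t @[t --> 0^'+] --> v i &
      forall i, x' i t @[t --> 0^'+] --> v i].

Section facts.
Variables (v : 'I_3 -> R) (x x' : 'I_3 -> R -> R).
Hypothesis gp : global_profile v x x'.

Let in_T (r : R) : 0 < r -> 0 < r < r + 1.
Proof. by move=> r0; rewrite r0/= ltrDl ltr01. Qed.

Lemma gp_der i (r : R) : 0 < r -> is_derive r 1 (x i) (x' i r).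
Proof. by move=> r0; case: gp => /(_ (r + 1))[+ _ _] _ _ => /(_ i r (in_T r0)). Qed.

Lemma gp_der2 i (r : R) : 0 < r ->
  is_derive r 1 (x' i) (profile_rhs alpha beta d r (x^~ r) (x'^~ r) i).
Proof. by move=> r0; case: gp => /(_ (r + 1))[_ + _] _ _ => /(_ i r (in_T r0)). Qed.

Lemma gp_sphere (r : R) : 0 < r -> dot (x^~ r) (x^~ r) = 1.
Proof. by move=> r0; case: gp => /(_ (r + 1))[_ _ +] _ _ => /(_ r (in_T r0)). Qed.

Lemma gp_tangent (r : R) : 0 < r -> dot (x^~ r) (x'^~ r) = 0.
Proof.
by move=> r0; case: gp => /(_ (r + 1)) + _ _ => /profile_system_tangent/(_ _ (in_T r0)).
Qed.

Lemma gp_le1 i (r : R) : 0 < r -> `|x i r| <= 1.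
Proof. by move=> r0; case: gp => /(_ (r + 1)) + _ _ => /profile_coord_le1/(_ r i (in_T r0)). Qed.

Lemma gp_cvg i : x i t @[t --> 0^'+] --> pole i.
Proof.
case: gp => _ /(_ i) H _.
have E0 : pole i + 0 * v i = pole i by rewrite mul0r addr0.
have id0 : t @[t --> (0 : R)^'+] --> 0 by apply: cvg_at_right_filter; exact: cvg_id.
have {}H : pole i + t * ((x i t - pole i) / t) @[t --> 0^'+] --> pole i.
  by rewrite -[X in _ --> X]E0; apply: cvgD; [exact: cvg_cst|exact: cvgM].
apply: cvg_trans H; apply: near_eq_cvg; near=> t.
have t0 : 0 < t by near: t; exact: nbhs_right_gt.
by field; rewrite gt_eqF.
Unshelve. all: by end_near. Qed.

Lemma gp_energy_derive (r : R) : 0 < r -> is_derive r 1 (profile_energy d x x')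
    (- (2 * (d%:R - 2) * r + alpha * r ^+ 3) * dot (x'^~ r) (x'^~ r)).
Proof.
by move=> r0; case: gp => /(_ (r + 1)) + _ _ => /profile_energy_derive; apply; exact: in_T.
Qed.

Hypothesis alpha0 : 0 <= alpha.
Hypothesis d2 : 2 <= d%:R :> R.

Lemma gp_energy_nonincreasing (r s : R) : 0 < r -> r <= s ->
  profile_energy d x x' s <= profile_energy d x x' r.
Proof.
move=> r0 rs; case: gp => /(_ (s + 1)) sys _ _.
by apply: profile_energy_nonincreasing sys _ _ r0 rs _ => //; rewrite ltrDl.
Qed.

Lemma gp_energy_le0 (r : R) : 0 < r -> profile_energy d x x' r <= 0.
Proof.
move=> r0; case: gp => /(_ (r + 1)) sys _ xv.
exact: (profile_energy_le0 alpha0 d2 sys gp_cvg xv (in_T r0)).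
Qed.

Lemma gp_speed i (r : R) : 0 < r -> `|x' i r| <= 4 * d%:R / r.
Proof.
move=> r0; case: gp => /(_ (r + 1)) sys _ xv.
by have [_] := profile_speed alpha0 d2 sys gp_cvg xv (in_T r0).
Qed.

(** If the energy vanished at [r], monotonicity and its initial value would make it zero on
    [(0, r]]. Its derivative there would be zero with a nonzero coefficient, since [d > 2], so [x']
    would vanish and [v] with it. *)
Lemma gp_energy_lt0 (r : R) : 2 < d%:R :> R -> (exists i, v i != 0) -> 0 < r ->
  profile_energy d x x' r < 0.
Proof.
move=> dgt2 [i vi] r0; rewrite lt_neqAle gp_energy_le0// andbT.
apply: contra vi => /eqP E0.
have Es s : 0 < s <= r -> profile_energy d x x' s = 0.
  move=> /andP[s0 sr]; apply/eqP; rewrite eq_le gp_energy_le0//=.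
  by rewrite -E0; exact: gp_energy_nonincreasing.
have x'0 s : 0 < s < r -> x' i s = 0.
  move=> /andP[s0 sr].
  have D1 := gp_energy_derive s0.
  have D2 : is_derive s 1 (profile_energy d x x') 0.
    apply: (@der_near _ (fun=> 0)).
    near=> t; rewrite Es//; apply/andP; split; [|apply: ltW]; near: t;
      [exact: lt_nbhsr|exact: lt_nbhsl].
  have := @derive_val _ _ _ _ _ _ _ D1; rewrite (@derive_val _ _ _ _ _ _ _ D2).
  move/esym/eqP; rewrite mulf_eq0 oppr_eq0 gt_eqF/=; last first.
    apply: ltr_wpDr; first by rewrite mulr_ge0// exprn_ge0// ltW.
    by rewrite !mulr_gt0// subr_gt0.
  move=> /eqP q0; apply/eqP; rewrite -sqrf_eq0 eq_le sqr_ge0 andbT -q0.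
  exact: dot_coord (x'^~ s) i.
have H : x' i t @[t --> 0^'+] --> 0.
  have : cst 0 t @[t --> (0 : R)^'+] --> (0 : R) by exact: cvg_cst.
  apply: cvg_trans; apply: near_eq_cvg; near=> t; rewrite x'0//.
  by apply/andP; split; near: t; [exact: nbhs_right_gt|exact: nbhs_right_lt].
apply/eqP; case: gp => _ _ /(_ i) xv; exact: cvg_unique xv H.
Unshelve. all: by end_near. Qed.

Lemma gp_potential_ge (r s : R) : 0 < r -> r <= s ->
  - profile_energy d x x' r <= potential d (x 2 s).
Proof.
move=> r0 rs; have s0 : 0 < s by exact: lt_le_trans rs.
have := gp_energy_nonincreasing r0 rs; rewrite {1}/profile_energy.
have : 0 <= s ^+ 2 * dot (x'^~ s) (x'^~ s) by rewrite mulr_ge0 ?dot_ge0// exprn_ge0// ltW.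
lra.
Qed.

Lemma gp_energy_ge (r : R) : 0 < r -> - (4 * d%:R) <= profile_energy d x x' r.
Proof.
move=> r0; rewrite /profile_energy lerBrDr.
have : 0 <= r ^+ 2 * dot (x'^~ r) (x'^~ r) by rewrite mulr_ge0 ?dot_ge0// exprn_ge0// ltW.
have := @potential_le R d d2 (x 2 r) (gp_le1 2 r0); lra.
Qed.

End facts.

Hypothesis alpha0 : 0 <= alpha.
Hypothesis d4 : 4 <= d%:R :> R.

Let d2 : 2 <= d%:R :> R.
Proof. by apply: le_trans d4; rewrite ler_nat. Qed.

(** The integrating factor for [f' + (c / 2) t f], used with [c = alpha]. *)
Lemma der_gauss_weight (f : R -> R) (c t a : R) : is_derive t 1 f a ->
  is_derive t 1 (fun t => f t * expR (c / 4 * t ^+ 2))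
    ((a + c / 2 * t * f t) * expR (c / 4 * t ^+ 2)).
Proof. by move=> H; dereq => //; rewrite /=; field. Qed.

(* [W = r^6 |x'|^2] satisfies [W' <= - (alpha / 2) r (W - B)]. *)
Lemma gp_speed_cubic v x x' : 0 < alpha -> global_profile v x x' ->
  forall r : R, 0 < r -> r ^+ 6 * dot (x'^~ r) (x'^~ r) <= 4 * (d%:R - 1) ^+ 2 / alpha ^+ 2.
Proof.
move=> al0 gp r r0.
set B := (X in _ <= X).
pose m : R := d%:R; have m4 : 4 <= m by [].
have B0 : 0 <= B by rewrite /B divr_ge0 ?sqr_ge0// mulr_ge0 ?sqr_ge0.
pose q (t : R) := dot (x'^~ t) (x'^~ t).
pose Z (t : R) := (t ^+ 6 * q t - B) * expR (alpha / 4 * t ^+ 2).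
pose W' (t : R) := (6 - 2 * (m - 1)) * t ^+ 5 * q t
   - 2 * (m - 2 + x 2 t) * t ^+ 4 * x' 2 t - alpha * t ^+ 7 * q t.
have dW (t : R) : 0 < t -> is_derive t 1 (fun t => t ^+ 6 * q t - B) (W' t).
  move=> t0.
  have K0 := gp_der2 gp 0 t0; have K1 := gp_der2 gp 1 t0; have K2 := gp_der2 gp 2 t0.
  rewrite /q /dot; dereq.
  set a := (X in X = _); set b := (X in _ = X).
  have -> : a = b + (- 2 * q t * t ^+ 6 + 2 * (m - 2 + x 2 t) * x 2 t * t ^+ 4)
      * dot (x^~ t) (x'^~ t).
    rewrite /a /b /W' /q /profile_rhs /cross /dot !ord3_addE !poleE -/m /=.
    by field; rewrite gt_eqF.
  by rewrite (gp_tangent gp t0) mulr0 addr0.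
have dZ (t : R) : 0 < t -> is_derive t 1 Z
    ((W' t + alpha / 2 * t * (t ^+ 6 * q t - B)) * expR (alpha / 4 * t ^+ 2)).
  by move=> t0; apply: der_gauss_weight; exact: dW.
have Z'le0 (t : R) : 0 < t -> W' t + alpha / 2 * t * (t ^+ 6 * q t - B) <= 0.
  move=> t0; rewrite /W'.
  set s := x' 2 t.
  have qs : s ^+ 2 <= q t by exact: (dot_coord (x'^~ t) 2).
  have q0 : 0 <= q t by exact: dot_ge0.
  have := gp_le1 gp 2 t0; rewrite ler_norml => /andP[c1 c2].
  have t5 : 0 <= t ^+ 5 by rewrite exprn_ge0// ltW.
  have t7 : 0 <= t ^+ 7 by rewrite exprn_ge0// ltW.
  have t4 : 0 <= t ^+ 4 by rewrite exprn_ge0// ltW.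
  (* The power [6] is absorbed exactly when [m >= 4], that is [n >= 2]. *)
  have H1 : (6 - 2 * (m - 1)) * t ^+ 5 * q t <= 0.
    by rewrite -mulrA mulr_le0_ge0 ?mulr_ge0//; lra.
  have H2 : - (2 * (m - 2 + x 2 t) * t ^+ 4 * s) <= 2 * (m - 1) * t ^+ 4 * `|s|.
    apply: le_trans (ler_norm _) _.
    have c0 : 0 <= 2 * (m - 2 + x 2 t) by lra.
    rewrite normrN normrM normrM (ger0_norm t4) (ger0_norm c0).
    by rewrite ler_wpM2r// ler_wpM2r//; lra.
  (* Completing the square spends half of the damping on the potential term. The remainder
     [2 (m - 1)^2 / alpha t] must equal [alpha / 2 t B], which fixes [B], a constant independent of
     the solution. *)
  have H3 : 2 * (m - 1) * t ^+ 4 * `|s| <= alpha / 2 * t ^+ 7 * s ^+ 2 + 2 * (m - 1) ^+ 2 / alpha * t.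
    rewrite -subr_ge0 -(real_normK (num_real s)).
    rewrite (_ : _ - _ = alpha / 2 * t * (t ^+ 3 * `|s| - 2 * (m - 1) / alpha) ^+ 2).
      by apply: mulr_ge0; [apply: mulr_ge0; lra|exact: sqr_ge0].
    by field; rewrite gt_eqF.
  have H4 : alpha / 2 * t ^+ 7 * s ^+ 2 <= alpha / 2 * t ^+ 7 * q t.
    by apply: ler_wpM2l => //; apply: mulr_ge0 => //; lra.
  have H5 : alpha / 2 * t * (t ^+ 6 * q t - B) = alpha / 2 * t ^+ 7 * q t - 2 * (m - 1) ^+ 2 / alpha * t.
    by rewrite /B -/m; field; rewrite gt_eqF.
  rewrite H5; lra.
have Zcvg : Z t @[t --> 0^'+] --> - B.
  have id0 : t @[t --> (0 : R)^'+] --> 0 by apply: cvg_at_right_filter; exact: cvg_id.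
  have E0 : (0 ^+ 6 * (v 0 * v 0 + v 1 * v 1 + v 2 * v 2) - B) * expR (alpha / 4 * 0 ^+ 2) = - B.
    by rewrite !expr0n/= mulr0 expR0 mul0r sub0r mulr1.
  have [_ _ xv] := gp.
  have cX k : t ^+ k @[t --> (0 : R)^'+] --> (0 ^+ k : R).
    by apply: (@cvg_at_right_filter _ _ (fun t : R => t ^+ k)); exact: exprn_continuous.
  rewrite -[X in _ --> X]E0 /Z /q /dot; apply: cvgM.
    apply: cvgB; last exact: cvg_cst.
    by apply: cvgM => //; repeat apply: cvgD; apply: cvgM; exact: xv.
  apply: continuous_cvg; first exact: continuous_expR.
  by apply: cvgM; [exact: cvg_cst|exact: cX].
have Zr : Z r <= - B.
  apply: (cvgr_to_ge Zcvg); near=> s.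
  have s0 : 0 < s by near: s; exact: nbhs_right_gt.
  have sr : s < r by near: s; exact: nbhs_right_lt.
  rewrite -lerN2.
  apply: (@der_ge0_le R (fun t => - Z t) (fun t =>
    - ((W' t + alpha / 2 * t * (t ^+ 6 * q t - B)) * expR (alpha / 4 * t ^+ 2)))).
    exact: ltW.
    by move=> t /andP[st _]; apply: derN; apply: dZ; exact: lt_le_trans st.
  move=> t /andP[st _]; rewrite oppr_ge0 mulr_le0_ge0 ?expR_ge0//.
  by apply: Z'le0; exact: lt_trans st.
have : Z r <= 0 by lra.
by rewrite /Z pmulr_lle0 ?expR_gt0// subr_le0.
Unshelve. all: by end_near. Qed.

Lemma gp_tail_dissipative : 0 < alpha -> exists C : R, forall v x x',
  global_profile v x x' -> exists l : 'I_3 -> R, forall i (r : R), 0 < r ->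
    `|x i r - l i| <= C / r ^+ 2.
Proof.
move=> al0; pose B := 4 * (d%:R - 1) ^+ 2 / alpha ^+ 2; exists (Num.sqrt B).
move=> v x x' gp.
have B0 : 0 <= B by rewrite /B divr_ge0 ?sqr_ge0// mulr_ge0 ?sqr_ge0.
have H i : exists l, forall r : R, 0 < r -> `|x i r - l| <= Num.sqrt B / r ^+ 2.
  apply: (@cube_tail R (x i) (x' i) _ 0) => // r r0; first exact: (gp_der gp).
  rewrite ler_pdivlMr ?exprn_gt0// -[X in _ * X]gtr0_norm ?exprn_gt0// -normrM.
  rewrite -sqrtr_sqr ler_sqrt// exprMn -exprM mulrC.
  apply: le_trans (gp_speed_cubic al0 gp r0).
  by rewrite ler_wpM2l ?(exprn_ge0 _ (ltW r0))//; exact: (dot_coord (x'^~ r) i).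
have [l Hl] := choice H; exists l => i r; exact: Hl.
Qed.

(* The equation makes [beta / 2 x + x cross x' / r] an approximate constant of motion. *)
Lemma gp_tail_schroedinger : alpha = 0 -> beta ^+ 2 = 1 -> exists C : R, forall v x x',
  global_profile v x x' -> exists l : 'I_3 -> R, forall i (r : R), 0 < r ->
    `|x i r - l i| <= C / r ^+ 2.
Proof.
move=> al0 be1; pose m : R := d%:R; have m4 : 4 <= m by [].
(* Obtained from [|x cross x'| <= 8 m / r], [|x cross e_3| <= 2] and [m - 2 + x_3 <= m + 1],
   coordinatewise. *)
pose K := 8 * m * m + 2 * (m + 1).
exists (2 * (K + 8 * m)) => v x x' gp.
have bsum (a b c e A : R) : `|a| <= 1 -> `|b| <= A -> `|c| <= 1 -> `|e| <= A ->
    `|a * b - c * e| <= 2 * A.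
  move=> H1 H2 H3 H4; apply: le_trans (ler_normB _ _) _; rewrite !normrM.
  have : `|a| * `|b| <= 1 * A by exact: ler_pM.
  have : `|c| * `|e| <= 1 * A by exact: ler_pM.
  lra.
have crossb i (r : R) : 0 < r -> `|cross (x^~ r) (x'^~ r) i| <= 2 * (4 * m / r).
  by move=> r0; apply: bsum; [exact: (gp_le1 gp)|exact: (gp_speed gp)|
    exact: (gp_le1 gp)|exact: (gp_speed gp)].
have poleb i : `|pole i| <= 1 :> R by rewrite /pole; case: eqP; rewrite ?normr0 ?normr1.
have crossp i (r : R) : 0 < r -> `|cross (x^~ r) pole i| <= 2 * 1.
  by move=> r0; apply: bsum; [exact: (gp_le1 gp)| |exact: (gp_le1 gp)|].
pose F i (t : R) := beta / 2 * x i t + cross (x^~ t) (x'^~ t) i / t.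
pose F' i (t : R) := - (m / t ^+ 2 * cross (x^~ t) (x'^~ t) i)
  - (m - 2 + x 2 t) / t ^+ 3 * cross (x^~ t) pole i.
have dF i (t : R) : 0 < t -> is_derive t 1 (F i) (F' i t).
  move=> t0; have tn0 : t != 0 by rewrite gt_eqF.
  have H0 := gp_der gp 0 t0; have H1 := gp_der gp 1 t0; have H2 := gp_der gp 2 t0.
  have K0 := gp_der2 gp 0 t0; have K1 := gp_der2 gp 1 t0; have K2 := gp_der2 gp 2 t0.
  have D : is_derive t 1 (F i) (F' i t + beta / 2 * (x i t) * dot (x^~ t) (x'^~ t)
      - beta / 2 * x' i t * (dot (x^~ t) (x^~ t) - 1)).
    elim/ord3_ind: i; rewrite /F /cross !ord3_addE; dereq => //;
    rewrite /F' /profile_rhs /cross /dot !ord3_addE !poleE -/m al0 /=; field; exact: tn0.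
  by apply: (der_eq D); rewrite (gp_tangent gp t0) (gp_sphere gp t0) subrr !mulr0 addr0 subr0.
have F'K i (t : R) : 0 < t -> `|F' i t| <= K / t ^+ 3.
  move=> t0; have tn0 : t != 0 by rewrite gt_eqF.
  have -> : K / t ^+ 3 = m / t ^+ 2 * (2 * (4 * m / t)) + (m + 1) / t ^+ 3 * (2 * 1).
    by rewrite /K; field.
  apply: le_trans (ler_normB _ _) _; rewrite normrN !normrM !normfV.
  rewrite !(gtr0_norm (exprn_gt0 _ t0)) (ger0_norm (_ : 0 <= m)); last by lra.
  have := gp_le1 gp 2 t0; rewrite ler_norml => /andP[c1 c2].
  rewrite (ger0_norm (_ : 0 <= m - 2 + x 2 t)); last by lra.
  have t20 : 0 <= t ^- 2 by rewrite invr_ge0 exprn_ge0// ltW.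
  have t30 : 0 <= t ^- 3 by rewrite invr_ge0 exprn_ge0// ltW.
  apply: lerD.
    by rewrite ler_wpM2l ?crossb// mulr_ge0//; lra.
  apply: ler_pM; rewrite ?crossp ?mulr_ge0//; first by lra.
  by rewrite ler_wpM2r//; lra.
have H i : exists l, forall r : R, 0 < r -> `|F i r - l| <= K / r ^+ 2.
  exact: (@cube_tail R (F i) (F' i) K 0 (lexx _) (dF i) (F'K i)).
have [l Hl] := choice H; exists (fun i => 2 * beta * l i) => i r r0.
have rn0 : r != 0 by rewrite gt_eqF.
have bn : `|beta| = 1 by apply/eqP; rewrite -(@pexpr_eq1 _ _ 2)// real_normK ?num_real// be1.
(* As [beta^2 = 1], multiplying [F] by [2 beta] recovers [x] up to the term
   [2 beta (x cross x') / r], which is itself of order [1 / r^2]. *)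
have -> : x i r - 2 * beta * l i =
    2 * beta * ((F i r - l i) - cross (x^~ r) (x'^~ r) i / r) + (1 - beta ^+ 2) * x i r.
  by rewrite /F; field.
rewrite be1 subrr mul0r addr0 !normrM bn mulr1 ger0_norm//.
rewrite -mulrA ler_wpM2l//; apply: le_trans (ler_normB _ _) _.
rewrite [leRHS]mulrDl; apply: lerD; first exact: Hl.
have -> : 8 * m / r ^+ 2 = 2 * (4 * m / r) / r by field.
by rewrite normrM normfV (gtr0_norm r0) ler_wpM2r ?crossb// invr_ge0 ltW.
Qed.

Lemma gp_tail : alpha ^+ 2 + beta ^+ 2 = 1 -> exists C : R, forall v x x',
  global_profile v x x' -> exists l : 'I_3 -> R, forall i (r : R), 0 < r ->
    `|x i r - l i| <= C / r ^+ 2.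
Proof.
move=> ab; have [a0|a0] := eqVneq alpha 0.
  by apply: gp_tail_schroedinger => //; rewrite -ab a0 expr0n/= add0r.
by apply: gp_tail_dissipative; rewrite lt_neqAle eq_sym a0.
Qed.

Lemma potential_continuous : continuous (@potential R d).
Proof.
have -> : @potential R d = (fun c => 1 - c * c + (d%:R - 2) * (2 - 2 * c)).
  by apply/funext => c; rewrite /potential expr2.
by move=> c; cnt.
Qed.

(** Energy and potential both converge, hence so does [r^2 |x'|^2]. A positive limit [L] would make
    the energy decrease at a rate of order [1 / r], whose integral diverges; the contradiction is
    drawn on a single interval [[s, 2 s]]. *)
Lemma gp_speed_cvg0 v x x' (l : R) : alpha = 0 -> global_profile v x x' ->
  x 2 r @[r --> +oo] --> l -> r ^+ 2 * dot (x'^~ r) (x'^~ r) @[r --> +oo] --> 0.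
Proof.
move=> al0 gp xl; pose m : R := d%:R; have m4 : 4 <= m by [].
pose E := profile_energy d x x'.
(* Cutting off at [1] gives a function monotone and bounded on the whole line. *)
pose f (r : R) := - E (Num.max 1 r).
have max1 (r : R) : 0 < Num.max 1 r by rewrite lt_max ltr01.
have ndf : nondecreasing_fun f.
  move=> r s rs; rewrite /f lerN2; apply: (gp_energy_nonincreasing gp) => //.
  by rewrite ge_max !le_max lexx/= rs orbT.
have ubf : has_ubound (range f).
  by exists (4 * d%:R) => _ [r _ <-]; rewrite /f lerNl; exact: (gp_energy_ge gp).
have fI := nondecreasing_cvgr ndf ubf; set J := sup _ in fI.
have EJ : E r @[r --> +oo] --> - J.
  have : - f r @[r --> +oo] --> - J by exact: cvgN.
  apply: cvg_trans; apply: near_eq_cvg; near=> r.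
  rewrite /f opprK max_r//; near: r; exact: nbhs_pinfty_ge.
pose q (r : R) := r ^+ 2 * dot (x'^~ r) (x'^~ r).
have qL : q r @[r --> +oo] --> - J + potential d l.
  have -> : q = (fun r => E r + potential d (x 2 r)).
    by apply/funext => r; rewrite /E /profile_energy subrK.
  apply: cvgD => //; apply: continuous_cvg => //; exact: potential_continuous.
set L := _ + _ in qL.
have L0 : 0 <= L.
  apply: (cvgr_to_ge qL); near=> r.
  have r0 : 0 <= r by near: r; exact: nbhs_pinfty_ge.
  by rewrite /q mulr_ge0 ?dot_ge0// exprn_ge0.
suff -> : 0 = L by [].
apply/eqP; rewrite eq_le L0/= leNgt; apply/negP => Lpos.
have L20 : 0 < L / 2 by lra.
have e0 : 0 < L / 4 by lra.
have /cvgrPdist_lt/(_ _ L20) [A [_ HA]] := qL.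
have /cvgrPdist_lt/(_ _ e0) [A' [_ HA']] := EJ.
pose s := Num.max 1 (Num.max (A + 1) (A' + 1)).
have s1 : 1 <= s by rewrite /s le_max lexx.
have sA : A < s by rewrite /s !lt_max ltrDl ltr01 orbT.
have sA' : A' < s by rewrite /s !lt_max ltrDl ltr01 !orbT.
have s0 : 0 < s by lra.
have H1 := HA' s sA'; have H2 : `|- J - E (2 * s)| < L / 4 by apply: HA'; lra.
(* For [m >= 4] and [r^2 |x'|^2 >= L / 2] the energy falls at rate at least [L / (2 s)], so it drops
   by [L / 2] over a length [s]; yet both end values lie within [L / 4] of its limit. *)
have : E (2 * s) <= E s - L / 2.
  suff : - E s + (L / (2 * s)) * s <= - E (2 * s) + (L / (2 * s)) * 0.
    have -> : L / (2 * s) * s = L / 2 by field; rewrite gt_eqF.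
    by lra.
  pose c := L / (2 * s).
  pose g (t : R) := - E t + c * (2 * s - t).
  have -> : - E s + c * s = g s by rewrite /g; ring.
  have -> : - E (2 * s) + c * 0 = g (2 * s) by rewrite /g; ring.
  apply: (@der_ge0_le R g (fun t => 2 * (d%:R - 2) * t * dot (x'^~ t) (x'^~ t) - c)); first by lra.
    move=> t /andP[st _]; have t0 : 0 < t by lra.
    have DE := gp_energy_derive gp t0; rewrite /g /E; dereq.
    by rewrite al0; ring.
  move=> t /andP[st ts]; have t0 : 0 < t by lra.
  have := HA t (lt_trans sA st); rewrite /= ltr_norml /q => /andP[_ Q].
  have Q' : L / 2 <= t ^+ 2 * dot (x'^~ t) (x'^~ t) by lra.
  rewrite subr_ge0 -(ler_pM2l t0).
  apply: (@le_trans _ _ L).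
    rewrite /c mulrCA ler_piMr ?(ltW Lpos)// ler_pdivrMr ?mul1r; lra.
  have -> : t * (2 * (d%:R - 2) * t * dot (x'^~ t) (x'^~ t)) =
     2 * (m - 2) * (t ^+ 2 * dot (x'^~ t) (x'^~ t)) by rewrite /m; ring.
  have := ler_wpM2l (_ : 0 <= 2 * (m - 2)) Q'.
  have : 0 <= (m - 4) * L by rewrite mulr_ge0 ?subr_ge0// ltW.
  by move=> h1 h2; apply: le_trans (h2 _); lra.
move: H1 H2; rewrite /= !ltr_norml => /andP[? ?] /andP[? ?]; lra.
Unshelve. all: by end_near. Qed.

End asymptotics.

(** * Uniqueness and continuous dependence *)

Section well_posedness.
Context {R : realType}.
Variables (alpha beta : R) (d : nat).
Implicit Types (x w p z : 'I_3 -> R -> R) (v : 'I_3 -> R).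

Lemma global_profile_of_regular v w p : v 2 = 0 ->
  (forall i, continuous (w i) /\ continuous (p i)) -> (forall i, w i 0 = v i) ->
  (forall T, regular_system alpha beta d T w p) ->
  global_profile alpha beta d v (fun i r => pole i + r * w i r) (fun i r => w i r + r * p i r).
Proof.
move=> v2 cwp w0 sys.
have w_cvg0 i : w i t @[t --> 0^'+] --> v i.
  by rewrite -w0; apply: cvg_at_right_filter; exact: (cwp i).1.
split => [T|i|i].
- apply: regular_system_profile => //.
  have [T0|T0] := ltP 0 T; last by move=> r /andP[r0 rT]; lra.
  have [C C0 HC] := continuous_bounded_oo (ltW T0) (fun i => (cwp i).1).
  have [D D0 HD] := continuous_bounded_oo (ltW T0) (fun i => (cwp i).2).
  apply: (regular_system_sphere (M := C + D)) (sys T) w_cvg0 v2 _ => i r /andP[/ltW r0 /ltW rT].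
  have H1 : `|w i r| <= C by apply: HC; rewrite r0.
  have H2 : `|p i r| <= D by apply: HD; rewrite r0.
  by split; lra.
- apply: cvg_trans (w_cvg0 i); apply: near_eq_cvg; near=> t.
  have t0 : 0 < t by near: t; exact: nbhs_right_gt.
  by field; rewrite gt_eqF.
- have E0 : v i + 0 * p i 0 = v i by rewrite mul0r addr0.
  rewrite -[X in _ --> X]E0; apply: cvgD => //.
  apply: cvgM; apply: cvg_at_right_filter; [exact: cvg_id|exact: (cwp i).2].
Unshelve. all: by end_near. Qed.

Lemma regular_of_global_profile v x x' : global_profile alpha beta d v x x' ->
  let w i r := (x i r - pole i) / r in
  forall T, regular_system alpha beta d T w (fun i r => (x' i r - w i r) / r).
Proof.
move=> gp w T; pose p i r := (x' i r - w i r) / r; rewrite -/p.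
have dw i (r : R) : 0 < r -> is_derive r 1 (w i) (p i r).
  move=> r0; have rn0 : r != 0 by rewrite gt_eqF.
  have H := gp_der gp i r0; rewrite /w; dereq => //.
  by rewrite /p /w /=; field.
split=> i r /andP[r0 _]; first exact: dw.
have rn0 : r != 0 by rewrite gt_eqF.
have H := dw i r r0; have H' := gp_der2 gp i r0.
have E : regular_rhs alpha beta d r (w^~ r) (fun j => r * p j r) i =
    profile_rhs alpha beta d r (x^~ r) (x'^~ r) i + (d%:R - 1) / r * (x' i r - w i r).
  have := profile_rhs_regular alpha beta d (w^~ r) (fun j => r * p j r) i rn0; cbv zeta.
  have -> : (fun j => pole j + r * w j r) = x^~ r.
    by apply/funext => j; rewrite /w; field.
  have -> : (fun j => w j r + r * p j r) = x'^~ r.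
    by apply/funext => j; rewrite /p; field.
  rewrite (gp_sphere gp r0) subrr mulr0 !mul0r addr0 => ->.
  by rewrite [p i r]/p; field.
pose f (t : R) := w i t.
have D : is_derive r 1 (fun t => t ^+ d.+1 * ((x' i t - f t) / t))
    (r ^+ d * regular_rhs alpha beta d r (w^~ r) (fun j => r * p j r) i).
  rewrite -/(f) in H; rewrite E; move: (profile_rhs _ _ _ _ _ _ _) H' => rhs H'.
  have Hf : is_derive r 1 f (p i r) := H.
  dereq => //; rewrite /= /p -/(f r) exprS -natr1.
  by move: (r ^+ d) (d%:R) (f r) => rd m fr; field.
exact: D.
Qed.

(** The limits at [0] give the bound near [0], the energy gives it elsewhere. An arbitrary solution
    needs such a bound before it can be compared with another, the nonlinearity being only locally
    Lipschitz. *)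
Lemma global_profile_bounded v x x' : 0 <= alpha -> 2 <= d%:R :> R ->
  global_profile alpha beta d v x x' ->
  exists2 M : R, 0 <= M & forall i (r : R), 0 < r ->
    `|(x i r - pole i) / r| <= M /\ `|x' i r - (x i r - pole i) / r| <= M.
Proof.
move=> alpha0 d2 gp; have [_ xv x'v] := gp.
have near_bound (f : R -> R) (l : R) : f t @[t --> 0^'+] --> l ->
    exists del : R, 0 < del /\ forall r : R, 0 < r < del -> `|f r| <= `|l| + 1.
  move=> /cvgrPdist_le/(_ 1 ltr01); rewrite near_withinE => /nbhs_ballP[e /= e0 He].
  exists e; split=> // r /andP[r0 re].
  have : `|l - f r| <= 1 by apply: He => //=; rewrite /ball/= sub0r normrN gtr0_norm.
  have : `|f r| <= `|l| + `|l - f r|.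
    by rewrite -[X in `|X| <= _](subKr l) ler_normB.
  lra.
have H i : exists M, 0 <= M /\ forall r : R, 0 < r ->
    `|(x i r - pole i) / r| <= M /\ `|x' i r - (x i r - pole i) / r| <= M.
  have [e1 [e10 H1]] := near_bound _ _ (xv i).
  have [e2 [e20 H2]] := near_bound _ _ (x'v i).
  pose e := Num.min e1 e2.
  have e0 : 0 < e by rewrite /e lt_min e10.
  have m0 : 0 <= d%:R :> R by rewrite ler0n.
  have Q0 : 0 <= 2 / e by rewrite divr_ge0// ltW.
  have S0 : 0 <= 4 * d%:R / e by rewrite divr_ge0 ?mulr_ge0// ltW.
  have vi0 := normr_ge0 (v i).
  exists (2 * (`|v i| + 1) + 2 / e + 4 * d%:R / e); split; first lra.
  move=> r r0.
  suff [h1 h2] : `|(x i r - pole i) / r| <= `|v i| + 1 + 2 / e /\ `|x' i r| <= `|v i| + 1 + 4 * d%:R / e.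
    split; first lra.
    by apply: le_trans (ler_normB _ _) _; lra.
  have [re|re] := ltP r e.
    have h1 : `|(x i r - pole i) / r| <= `|v i| + 1.
      by apply: H1; rewrite r0 (lt_le_trans re)// /e ge_min lexx.
    have h2 : `|x' i r| <= `|v i| + 1.
      by apply: H2; rewrite r0 (lt_le_trans re)// /e ge_min lexx orbT.
    by split; lra.
  have ir : r^-1 <= e^-1 by rewrite lef_pV2 ?posrE.
  have h1 : `|(x i r - pole i) / r| <= 2 / e.
    rewrite normrM normfV (gtr0_norm r0); apply: ler_pM => //; first by rewrite invr_ge0 ltW.
    have Hp : `|pole i| <= 1 :> R by rewrite /pole; case: eqP; rewrite ?normr0 ?normr1.
    by apply: le_trans (ler_normB _ _) _; have := gp_le1 gp i r0; lra.
  have h2 : `|x' i r| <= 4 * d%:R / e.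
    by apply: le_trans (gp_speed gp alpha0 d2 i r0) _; rewrite ler_wpM2l// mulr_ge0.
  by split; lra.
have /choice[b Hb] := H.
exists (\sum_i b i); first by apply: sumr_ge0 => i _; exact: (Hb i).1.
move=> i r r0; have [b0 /(_ r r0)[h1 h2]] := Hb i.
have bi : b i <= \sum_i b i.
  by rewrite (bigD1 i)//= lerDl; apply: sumr_ge0 => j _; exact: (Hb j).1.
by split; [exact: le_trans h1 bi|exact: le_trans h2 bi].
Qed.

(** On the set where everything is bounded by [M] the nonlinearity has a Lipschitz constant [L], and
    Gronwall applies to the difference. The averaging operator first bounds [p] by [K], which starts
    the Gronwall iteration; [C] depends on [T] and [L] only. *)
Lemma regular_system_dependence (T M : R) : 0 < T -> exists2 C : R, 0 <= C &
  forall (a : R) v1 v2 w1 p1 w2 p2,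
  (forall i, `|v1 i - v2 i| <= a) ->
  regular_system alpha beta d T w1 p1 -> regular_system alpha beta d T w2 p2 ->
  (forall i, w1 i t @[t --> 0^'+] --> v1 i) -> (forall i, w2 i t @[t --> 0^'+] --> v2 i) ->
  (forall i, t * p1 i t @[t --> 0^'+] --> 0) -> (forall i, t * p2 i t @[t --> 0^'+] --> 0) ->
  (forall i (r : R), 0 < r < T -> `|w1 i r| <= M /\ `|r * p1 i r| <= M) ->
  (forall i (r : R), 0 < r < T -> `|w2 i r| <= M /\ `|r * p2 i r| <= M) ->
  forall i (r : R), 0 < r < T -> `|w1 i r - w2 i r| <= C * a.
Proof.
move=> T0; have [K [L [K0 L0 HKL]]] := regular_rhs_bounds alpha beta d T M.
exists (1 + expR (2 * L * T)); first by rewrite addr_ge0 ?expR_ge0.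
move=> a v1 v2 w1 p1 w2 p2 va [dw1 dp1] [dw2 dp2] wv1 wv2 p10 p20 M1 M2 i r rT.
have a0 : 0 <= a := le_trans (normr_ge0 _) (va 0).
have pK v w p : (forall i, w i t @[t --> 0^'+] --> v i) ->
    (forall i, t * p i t @[t --> 0^'+] --> 0) -> regular_system alpha beta d T w p ->
    (forall i (r : R), 0 < r < T -> `|w i r| <= M /\ `|r * p i r| <= M) ->
    forall i (r : R), 0 < r < T -> `|p i r| <= K.
  move=> wv p0 [dw dp] wM j; apply: (singular_bound (ltW K0) (dp j)) => [s sT|].
    have [k|k|k|] := HKL s (w^~ s) (fun j => s * p j s) (w^~ s) (fun j => s * p j s) 0 0 sT _ _ _ j => //.
    - by have [? ?] := wM k s sT.
    - by rewrite subrr normr0.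
    - by rewrite subrr normr0.
  have E0 : 0 ^+ d * 0 = 0 :> R by rewrite mulr0.
  have cX : t ^+ d @[t --> (0 : R)^'+] --> (0 ^+ d : R).
    by apply: (@cvg_at_right_filter _ _ (fun t : R => t ^+ d)); exact: exprn_continuous.
  rewrite -[X in _ --> X]E0; under eq_fun do rewrite exprSr -mulrA.
  exact: cvgM.
have pB i1 (r1 : R) : 0 < r1 < T -> `|p1 i1 r1 - p2 i1 r1| <= 2 * K.
  move=> rT1; apply: le_trans (ler_normB _ _) _.
  have := pK v1 w1 p1 wv1 p10 (conj dw1 dp1) M1 i1 r1 rT1.
  have := pK v2 w2 p2 wv2 p20 (conj dw2 dp2) M2 i1 r1 rT1.
  lra.
have dwB i1 (r1 : R) : 0 < r1 < T ->
    is_derive r1 1 (fun t => w1 i1 t - w2 i1 t) (p1 i1 r1 - p2 i1 r1).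
  by move=> rT1; exact: derD (dw1 i1 r1 rT1) (derN (dw2 i1 r1 rT1)).
pose n w p i (r : R) := regular_rhs alpha beta d r (w^~ r) (fun j => r * p j r) i.
have dpB i1 (r1 : R) : 0 < r1 < T ->
    is_derive r1 1 (fun t => t ^+ d.+1 * (p1 i1 t - p2 i1 t))
      (r1 ^+ d * (n w1 p1 i1 r1 - n w2 p2 i1 r1)).
  move=> rT1; rewrite mulrBr.
  have := derD (dp1 i1 r1 rT1) (derN (dp2 i1 r1 rT1)).
  by under [X in is_derive _ _ X _ -> _]eq_fun do rewrite -mulrBr.
have wc i1 : w1 i1 t - w2 i1 t @[t --> 0^'+] --> v1 i1 - v2 i1 by apply: cvgB.
have nL (r1 B C : R) : 0 < r1 < T -> (forall i, `|w1 i r1 - w2 i r1| <= B) ->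
    (forall i, `|p1 i r1 - p2 i r1| <= C) ->
    forall i, `|n w1 p1 i r1 - n w2 p2 i r1| <= L * (B + r1 * C).
  move=> rT1 wB pC i1; have /andP[r10 _] := rT1.
  have [j|//|j|_] := HKL r1 (w1^~ r1) (fun j => r1 * p1 j r1) (w2^~ r1)
    (fun j => r1 * p2 j r1) B (r1 * C) rT1 _ _ _ i1 => //.
    by have [? ?] := M1 j r1 rT1; have [? ?] := M2 j r1 rT1.
  by rewrite -mulrBr normrM (gtr0_norm r10) ler_wpM2l// ltW.
have [H _] := @singular_gronwall R 'I_3 d T L a (2 * K) (fun i r => w1 i r - w2 i r)
  (fun i r => p1 i r - p2 i r) (fun i r => n w1 p1 i r - n w2 p2 i r)
  (fun i => v1 i - v2 i) L0 a0 dwB va wc pB dpB nL i r rT.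
apply: le_trans H _; rewrite mulrC ler_wpM2r// lerD2l ler_expR ler_wpM2l//.
  by rewrite mulr_ge0// ltW.
by case/andP: rT => _ /ltW.
Qed.

Hypothesis alpha0 : 0 <= alpha.
Hypothesis d2 : 2 <= d%:R :> R.

Lemma global_profile_dependence (T M : R) : 0 < T -> exists2 C : R, 0 <= C &
  forall (a : R) v1 v2 x x' z z',
  global_profile alpha beta d v1 x x' -> global_profile alpha beta d v2 z z' ->
  (forall i, `|v1 i - v2 i| <= a) ->
  (forall i (r : R), 0 < r < T ->
    `|(x i r - pole i) / r| <= M /\ `|x' i r - (x i r - pole i) / r| <= M) ->
  (forall i (r : R), 0 < r < T ->
    `|(z i r - pole i) / r| <= M /\ `|z' i r - (z i r - pole i) / r| <= M) ->
  forall i (r : R), 0 < r < T -> `|x i r - z i r| <= C * a.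
Proof.
move=> T0; have [C C0 HC] := regular_system_dependence M T0.
exists (T * C); first by rewrite mulr_ge0// ltW.
move=> a v1 v2 x x' z z' gp1 gp2 va M1 M2 i r rT; have /andP[r0 /ltW rT'] := rT.
have p_cvg v y y' : global_profile alpha beta d v y y' -> forall i,
    t * ((y' i t - (y i t - pole i) / t) / t) @[t --> 0^'+] --> 0.
  move=> [_ yv y'v] j.
  have H : y' j t - (y j t - pole j) / t @[t --> 0^'+] --> 0.
    by rewrite -[X in _ --> X](subrr (v j)); apply: cvgB.
  apply: cvg_trans H; apply: near_eq_cvg; near=> t.
  have t0 : 0 < t by near: t; exact: nbhs_right_gt.
  by rewrite [RHS]mulrC divfK// gt_eqF.
have bnd y y' : (forall i (r : R), 0 < r < T ->
    `|(y i r - pole i) / r| <= M /\ `|y' i r - (y i r - pole i) / r| <= M) ->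
    forall i (r : R), 0 < r < T ->
    `|(y i r - pole i) / r| <= M /\ `|r * ((y' i r - (y i r - pole i) / r) / r)| <= M.
  move=> H j s sT; have [h1 h2] := H j s sT; have /andP[s0 _] := sT.
  by split=> //; rewrite mulrC divfK// gt_eqF.
have [_ wv1 _] := gp1; have [_ wv2 _] := gp2.
have := HC a v1 v2 _ _ _ _ va (regular_of_global_profile gp1 T)
  (regular_of_global_profile gp2 T) wv1 wv2 (p_cvg _ _ _ gp1) (p_cvg _ _ _ gp2)
  (bnd _ _ M1) (bnd _ _ M2) i r rT.
rewrite -mulrBl (_ : x i r - pole i - _ = x i r - z i r); last by ring.
rewrite normrM normfV (gtr0_norm r0).
rewrite ler_pdivrMr// => /le_trans; apply.
by rewrite mulrC -mulrA ler_wpM2r// mulr_ge0// (le_trans _ (va 0)).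
Unshelve. all: by end_near. Qed.

Lemma global_profile_unique v x x' z z' :
  global_profile alpha beta d v x x' -> global_profile alpha beta d v z z' ->
  forall i (r : R), 0 < r -> x i r = z i r.
Proof.
move=> gp1 gp2 i r r0.
have [M1 M10 H1] := global_profile_bounded alpha0 d2 gp1.
have [M2 M20 H2] := global_profile_bounded alpha0 d2 gp2.
have T0 : 0 < r + 1 by lra.
have [C C0 HC] := global_profile_dependence (M1 + M2) T0.
apply/eqP; rewrite -subr_eq0 -normr_le0 -[leRHS](mulr0 C).
apply: (HC _ _ _ _ _ _ _ gp1 gp2); last by rewrite r0/= ltrDl ltr01.
- by move=> j; rewrite subrr normr0.
- by move=> j s /andP[s0 _]; have [h1 h2] := H1 j s s0; split; lra.
- by move=> j s /andP[s0 _]; have [h1 h2] := H2 j s s0; split; lra.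
Qed.

Lemma global_profile_exists (A : R) : 0 <= A -> exists2 M : R, 0 <= M &
  forall v, v 2 = 0 -> (forall i, `|v i| <= A) -> exists x x',
  [/\ global_profile alpha beta d v x x',
      forall i, x i 0 = pole i &
      forall i (r : R), 0 < r ->
       `|(x i r - pole i) / r| <= M /\ `|x' i r - (x i r - pole i) / r| <= M].
Proof.
move=> A0; have [M M0 HM] := bounded_profiles beta alpha0 d2 A0.
exists M => // v v2 vA; have [w [p [cwp w0 sys wM]]] := HM v v2 vA.
exists (fun i r => pole i + r * w i r), (fun i r => w i r + r * p i r); split.
- exact: global_profile_of_regular.
- by move=> i; rewrite mul0r addr0.
- move=> i r r0; have rn0 : r != 0 by rewrite gt_eqF.
  have -> : (pole i + r * w i r - pole i) / r = w i r by field.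
  by rewrite [w i r + _]addrC addrK; exact: wM (ltW r0).
Qed.

(* Uniqueness transfers the uniform bound of [global_profile_exists] to every solution. *)
Lemma global_profile_continuous (A T : R) : 0 <= A -> 0 < T -> exists2 C : R, 0 <= C &
  forall (a : R) v1 v2 x x' z z', v1 2 = 0 -> v2 2 = 0 ->
  (forall i, `|v1 i| <= A) -> (forall i, `|v2 i| <= A) -> (forall i, `|v1 i - v2 i| <= a) ->
  global_profile alpha beta d v1 x x' -> global_profile alpha beta d v2 z z' ->
  forall i (r : R), 0 < r < T -> `|x i r - z i r| <= C * a.
Proof.
move=> A0 T0; have [M M0 HM] := global_profile_exists A0.
have [C C0 HC] := global_profile_dependence M T0.
exists C => // a v1 v2 x x' z z' v12 v22 v1A v2A va gp1 gp2 i r rT.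
have [y1 [y1' [gq1 _ b1]]] := HM v1 v12 v1A.
have [y2 [y2' [gq2 _ b2]]] := HM v2 v22 v2A.
have /andP[r0 _] := rT.
rewrite (global_profile_unique gp1 gq1 i r0) (global_profile_unique gp2 gq2 i r0).
apply: (HC _ _ _ _ _ _ _ gq1 gq2 va) => //.
- by move=> j s /andP[s0 _]; exact: b1.
- by move=> j s /andP[s0 _]; exact: b2.
Qed.

End well_posedness.

(** * Smoothness and vector-valued solutions *)

Section smooth_functions.
Context {R : realType}.
Implicit Types f g : R -> R.

(* [k] times differentiable with continuous last derivative on [r > 0]; unlike
   [Ck_pos] it quantifies the derivatives existentially, hence is easily closed
   under algebraic operations. *)
Fixpoint smooth_upto (k : nat) f : Prop :=
  if k is k'.+1 then exists g, (forall r : R, 0 < r -> is_derive r 1 f (g r)) /\ smooth_upto k' g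
  else forall r : R, 0 < r -> continuous_at r f.

Lemma pos_near (r : R) (P : R -> Prop) : 0 < r -> (forall t, 0 < t -> P t) ->
  \forall t \near r, P t.
Proof. by move=> r0 HP; near=> t; apply: HP; near: t; exact: lt_nbhsr. Unshelve. all: by end_near. Qed.

Lemma smooth_upto_ext k f g : (forall r : R, 0 < r -> f r = g r) ->
  smooth_upto k f -> smooth_upto k g.
Proof.
case: k => [|k] fg /=.
  by move=> cf r r0; apply: (@continuous_near _ f); [exact: pos_near|exact: cf].
move=> [h [fh sh]]; exists h; split=> // r r0.
by apply: (@der_near _ f); [exact: pos_near|exact: fh].
Qed.

Lemma smooth_uptoW k f : smooth_upto k.+1 f -> smooth_upto k f.
Proof.
elim: k f => [|k IH] f /= [g [fg sg]].
  by move=> r r0; exact: der_continuous (fg r r0).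
by exists g; split=> //; exact: IH.
Qed.

Lemma smooth_upto_cst k (c : R) : smooth_upto k (fun=> c).
Proof.
elim: k c => [|k IH] c /=; first by move=> r _; exact: cvg_cst.
by exists (fun=> 0); split => // r _; exact: der_cst.
Qed.

Lemma smooth_upto_id k : smooth_upto k (fun t : R => t).
Proof.
case: k => [|k] /=; first by move=> r _; exact: cvg_id.
by exists (fun=> 1); split => [r _|]; [exact: der_id|exact: smooth_upto_cst].
Qed.

Lemma smooth_uptoD k f g : smooth_upto k f -> smooth_upto k g ->
  smooth_upto k (fun t => f t + g t).
Proof.
elim: k f g => [|k IH] f g /=; first by move=> cf cg r r0; apply: cntD; [exact: cf|exact: cg].
move=> [f' [df sf]] [g' [dg sg]]; exists (fun t => f' t + g' t); split; last exact: IH.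
by move=> r r0; apply: derD; [exact: df|exact: dg].
Qed.

Lemma smooth_uptoN k f : smooth_upto k f -> smooth_upto k (fun t => - f t).
Proof.
elim: k f => [|k IH] f /=; first by move=> cf r r0; apply: cntN; exact: cf.
move=> [f' [df sf]]; exists (fun t => - f' t); split; last exact: IH.
by move=> r r0; apply: derN; exact: df.
Qed.

Lemma smooth_uptoM k f g : smooth_upto k f -> smooth_upto k g ->
  smooth_upto k (fun t => f t * g t).
Proof.
elim: k f g => [|k IH] f g; first by move=> /= cf cg r r0; apply: cntM; [exact: cf|exact: cg].
move=> sf sg; have [sf1 sg1] := (smooth_uptoW sf, smooth_uptoW sg).
case: sf sg => f' [df sf'] [g' [dg sg']].
exists (fun t => f t * g' t + g t * f' t); split.
  by move=> r r0; apply: derM; [exact: df|exact: dg].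
by apply: smooth_uptoD; exact: IH.
Qed.

Lemma smooth_upto_inv k : smooth_upto k (fun t : R => t^-1).
Proof.
elim: k => [|k IH] /=.
  by move=> r r0; apply: (@der_continuous _ _ _ (- r ^- 2 * 1)); der; rewrite gt_eqF.
exists (fun t => - (t^-1 * t^-1)); split; last first.
  by apply: smooth_uptoN; exact: smooth_uptoM.
by move=> r r0; dereq; rewrite ?gt_eqF// mulr1 expr2 invfM.
Qed.

End smooth_functions.

Section vector_functions.
Context {R : realType}.

Lemma cvg_row (T : Type) (F : set_system T) (FF : Filter F) (f : T -> 'rV[R]_3) (l : 'rV[R]_3) :
  (forall i, f t 0 i @[t --> F] --> l 0 i) -> f t @[t --> F] --> l.
Proof.
move=> H; apply/cvgrPdist_le => e e0.
have /cvgrPdist_le/(_ e e0) H0 := H 0.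
have /cvgrPdist_le/(_ e e0) H1 := H 1.
have /cvgrPdist_le/(_ e e0) H2 := H 2.
near=> t; rewrite /Num.Def.normr/= mx_normrE (bigmax_le _ (ltW e0))//= => -[j i] _.
rewrite !mxE/= ord1; elim/ord3_ind: i; near: t => //.
Unshelve. all: by end_near. Qed.

Lemma cvg_coord (T : Type) (F : set_system T) (FF : Filter F) (f : T -> 'rV[R]_3) (l : 'rV[R]_3) i :
  f t @[t --> F] --> l -> f t 0 i @[t --> F] --> l 0 i.
Proof.
by move=> fl; apply: (cvg_comp f (fun M : 'rV[R]_3 => M 0 i) fl); exact: coord_continuous.
Qed.

Lemma derivable_coord (f : R -> 'rV[R]_3) (r : R) i : derivable f r 1 ->
  is_derive r 1 (fun t => f t 0 i) (f^`() r 0 i).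
Proof.
move=> df; have /derivable_mxP/(_ 0 i) H := df.
by split => //; rewrite derive1E derive_mx// mxE.
Qed.

Lemma derivable_of_coord (f : R -> 'rV[R]_3) (r : R) (g : 'I_3 -> R) :
  (forall i, is_derive r 1 (fun t => f t 0 i) (g i)) ->
  derivable f r 1 /\ forall i, f^`() r 0 i = g i.
Proof.
move=> H; have df : derivable f r 1.
  by apply/derivable_mxP => j i; rewrite ord1; case: (H i).
split=> // i; rewrite derive1E derive_mx// mxE; have := H i => Hi.
exact: derive_val.
Qed.

Lemma Ck_pos_of_smooth (k : nat) (f : R -> 'rV[R]_3) :
  (forall i, smooth_upto k (fun r => f r 0 i)) -> Ck_pos k f.
Proof.
elim: k f => [|k IH] f sf.
  split => // r r0; rewrite derive1n0.
  by apply: cvg_row => i; exact: sf.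
have /choice[g Hg] := sf.
have df (r : R) : 0 < r -> derivable f r 1 /\ forall i, f^`() r 0 i = g i r.
  by move=> r0; apply: derivable_of_coord => i; exact: (Hg i).1.
have [C1 C2] : Ck_pos k f^`().
  apply: IH => i; apply: smooth_upto_ext (Hg i).2 => r r0.
  by rewrite (df r r0).2.
split=> [[|j] r jk r0|r r0].
- by rewrite derive1n0; exact: (df r r0).1.
- by rewrite derive1Sn; exact: C1.
- by rewrite derive1Sn; exact: C2.
Qed.

End vector_functions.

(** * Passage between coordinate profiles and vector-valued solutions *)

Section translation.
Context {R : realType}.
Variables (alpha beta : R) (n : nat).
Let d := (2 * n)%N.
Implicit Types (psi : R -> 'rV[R]_3) (v : 'rV[R]_3).

Lemma dotpE (u v : 'rV[R]_3) : dotp u v = dot (u 0) (v 0).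
Proof.
rewrite /dotp /dot !big_ord_recr/= big_ord0 add0r.
by congr (_ * _ + _ * _ + _ * _); congr (_ 0 _); exact: val_inj.
Qed.

Lemma crosspE (u v : 'rV[R]_3) i : crossp u v 0 i = cross (u 0) (v 0) i.
Proof. by rewrite mxE. Qed.

Lemma e3E i : (@e3 R) 0 i = pole i.
Proof. by rewrite /e3 mxE eqxx. Qed.

Lemma enormE (u : 'rV[R]_3) : enorm u ^+ 2 = dot (u 0) (u 0).
Proof. by rewrite /enorm dotpE sqr_sqrtr// dot_ge0. Qed.

Lemma sphere2E (u : 'rV[R]_3) : sphere2 u <-> dot (u 0) (u 0) = 1.
Proof.
rewrite /sphere2/= -enormE; split => [->|H]; first by rewrite expr1n.
by apply/eqP; rewrite -(@pexpr_eq1 _ _ 2) ?sqrtr_ge0// H.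
Qed.

Lemma tangent_sphere2E v : tangent_sphere2 e3 v <-> v 0 2 = 0.
Proof. by rewrite /tangent_sphere2/= dotpE /dot !e3E !poleE !mulr0 !add0r mulr1. Qed.

Lemma crossK (x b : 'I_3 -> R) i : cross x (cross x b) i = x i * dot x b - b i * dot x x.
Proof. by elim/ord3_ind: i; rewrite /cross /dot !ord3_addE; ring. Qed.

Lemma natd : (d%:R : R) = 2 * n%:R.
Proof. by rewrite /d natrM. Qed.

(** Mean value argument applied to [f - l t]. It identifies the limit of [psi'] at [0] with the
    prescribed right derivative [v]. *)
Lemma slope_cvg_at_right (f f' : R -> R) (l a : R) :
  (forall r : R, 0 < r -> is_derive r 1 f (f' r)) -> f t @[t --> 0^'+] --> a ->
  f' t @[t --> 0^'+] --> l -> (f t - a) / t @[t --> 0^'+] --> l.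
Proof.
move=> df fa f'l; apply/cvgrPdist_le => e e0.
have /cvgrPdist_le/(_ e e0) := f'l; rewrite near_withinE => /nbhs_ballP[del /= del0 Hdel].
near=> t.
have t0 : 0 < t by near: t; exact: nbhs_right_gt.
have td : t < del by near: t; exact: nbhs_right_lt.
have H : `|(f t - l * t) - (a - l * 0)| <= e * t - e * 0.
  apply: (@der_comparison0 R (fun s => f s - l * s) (fun s => e * s) (fun s => f' s - l)
    (fun=> e) _ _ del).
  - by move=> s /andP[s0 _]; have ds := df s s0; dereq; ring.
  - by move=> s _; dereq; ring.
  - apply: cvgB => //; apply: (@der_cvg_at_right R (fun s => l * s)); der.
  - by apply: (@der_cvg_at_right R (fun s => e * s)); der.
  - move=> s /andP[s0 sd]; rewrite distrC; apply: Hdel => //=.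
    by rewrite /ball/= sub0r normrN gtr0_norm.
  - by rewrite t0.
have -> : l - (f t - a) / t = - ((f t - l * t) - (a - l * 0)) / t.
  by field; rewrite gt_eqF.
by rewrite normrM normrN normfV (gtr0_norm t0) ler_pdivrMr//; move: H; rewrite mulr0 !subr0 mulr0 subr0.
Unshelve. all: by end_near. Qed.

(** Crossing the equation with [psi] recovers its component tangent to the sphere, by
    [x cross (x cross B) = (x . B) x - B]. The missing component of [psi''] along [psi] comes from
    differentiating [|psi|^2 = 1] twice. *)
Lemma global_solution_profile v psi : global_solution alpha beta n v psi ->
  global_profile alpha beta d (v 0) (fun i r => psi r 0 i) (fun i r => psi^`() r 0 i).
Proof.
move=> [sph [[[C1 C1c] [l psi_l psi'_l]] [C2 _]] eqn [psi0 psi_v]].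
pose x i (r : R) := psi r 0 i; pose x' i (r : R) := psi^`() r 0 i.
pose x2 i (r : R) := psi^`(2) r 0 i.
have dx i (r : R) : 0 < r -> is_derive r 1 (x i) (x' i r).
  by move=> r0; apply: derivable_coord; have := C1 0%N r isT r0; rewrite derive1n0.
have dx' i (r : R) : 0 < r -> is_derive r 1 (x' i) (x2 i r).
  move=> r0; rewrite /x2 derive1nS derive1n1; apply: derivable_coord.
  by have := C2 1%N r isT r0; rewrite derive1n1.
have S (r : R) : 0 < r -> dot (x^~ r) (x^~ r) = 1.
  by move=> r0; apply/sphere2E/sph; exact: ltW.
have Z (r : R) : 0 < r -> dot (x^~ r) (x'^~ r) = 0.
  move=> r0; have H0 := dx 0 r r0; have H1 := dx 1 r r0; have H2 := dx 2 r r0.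
  have D1 : is_derive r 1 (fun t => dot (x^~ t) (x^~ t)) (2 * dot (x^~ r) (x'^~ r)).
    by rewrite /dot; dereq; ring.
  have D2 : is_derive r 1 (fun t => dot (x^~ t) (x^~ t)) 0.
    by apply: (@der_near _ (fun=> 1)); apply: pos_near => // t t0; rewrite S.
  have := @derive_val _ _ _ _ _ _ _ D1; rewrite (@derive_val _ _ _ _ _ _ _ D2); lra.
have W (r : R) : 0 < r -> dot (x'^~ r) (x'^~ r) + dot (x^~ r) (x2^~ r) = 0.
  move=> r0; have H0 := dx 0 r r0; have H1 := dx 1 r r0; have H2 := dx 2 r r0.
  have K0 := dx' 0 r r0; have K1 := dx' 1 r r0; have K2 := dx' 2 r r0.
  have D1 : is_derive r 1 (fun t => dot (x^~ t) (x'^~ t))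
      (dot (x'^~ r) (x'^~ r) + dot (x^~ r) (x2^~ r)).
    by rewrite /dot; dereq; ring.
  have D2 : is_derive r 1 (fun t => dot (x^~ t) (x'^~ t)) 0.
    by apply: (@der_near _ (fun=> 0)); apply: pos_near => // t t0; rewrite Z.
  by have := @derive_val _ _ _ _ _ _ _ D1; rewrite (@derive_val _ _ _ _ _ _ _ D2).
have A i (r : R) : 0 < r -> x2 i r = profile_rhs alpha beta d r (x^~ r) (x'^~ r) i.
  move=> r0; have rn0 : r != 0 by rewrite gt_eqF.
  pose m : R := d%:R; pose c : R := (m - 2 + x 2 r) / r ^+ 2.
  pose B j := x2 j r + (m - 1) / r * x' j r + c * pole j.
  pose g j := - (r / 2) * (alpha * cross (x^~ r) (x'^~ r) j + beta * x' j r).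
  have gB j : cross (x^~ r) B j = g j.
    have /rowP/(_ j) := eqn r r0; rewrite !mxE -natd -/d => /esym.
    by move=> E; exact: E.
  have K := crossK (x^~ r) B i; rewrite S// mulr1 in K.
  have XB : dot (x^~ r) B = - dot (x'^~ r) (x'^~ r) + c * x 2 r.
    have -> : dot (x^~ r) B = dot (x^~ r) (x2^~ r) + (m - 1) / r * dot (x^~ r) (x'^~ r) + c * x 2 r.
      by rewrite /B /dot !poleE; ring.
    by rewrite Z// mulr0 addr0; have := W r r0; lra.
  have KG : cross (x^~ r) (cross (x^~ r) B) i =
      - (r / 2) * (- (alpha * x' i r) + beta * cross (x^~ r) (x'^~ r) i).
    have -> : cross (x^~ r) (cross (x^~ r) B) i = cross (x^~ r) g i.
      by rewrite /cross -/(cross (x^~ r) B (i + 1)) -!/(cross (x^~ r) B _) !gB.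
    have -> : cross (x^~ r) g i = - (r / 2) * (alpha * cross (x^~ r) (cross (x^~ r) (x'^~ r)) i
        + beta * cross (x^~ r) (x'^~ r) i).
      by rewrite /g {1}/cross [in RHS]/cross; rewrite /cross; ring.
    by rewrite crossK Z// S//; ring.
  rewrite KG XB in K.
  have -> : x2 i r = B i - (m - 1) / r * x' i r - c * pole i by rewrite /B; ring.
  have -> : B i = x i r * (- dot (x'^~ r) (x'^~ r) + c * x 2 r) -
      - (r / 2) * (- (alpha * x' i r) + beta * cross (x^~ r) (x'^~ r) i) by rewrite K; ring.
  by rewrite /profile_rhs /c -/m; ring.
have xv i : (x i t - pole i) / t @[t --> 0^'+] --> v 0 i.
  have := @cvg_coord _ _ _ _ _ _ i psi_v.
  under eq_fun do rewrite !mxE psi0 e3E mulrC.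
  exact.
have xp i : x i t @[t --> 0^'+] --> pole i.
  have E0 : pole i + 0 * v 0 i = pole i by rewrite mul0r addr0.
  have id0 : t @[t --> (0 : R)^'+] --> 0 by apply: cvg_at_right_filter; exact: cvg_id.
  have H : pole i + t * ((x i t - pole i) / t) @[t --> 0^'+] --> pole i.
    by rewrite -[X in _ --> X]E0; apply: cvgD; [exact: cvg_cst|exact: cvgM].
  apply: cvg_trans H; apply: near_eq_cvg; near=> t.
  have t0 : 0 < t by near: t; exact: nbhs_right_gt.
  by field; rewrite gt_eqF.
split => // [T|i].
  split => [i r /andP[r0 _]|i r /andP[r0 _]|r /andP[r0 _]].
  - exact: dx.
  - by rewrite -A//; exact: dx'.
  - exact: S.
have x'l : x' i t @[t --> 0^'+] --> l 0 i by exact: cvg_coord.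
suff -> : v 0 i = l 0 i by [].
exact: cvg_unique (xv i) (slope_cvg_at_right (dx i) (xp i) x'l).
Unshelve. all: by end_near. Qed.

(** Bootstrap: for [r > 0] the second derivative is polynomial in [x], [x'], [r] and [1 / r], so
    each round gains one derivative. *)
Lemma global_profile_smooth (v : 'I_3 -> R) x x' : global_profile alpha beta d v x x' ->
  forall k i, smooth_upto k (x i) /\ smooth_upto k (x' i).
Proof.
move=> gp; elim=> [|k IH] i.
  by split => r r0; apply: der_continuous; [exact: (gp_der gp i r0)|exact: (gp_der2 gp i r0)].
split.
  by exists (x' i); split; [exact: (gp_der gp i)|exact: (IH i).2].
exists (fun r => profile_rhs alpha beta d r (x^~ r) (x'^~ r) i); split.
  exact: (gp_der2 gp i).
have sx j := (IH j).1; have sx' j := (IH j).2.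
rewrite /profile_rhs /dot /cross.
have sX2 : smooth_upto k (fun t : R => t ^+ 2).
  apply: (@smooth_upto_ext _ _ (fun t => t * t)) => [r _|]; first by rewrite expr2.
  by apply: smooth_uptoM; exact: smooth_upto_id.
have sV2 : smooth_upto k (fun t : R => t ^- 2).
  apply: (@smooth_upto_ext _ _ (fun t => t^-1 * t^-1)) => [r _|]; first by rewrite expr2 invfM.
  by apply: smooth_uptoM; exact: smooth_upto_inv.
repeat first [exact: smooth_upto_cst | exact: smooth_upto_id | exact: smooth_upto_inv
 | exact: sV2 | exact: sx | exact: sx' | apply: smooth_uptoD | apply: smooth_uptoN
 | apply: smooth_uptoM].
Qed.

Lemma profile_global_solution v x x' : global_profile alpha beta d (v 0) x x' ->
  (forall i, x i 0 = pole i) ->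
  let psi r := \row_i x i r in
  global_solution alpha beta n v psi /\ smooth_pos psi.
Proof.
move=> gp x0 psi.
have psiE r i : psi r 0 i = x i r by rewrite mxE.
have psi0 : psi 0 = e3 by apply/rowP => i; rewrite psiE x0 e3E.
have D1 (r : R) : 0 < r -> derivable psi r 1 /\ forall i, psi^`() r 0 i = x' i r.
  move=> r0; apply: derivable_of_coord => i.
  by under eq_fun do rewrite psiE; exact: (gp_der gp i r0).
have D2 (r : R) i : 0 < r ->
    psi^`(2) r 0 i = profile_rhs alpha beta d r (x^~ r) (x'^~ r) i.
  move=> r0; rewrite derive1nS derive1n1.
  have [] := @derivable_of_coord R psi^`() r (profile_rhs alpha beta d r (x^~ r) (x'^~ r)).
    move=> j; apply: (@der_near _ (x' j)); last exact: (gp_der2 gp j r0).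
    by apply: pos_near => // t t0; rewrite (D1 t t0).2.
  by move=> _ ->.
have sm : smooth_pos psi.
  move=> k; apply: Ck_pos_of_smooth => i.
  by under eq_fun do rewrite psiE; exact: (global_profile_smooth gp k i).1.
have [_ xv x'v] := gp.
have rd : is_right_derive0 psi v.
  apply: cvg_row => i; under eq_fun do rewrite !mxE x0 mulrC.
  exact: xv.
split=> //; split.
- move=> r; rewrite le_eqVlt => /predU1P[<-|r0]; apply/sphere2E.
    by rewrite psi0 /dot !e3E !poleE; ring.
  by rewrite /dot !psiE; exact: (gp_sphere gp r0).
- split; last exact: sm; split; first exact: sm.
  exists v => //; apply: cvg_row => i; apply: cvg_trans (x'v i).
  apply: near_eq_cvg; near=> t.
  have t0 : 0 < t by near: t; exact: nbhs_right_gt.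
  by rewrite (D1 t t0).2.
- move=> r r0; have rn0 : r != 0 by rewrite gt_eqF.
  have psi_x : psi r 0 = x^~ r by apply/funext => j; rewrite psiE.
  have psi_x' : psi^`() r 0 = x'^~ r by apply/funext => j; rewrite (D1 r r0).2.
  apply/rowP => i; rewrite crosspE psi_x.
  have -> : (psi^`(2)%classic r + ((2 * n%:R - 1) / r) *: psi^`()%classic r
      + ((2 * n%:R - 2 + x 2 r) / r ^+ 2) *: e3) 0 =
    (fun j => profile_rhs alpha beta d r (x^~ r) (x'^~ r) j + (d%:R - 1) / r * x' j r
      + (d%:R - 2 + x 2 r) / r ^+ 2 * pole j).
    by apply/funext => j; rewrite natd -D2// -(D1 r r0).2 -e3E [LHS]mxE [X in X + _]mxE
      [X in _ + X + _]mxE [X in _ + _ + X]mxE.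
  have -> : (- (r / 2) *: (alpha *: crossp (psi r) (psi^`()%classic r) + beta *: psi^`()%classic r)) 0 i =
      - (r / 2) * (alpha * cross (x^~ r) (x'^~ r) i + beta * x' i r).
    by rewrite [LHS]mxE [X in _ * X]mxE [X in _ * (X + _)]mxE [X in _ * (_ + X)]mxE crosspE
      psi_x psi_x'.
  have S := gp_sphere gp r0; have Z := gp_tangent gp r0.
  set a := (X in X = _); set b := (X in _ = X).
  (* The equation holds up to multiples of the constraints [x . x' = 0] and [|x|^2 = 1]. *)
  have -> : b = a + r / 2 * beta * (x i r * dot (x^~ r) (x'^~ r)
      - x' i r * (dot (x^~ r) (x^~ r) - 1)).
    rewrite /a /b {a b}; elim/ord3_ind: i;
      rewrite /profile_rhs /cross /dot !ord3_addE !poleE; field; exact: rn0.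
  by rewrite Z S subrr !mulr0 subr0 mulr0 addr0.
- by [].
Unshelve. all: by end_near. Qed.

End translation.

(** * Infinite energy *)

Section infinite_energy.
Context {R : realType}.

(** [c] times the indicator of [A] is one of the simple functions whose supremum is the integral.
    This form applies to integrands whose measurability has not been established, such as the energy
    density. *)
Lemma integral_ge_scaled_measure dT (T : measurableType dT) (mu : {measure set T -> \bar R})
    (f : T -> \bar R) (A : set T) (c : R) :
  (forall x, (0 <= f x)%E) -> measurable A -> 0 <= c ->
  (forall x, A x -> (c%:E <= f x)%E) -> (c%:E * mu A <= \int[mu]_x f x)%E.
Proof.
move=> f0 mA c0 cf; rewrite ge0_integralTE//.
apply: ereal_sup_ubound; exists (scale_nnsfun (indic_nnsfun R mA) c0) => /=.
  move=> x; rewrite /measurable_realfun.mindic indicE; have [xA|xA] := boolP (x \in A).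
    by rewrite mulr1; apply: cf; rewrite inE in xA.
  by rewrite mulr0.
transitivity (c%:E * sintegral mu (measurable_realfun.mindic R mA))%E.
  exact: (sintegralrM mu c (indic_nnsfun R mA)).
by congr (_ * _)%E; exact: sintegral_indic.
Qed.

Definition tuple_box (n : nat) (a b : R) : set (n.-tuple (measurableTypeR R)) :=
  [set t | forall i, a <= tnth t i <= b].

Lemma measurable_tuple_box n (a b : R) : measurable (@tuple_box n a b).
Proof.
have -> : @tuple_box n a b = \bigcap_(i in [set: 'I_n]) ((fun t => tnth t i) @^-1` `[a, b]).
  apply/seteqP; split => t /=.
    by move=> H i _ /=; rewrite in_itv/= H.
  by move=> H i; have := H i Logic.I; rewrite /= in_itv.
apply: fin_bigcap_measurable; first exact: finite_finset.
move=> i _; rewrite -[X in measurable X]setTI.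
by apply: measurable_tnth => //; exact: measurable_itv.
Qed.

Lemma lebesgue_tuple_box n (a b : R) : a <= b ->
  @lebesgue_tuple R n (tuple_box a b) = ((b - a) ^+ n)%:E.
Proof.
move=> leab; elim: n => [|n IH] /=.
  by rewrite expr0 diracE mem_set// => -[].
rewrite /pushforward.
have -> : @tuple_of_pair R n @^-1` tuple_box a b = `[a, b]%classic `*` @tuple_box n a b.
  apply/seteqP; split => -[x t] /=.
    move=> H; split.
      by have := H ord0; rewrite (tnth_nth 0)/= in_itv.
    by move=> i; have := H (lift ord0 i); rewrite !(tnth_nth 0).
  move=> [H1 H2] i; rewrite (tnth_nth 0) /=.
  have [->|[j ->]] : i = ord0 \/ exists j, i = lift ord0 j.
    by case: (unliftP ord0 i) => [j ->|->]; [right; exists j|left].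
  - by move: H1; rewrite in_itv.
  - by have := H2 j; rewrite (tnth_nth 0).
rewrite product_measure1E; [|exact: measurable_itv|exact: measurable_tuple_box].
have mab : lebesgue_measure (`[a, b]%classic : set R) = (b - a)%:E.
  rewrite lebesgue_measure_itv/= lte_fin.
  move: leab; rewrite le_eqVlt => /predU1P[->|ab]; first by rewrite ltxx subrr.
  by rewrite ab -EFinD.
transitivity ((b - a)%:E * ((b - a) ^+ n)%:E)%E; last by rewrite -EFinM exprS.
by congr (_ * _)%E; [exact: mab|exact: IH].
Qed.

(** One cube suffices at each scale: [[N, 2 N]^(2 n)] has volume at least [N^4], and on it
    [|x|^2 <= 8 n N^2], so it contributes at least a multiple of [N^2]. *)
Lemma radial_integral_infty (n : nat) (f : R -> R) (c : R) : (2 <= n)%N -> 0 < c ->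
  (forall r : R, 0 <= r -> 0 <= f r) -> (forall r : R, 1 <= r -> c / r ^+ 2 <= f r) ->
  (\int[@lebesgue_tuple R (2 * n)%N]_x (f (Num.sqrt (\sum_i tnth x i ^+ 2)))%:E = +oo)%E.
Proof.
move=> n2 c0 f0 fc; apply/eqP; rewrite eq_le leey/=.
set I := (X in (_ <= X)%E).
have n0 : 0 < n%:R :> R by rewrite ltr0n; apply: leq_trans n2.
have bound (N : R) : 1 <= N -> ((c / (8 * n%:R) * N ^+ 2)%:E <= I)%E.
  move=> N1; have N0 : 0 < N by exact: lt_le_trans N1.
  pose cN := c / (8 * n%:R * N ^+ 2).
  have cN0 : 0 <= cN by rewrite /cN divr_ge0 ?mulr_ge0 ?exprn_ge0// ltW.
  apply: (@le_trans _ _ (cN%:E * @lebesgue_tuple R (2 * n)%N (tuple_box N (2 * N)))%E).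
    rewrite lebesgue_tuple_box; last by lra.
    rewrite -EFinM lee_fin.
    have -> : 2 * N - N = N by ring.
    have -> : c / (8 * n%:R) * N ^+ 2 = cN * N ^+ 4.
      by rewrite /cN; field; rewrite !gt_eqF.
    rewrite ler_wpM2l// ler_weXn2l//.
    by rewrite (leq_mul2l 2 2 n).
  apply: integral_ge_scaled_measure => //.
  - by move=> x; rewrite lee_fin f0// sqrtr_ge0.
  - exact: measurable_tuple_box.
  move=> x xB; rewrite lee_fin.
  set s := \sum_i _; pose rho := Num.sqrt s; rewrite -/rho.
  have s_ge : N ^+ 2 <= s.
    have i0 : 'I_(2 * n).
      by exists 0%N; rewrite muln_gt0 (leq_trans _ n2).
    rewrite /s (bigD1 i0)//=; apply: ler_wpDr.
      by apply: sumr_ge0 => j _; exact: sqr_ge0.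
    have /andP[h _] := xB i0; rewrite lerXn2r ?nnegrE ?(ltW N0)//.
    exact: le_trans (ltW N0) h.
  have s_le : s <= 8 * n%:R * N ^+ 2.
    have -> : 8 * n%:R * N ^+ 2 = \sum_(i < 2 * n) (2 * N) ^+ 2.
      by rewrite sumr_const card_ord -[RHS]mulr_natl natrM; ring.
    apply: ler_sum => i _; have /andP[h1 h2] := xB i.
    have h0 : 0 <= tnth x i by exact: le_trans (ltW N0) h1.
    by rewrite lerXn2r ?nnegrE ?mulr_ge0 ?(ltW N0).
  have s0 : 0 < s by apply: lt_le_trans s_ge; rewrite exprn_gt0.
  have rho2 : rho ^+ 2 = s by rewrite sqr_sqrtr// ltW.
  have rho1 : 1 <= rho.
    rewrite -(@ler_pXn2r _ 2)// ?nnegrE ?sqrtr_ge0// rho2 expr1n.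
    by apply: le_trans s_ge; rewrite exprn_ege1.
  apply: le_trans (fc _ rho1); rewrite rho2 /cN ler_pM2l// lef_pV2 ?posrE//.
  exact: lt_le_trans s_le.
have : (0 <= I)%E by apply: integral_ge0 => x _; rewrite lee_fin f0// sqrtr_ge0.
case: (I) bound => // r bound _.
pose K := c / (8 * n%:R).
have K0 : 0 < K by rewrite /K divr_gt0// mulr_gt0.
have rK : 0 <= `|r| / K by rewrite divr_ge0// ltW.
have := bound (`|r| / K + 1) (ltac:(lra)); rewrite lee_fin -/K.
have h : `|r| / K + 1 <= (`|r| / K + 1) ^+ 2 by rewrite expr2 ler_peMl; lra.
have := ler_wpM2l (ltW K0) h.
have -> : K * (`|r| / K + 1) = `|r| + K by field; rewrite gt_eqF.
move=> h1 /(le_trans h1).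
by rewrite leNgt (le_lt_trans (ler_norm r))// ltrDl.
Qed.

End infinite_energy.

(** * Conclusion *)

Section main.
Context {R : realType}.
Variables (n : nat) (alpha beta : R).
Hypothesis hn : (2 <= n)%N.
Hypothesis alpha0 : 0 <= alpha.
Hypothesis ab : alpha ^+ 2 + beta ^+ 2 = 1.
Let d := (2 * n)%N.
Implicit Types (psi : R -> 'rV[R]_3) (v : 'rV[R]_3).

Let d4 : 4 <= d%:R :> R.
Proof. by rewrite ler_nat /d (leq_mul2l 2 2 n). Qed.

Let d2 : 2 <= d%:R :> R.
Proof. by apply: le_trans d4; rewrite ler_nat. Qed.

Lemma row_coord_bound v i : `|v 0 i| <= `|v|.
Proof. by rewrite [leRHS]/Num.Def.normr/= mx_normrE; exact: (le_bigmax _ _ (0, i)). Qed.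

Lemma global_solution_exists v : tangent_sphere2 e3 v ->
  exists psi, global_solution alpha beta n v psi /\ smooth_pos psi.
Proof.
move=> /tangent_sphere2E v2.
have [M M0 HM] := global_profile_exists beta alpha0 d2 (normr_ge0 v).
have [x [x' [gp x0 _]]] := HM (v 0) v2 (row_coord_bound v).
by exists (fun r => \row_i x i r); exact: profile_global_solution gp x0.
Qed.

Lemma global_solution_unique v psi phi : global_solution alpha beta n v psi ->
  global_solution alpha beta n v phi -> forall r : R, 0 <= r -> phi r = psi r.
Proof.
move=> gs gs' r; rewrite le_eqVlt => /predU1P[<-|r0].
  by case: gs gs' => _ _ _ [-> _] [_ _ _ [-> _]].
apply/rowP => i.
exact: (global_profile_unique alpha0 d2 (global_solution_profile gs') (global_solution_profile gs)).
Qed.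

Lemma enorm_sqrt (u : 'rV[R]_3) : enorm u = Num.sqrt (dot (u 0) (u 0)).
Proof. by rewrite /enorm dotpE. Qed.

Lemma global_solution_potential v psi : v != 0 -> global_solution alpha beta n v psi ->
  forall s : R, 0 < s ->
    exists2 c : R, 0 < c & forall r : R, s <= r -> c <= potential d (psi r 0 2).
Proof.
move=> v0 gs s s0; have gp := global_solution_profile gs.
have vi : exists i, v 0 i != 0.
  apply/not_existsP => H; move/negP: v0; apply; apply/eqP/rowP => i.
  by rewrite mxE; apply/eqP; apply/negPn/negP => vi; exact: (H i).
have d2' : 2 < d%:R :> R by apply: lt_le_trans d4; rewrite ltr_nat.
have E0 := gp_energy_lt0 gp alpha0 d2 d2' vi s0.
exists (- profile_energy d (fun i r => psi r 0 i) (fun i r => psi^`() r 0 i) s).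
  by rewrite oppr_gt0.
by move=> r sr; exact: (gp_potential_ge gp).
Qed.

Lemma potential1 : potential d (1 : R) = 0.
Proof. by rewrite /potential; ring. Qed.

(** The constant comes before [v] in the quantifiers: this uniform rate is what carries continuous
    dependence from finite [r] to the limit. *)
Lemma global_solution_tail : exists C : R, forall v psi, global_solution alpha beta n v psi ->
  exists l : 'rV[R]_3, forall i (r : R), 0 < r -> `|psi r 0 i - l 0 i| <= C / r ^+ 2.
Proof.
have [C HC] := gp_tail alpha0 d4 ab; exists C => v psi gs.
have [l Hl] := HC _ _ _ (global_solution_profile gs).
by exists (\row_i l i) => i r; rewrite mxE; exact: Hl.
Qed.

Lemma inv_sqr_tail (C e : R) : 0 < e -> exists2 T : R, 1 <= T & forall r : R, T <= r -> C / r ^+ 2 <= e.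
Proof.
move=> e0; exists (`|C| / e + 1); first by rewrite lerDr divr_ge0// ltW.
move=> r rT; have Ce : 0 <= `|C| / e by rewrite divr_ge0// ltW.
have r1 : 1 <= r by lra.
rewrite ler_pdivrMr ?exprn_gt0//; last by lra.
apply: le_trans (ler_norm C) _; rewrite -ler_pdivrMl// mulrC.
apply: (@le_trans _ _ r); first by lra.
by rewrite expr2 ler_peMl//; lra.
Qed.

Lemma tail_cvg (C : R) psi (l : 'rV[R]_3) :
  (forall i (r : R), 0 < r -> `|psi r 0 i - l 0 i| <= C / r ^+ 2) -> psi r @[r --> +oo] --> l.
Proof.
move=> H; apply: cvg_row => i; apply/cvgrPdist_le => e e0.
have [T T1 HT] := inv_sqr_tail C e0.
near=> r.
have Tr : T <= r by near: r; apply: nbhs_pinfty_ge; exact: num_real.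
by rewrite distrC; apply: le_trans (H i r _) (HT r Tr); lra.
Unshelve. all: by end_near. Qed.

Lemma limit_sphere v psi (l : 'rV[R]_3) : global_solution alpha beta n v psi ->
  psi r @[r --> +oo] --> l -> sphere2 l.
Proof.
move=> gs psil; apply/sphere2E.
have xl i : psi r 0 i @[r --> +oo] --> l 0 i by exact: cvg_coord.
have H : dot (psi r 0) (psi r 0) @[r --> +oo] --> dot (l 0) (l 0).
  by rewrite /dot; repeat apply: cvgD; apply: cvgM.
suff H1 : dot (psi r 0) (psi r 0) @[r --> +oo] --> (1 : R) by exact: cvg_unique H H1.
have : cst (1 : R) (r : R) @[r --> +oo] --> (1 : R) by exact: cvg_cst.
apply: cvg_trans; apply: near_eq_cvg; near=> r.
have r0 : 0 < r by near: r; exact: nbhs_pinfty_gt.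
by rewrite /=; have := gp_sphere (global_solution_profile gs) r0.
Unshelve. all: by end_near. Qed.

Lemma limit_neq_e3 v psi (l : 'rV[R]_3) : v != 0 -> global_solution alpha beta n v psi ->
  psi r @[r --> +oo] --> l -> l <> e3.
Proof.
move=> v0 gs psil le3.
have [c c0 Hc] := global_solution_potential v0 gs (@ltr01 R).
have H : potential d (psi r 0 2) @[r --> +oo] --> potential d (l 0 2).
  apply: continuous_cvg; [exact: potential_continuous|exact: cvg_coord].
have : c <= potential d (l 0 2).
  by apply: (cvgr_to_ge H); near=> r; apply: Hc; near: r; exact: nbhs_pinfty_ge.
by rewrite le3 e3E poleE potential1 leNgt c0.
Unshelve. all: by end_near. Qed.

Lemma global_solution_energy v psi : v != 0 -> global_solution alpha beta n v psi ->
  energy n psi = +oo%E.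
Proof.
move=> v0 gs; have [c c0 Hc] := global_solution_potential v0 gs (@ltr01 R).
have gp := global_solution_profile gs; have [sph _ _ _] := gs.
have n1 : 0 <= 2 * n%:R - 2 :> R by have := d2; rewrite natd; lra.
rewrite /energy (@radial_integral_infty R n (energy_density n psi) c) //.
- by rewrite mulry gtr0_sg ?mul1e// divr_gt0.
- move=> r r0; rewrite /energy_density addr_ge0 ?sqr_ge0// divr_ge0 ?sqr_ge0//.
  by rewrite !addr_ge0 ?sqr_ge0// mulr_ge0 ?sqr_ge0.
- move=> r r1; rewrite /energy_density; apply: ler_wpDl; first exact: sqr_ge0.
  have r0 : 0 < r by lra.
  rewrite ler_wpM2r ?invr_ge0 ?sqr_ge0//.
  have S := gp_sphere gp r0.
  have -> : psi r 0 0 ^+ 2 + psi r 0 1 ^+ 2 + (2 * n%:R - 2) * enorm (psi r - e3) ^+ 2 =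
      potential d (psi r 0 2) + (d%:R - 1) * (dot (psi r 0) (psi r 0) - 1).
    rewrite enormE natd /potential natd /dot.
    have E i : (psi r - e3) 0 i = psi r 0 i - pole i.
      by rewrite mxE [X in _ + X]mxE e3E.
    by rewrite !E !poleE; ring.
  by rewrite S subrr mulr0 addr0; exact: Hc.
Qed.

Lemma global_solution_speed v psi : global_solution alpha beta n v psi ->
  0 < alpha -> exists C : R, forall r : R, 0 < r -> enorm (psi^`()%classic r) <= C / r ^+ 3.
Proof.
move=> gs al0; have gp := global_solution_profile gs.
pose B := 4 * (d%:R - 1) ^+ 2 / alpha ^+ 2.
exists (Num.sqrt B) => r r0.
have B0 : 0 <= B by rewrite /B divr_ge0 ?sqr_ge0// mulr_ge0 ?sqr_ge0.
have r3 : 0 < r ^+ 3 by rewrite exprn_gt0.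
rewrite enorm_sqrt ler_pdivlMr// -[X in _ * X]gtr0_norm// -sqrtr_sqr -sqrtrM ?dot_ge0//.
rewrite ler_sqrt// -exprM mulrC.
exact: (gp_speed_cubic d4 al0 gp r0).
Qed.

Lemma global_solution_speed0 v psi (l : 'rV[R]_3) : global_solution alpha beta n v psi ->
  psi r @[r --> +oo] --> l -> alpha = 0 ->
  r * enorm (psi^`()%classic r) @[r --> +oo] --> (0 : R).
Proof.
move=> gs psil al0; have gp := global_solution_profile gs.
have psil2 : psi r 0 2 @[r --> +oo] --> l 0 2 by exact: cvg_coord.
have H := gp_speed_cvg0 alpha0 d4 al0 gp psil2.
have : Num.sqrt (r ^+ 2 * dot (psi^`()%classic r 0) (psi^`()%classic r 0)) @[r --> +oo]
    --> Num.sqrt (0 : R).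
  by apply: continuous_cvg H; exact: sqrt_continuous.
rewrite sqrtr0; apply: cvg_trans; apply: near_eq_cvg; near=> r.
have r0 : 0 < r by near: r; exact: nbhs_pinfty_gt.
by rewrite /= sqrtrM ?sqr_ge0// sqrtr_sqr gtr0_norm// enorm_sqrt.
Unshelve. all: by end_near. Qed.

(** Identifies the limit attached to [v = 0] as [e_3], so that continuity at [0] yields the
    behaviour as [v] tends to [0]. *)
Lemma constant_solution : global_solution alpha beta n 0 (fun=> e3).
Proof.
have gp : global_profile alpha beta d ((0 : 'rV[R]_3) 0) (fun i _ => pole i) (fun _ _ => 0).
  split=> [T|i|i].
  - split=> [i r _|i r _|r _].
    + exact: der_cst.
    + apply: (der_eq (der_cst 0 r)); rewrite /profile_rhs.
      by elim/ord3_ind: i; rewrite /cross /dot !ord3_addE !poleE; ring.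
    + by rewrite /dot !poleE; ring.
  - by rewrite mxE; under eq_fun do rewrite subrr mul0r; exact: cvg_cst.
  - by rewrite mxE; exact: cvg_cst.
have [gs _] := profile_global_solution gp (fun i => erefl).
have E : (\row_i pole i : 'rV[R]_3) = e3 by apply/rowP => i; rewrite mxE e3E.
by rewrite -E.
Qed.

(** A three-term estimate at one radius [T]: the uniform tail controls the distance of each solution
    to its limit, and continuous dependence compares the two solutions at [T]. *)
Lemma asymptotic_limit_continuous (C : R) (f : 'rV[R]_3 -> 'rV[R]_3) :
  (forall v psi, tangent_sphere2 e3 v -> global_solution alpha beta n v psi ->
    forall i (r : R), 0 < r -> `|psi r 0 i - f v 0 i| <= C / r ^+ 2) ->
  forall (v0 : 'rV[R]_3) (e : R), tangent_sphere2 e3 v0 -> 0 < e ->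
    \forall v \near v0, tangent_sphere2 e3 v -> `|f v0 - f v| <= e.
Proof.
move=> Hf v0 e tv0 e0.
have A0 : 0 <= `|v0| + 1 by rewrite addr_ge0.
have e30 : 0 < e / 3 by rewrite divr_gt0.
have [T T1 HT] := inv_sqr_tail C e30.
have T0 : 0 < T by lra.
have [K K0 HK] := global_profile_continuous beta alpha0 d2 A0 (ltr_wpDl (ltW T0) ltr01).
have [psi0 [gs0 _]] := global_solution_exists tv0.
(* The bound [1] keeps [v] in the ball of radius [|v0| + 1] for which [K] was chosen; [K + 1] avoids
   dividing by a possibly zero [K]. *)
have de0 : 0 < Num.min 1 (e / 3 / (K + 1)).
  by rewrite lt_min ltr01 divr_gt0//; lra.
near=> v => tv.
have vv0 : `|v0 - v| < Num.min 1 (e / 3 / (K + 1)).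
  by near: v; apply: cvgr_dist_lt => //; exact: cvg_id.
move: vv0; rewrite lt_min => /andP[v1 vd].
have [psi [gs _]] := global_solution_exists tv.
have vA : `|v| <= `|v0| + 1.
  have : `|v| <= `|v0| + `|v0 - v| by rewrite -[X in `|X| <= _](subKr v0) ler_normB.
  lra.
rewrite /Num.Def.normr/= mx_normrE (bigmax_le _ (ltW e0))//= => -[j i] _ /=.
rewrite ord1 mxE [X in _ + X]mxE.
have H0 := Hf v0 psi0 tv0 gs0 i T T0; have H1 := Hf v psi tv gs i T T0.
have H2 : `|psi0 T 0 i - psi T 0 i| <= K * `|v0 - v|.
  have TT : 0 < T < T + 1 by rewrite T0/= ltrDl.
  have vv i1 : `|v0 0 i1 - v 0 i1| <= `|v0 - v|.
    by have := row_coord_bound (v0 - v) i1; rewrite mxE [X in _ + X]mxE.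
  apply: (HK _ _ _ _ _ _ _ _ _ _ _ vv (global_solution_profile gs0) (global_solution_profile gs) i T TT).
  - exact/tangent_sphere2E.
  - exact/tangent_sphere2E.
  - by move=> i1; apply: le_trans (row_coord_bound v0 i1) _; rewrite lerDl.
  - by move=> i1; apply: le_trans (row_coord_bound v i1) vA.
have H3 : K * `|v0 - v| <= e / 3.
  apply: (@le_trans _ _ ((K + 1) * `|v0 - v|)); first by rewrite ler_wpM2r//; lra.
  by rewrite mulrC -ler_pdivlMr ?ltW//; lra.
have HTT := HT T (lexx _).
have -> : f v0 0 i - f v 0 i = - (psi0 T 0 i - f v0 0 i) + (psi0 T 0 i - psi T 0 i)
   + (psi T 0 i - f v 0 i) by ring.
apply: le_trans (ler_normD _ _) _.
apply: le_trans (lerD (ler_normD _ _) (lexx _)) _; rewrite normrN; lra.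
Unshelve. all: by end_near. Qed.

End main.

Theorem theorem1p1 (R : realType) (n : nat) (hn : (2 <= n)%N)
    (alpha beta : R) (halpha : 0 <= alpha)
    (hab : alpha ^+ 2 + beta ^+ 2 = 1) :
  (forall v : 'rV[R]_3, tangent_sphere2 e3 v ->
    exists psi : R -> 'rV[R]_3,
      [/\ global_solution alpha beta n v psi,
          forall phi : R -> 'rV[R]_3, global_solution alpha beta n v phi ->
            forall r : R, 0 <= r -> phi r = psi r,
          smooth_pos psi
        & v != 0 ->
          [/\ forall r : R, 0 < r -> psi r <> e3,
              (0 < alpha ->
                exists C : R, forall r : R, 0 < r ->
                  enorm (psi^`()%classic r) <= C / r ^+ 3)
              /\ (alpha = 0 ->
                r * enorm (psi^`()%classic r) @[r --> +oo] --> (0 : R)),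
              exists psi_infty : 'rV[R]_3,
                [/\ sphere2 psi_infty, psi_infty <> e3
                  & psi r @[r --> +oo] --> psi_infty]
            & energy n psi = +oo%E]])
  /\ exists psi_infty : 'rV[R]_3 -> 'rV[R]_3,
      [/\ forall (v : 'rV[R]_3) (psi : R -> 'rV[R]_3),
            tangent_sphere2 e3 v -> global_solution alpha beta n v psi ->
            psi r @[r --> +oo] --> psi_infty v,
          {within tangent_sphere2 e3, continuous psi_infty}
        & psi_infty v @[v --> within (tangent_sphere2 e3) (0 : 'rV[R]_3)^']
            --> (e3 : 'rV[R]_3)].
Proof.
have [C HC] := global_solution_tail hn halpha hab.
split.
  move=> v tv; have [psi [gs sm]] := global_solution_exists beta hn halpha tv.
  exists psi; split=> // [phi gs' r r0|v0].
    exact: (global_solution_unique hn halpha gs gs').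
  have [l Hl] := HC v psi gs; have psil := tail_cvg Hl.
  split.
  - move=> r r0 re3.
    have [c c0 Hc] := global_solution_potential hn halpha v0 gs r0.
    by have := Hc r (lexx r); rewrite re3 e3E poleE potential1 leNgt c0.
  - by split; [exact: (global_solution_speed hn gs)|
      exact: (global_solution_speed0 hn halpha gs psil)].
  - by exists l; split; [exact: (limit_sphere gs psil)|
      exact: (limit_neq_e3 hn halpha v0 gs psil)|].
  - exact: (global_solution_energy hn halpha v0 gs).
(* Outside the tangent plane the limit map takes the default value [0]. On it, uniqueness makes the
   limit of one chosen solution valid for all of them. *)
have /choice[f Hf] : forall v : 'rV[R]_3, exists l : 'rV[R]_3, tangent_sphere2 e3 v ->
    forall psi, global_solution alpha beta n v psi ->
    forall i (r : R), 0 < r -> `|psi r 0 i - l 0 i| <= C / r ^+ 2.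
  move=> v; have [tv|ntv] := pselect (tangent_sphere2 e3 v); last by exists 0.
  have [psi [gs _]] := global_solution_exists beta hn halpha tv.
  have [l Hl] := HC v psi gs; exists l => _ phi gs' i r r0.
  by rewrite (global_solution_unique hn halpha gs gs' (ltW r0)); exact: Hl.
have Hf' v psi (tv : tangent_sphere2 e3 v) (gs : global_solution alpha beta n v psi) := Hf v tv psi gs.
have fc := asymptotic_limit_continuous hn halpha Hf'.
exists f; split.
- by move=> v psi tv gs; exact: (tail_cvg (Hf' v psi tv gs)).
- apply/subspace_continuousP => v tv; apply/cvgrPdist_le => e e0.
  by rewrite near_withinE; exact: fc.
- have t0 : tangent_sphere2 e3 (0 : 'rV[R]_3) by apply/tangent_sphere2E; rewrite mxE.
  have f0 : f 0 = e3.
    apply/esym; apply: (@cvg_unique _ (@norm_hausdorff _ _) ((fun=> e3) @ +oo%R)).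
      exact: cvg_cst.
    exact: (tail_cvg (Hf' 0 _ t0 (constant_solution n alpha beta))).
  rewrite -[X in _ --> X]f0; apply/cvgrPdist_le => e e0.
  rewrite near_withinE; apply: nbhs_dnbhs; exact: fc.
Qed.
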